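(* Let $E,Q\in M_n(\mathbb C)$ and assume that at least one of $E$ and $Q$ is nonsingular. Then there exist $U,V\in GL_n(\mathbb C)$ such that, if $E$ is nonsingular, $$(UEV,U^{-*}QV)=\Big(I_n,\ \big(\bigoplus_{l=1}^{p}H_{2m_l}(\mu_l)\big)\oplus\big(\bigoplus_{j=1}^{q}e^{i\theta_j}\Delta_{n_j}\big)\oplus\big(\bigoplus_{k=1}^{s}J_{r_k}(0)\big)\Big),$$ and, if $Q$ is nonsingular, $$(UEV,U^{-*}QV)=\Big(I_{n-v}\oplus\big(\bigoplus_{k=1}^{s}J_{r_k}(0)^*\big),\ \big(\bigoplus_{l=1}^{p}H_{2m_l}(\mu_l)\big)\oplus\big(\bigoplus_{j=1}^{q}e^{i\theta_j}\Delta_{n_j}\big)\oplus I_v\Big),$$ where $v=\sum_{k=1}^{s}r_k$, $|\mu_l|>1$ and $0\le\theta_j<2\pi$. In each case the canonical form is uniquely determined by $(E,Q)$ up to permutations of pairs of summands.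
   Context: $M_n(\mathbb C)$ is the set of $n\times n$ complex matrices, $GL_n(\mathbb C)$ the nonsingular ones, $A^*$ is the conjugate transpose, $A^{-*}=(A^{-1})^*$. $\oplus$ is the block-diagonal direct sum; any of the families of summands may be empty. $J_n(\lambda)$ is the $n\times n$ upper Jordan block with eigenvalue $\lambda$ (ones on the superdiagonal). $\Delta_n$ is the $n\times n$ matrix whose nonzero entries are: in row $n+1-j$, the entry $1$ in column $j$ (for $1\le j\le n$) and the entry $i=\sqrt{-1}$ in column $j+1$ (for $1\le j\le n-1$); $\Delta_1=[1]$, $\Delta_2=\begin{bmatrix}0&1\\ 1&i\end{bmatrix}$. $H_{2n}(\mu)=\begin{bmatrix}0&I_n\\ J_n(\mu)&0\end{bmatrix}$. The pairs of summands are $(I_{2m_l},H_{2m_l}(\mu_l))$, $(I_{n_j},e^{i\theta_j}\Delta_{n_j})$, and $(I_{r_k},J_{r_k}(0))$ (respectively $(J_{r_k}(0)^*,I_{r_k})$). *)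

(* Defs.v *)
From HB Require Import structures.
From mathcomp Require Import all_boot all_order all_algebra.
From mathcomp Require Import reals trigo.
From mathcomp Require Export complex.

Set Implicit Arguments.
Unset Strict Implicit.
Unset Printing Implicit Defensive.

Import Order.TTheory GRing.Theory Num.Theory.
Local Open Scope ring_scope.
Local Open Scope sesquilinear_scope.

Definition dsummx (R : realType) (a b : nat)
    (A : 'M[R[i]]_a) (B : 'M[R[i]]_b) : 'M[R[i]]_(a + b) :=
  block_mx A 0 0 B.

Definition expi (R : realType) (theta : R) : R[i] :=
  (cos theta +i* sin theta)%C.

Definition Jordan (R : realType) (n : nat) (lambda : R[i]) : 'M[R[i]]_n :=
  \matrix_(a, b) (if a == b :> nat then lambda
                  else if a.+1 == b :> nat then 1 else 0).

(* Indices count from 0: the entry in row n + 1 - j and column j is at (a, b)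
   with a + b = n - 1, the one in row n + 1 - j and column j + 1 at (a, b) with
   a + b = n. *)
Definition Delta (R : realType) (n : nat) : 'M[R[i]]_n :=
  \matrix_(a, b) (if (a + b).+1 == n then 1
                  else if (a + b)%N == n then 'i%C else 0).

Definition Hmx (R : realType) (m : nat) (mu : R[i]) : 'M[R[i]]_(m + m) :=
  block_mx 0 1%:M (Jordan m mu) 0.

Record canonical_data (R : realType) (n : nat) := CanonicalData {
  cf_p : nat;
  cf_q : nat;
  cf_s : nat;
  cf_m : 'I_cf_p -> nat;
  cf_mu : 'I_cf_p -> R[i];
  cf_n : 'I_cf_q -> nat;
  cf_theta : 'I_cf_q -> R;
  cf_r : 'I_cf_s -> nat;
  cf_m_gt0 : forall l, (0 < cf_m l)%N;
  cf_mu_gt1 : forall l, 1 < `|cf_mu l|;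
  cf_n_gt0 : forall j, (0 < cf_n j)%N;
  cf_theta_itv : forall j, 0 <= cf_theta j < 2 * pi;
  cf_r_gt0 : forall k, (0 < cf_r k)%N;
  cf_dim : (\sum_(l < cf_p) (cf_m l + cf_m l) + \sum_(j < cf_q) cf_n j
            + \sum_(k < cf_s) cf_r k)%N = n
}.

(* The sum of the H and Delta summands; its size is n - v, where v is the sum of
   the cf_r k. *)
Definition regular_part (R : realType) (n : nat) (c : canonical_data R n) :=
  dsummx (\mxdiag_(l < cf_p c) Hmx (cf_m l) (cf_mu l))
         (\mxdiag_(j < cf_q c) (expi (cf_theta j) *: Delta R (cf_n j))).

Definition canonical_pair_E (R : realType) (n : nat) (c : canonical_data R n) :
    'M[R[i]]_n * 'M[R[i]]_n :=
  (1%:M,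
   castmx (cf_dim c, cf_dim c)
     (dsummx (regular_part c) (\mxdiag_(k < cf_s c) Jordan (cf_r k) 0))).

Definition canonical_pair_Q (R : realType) (n : nat) (c : canonical_data R n) :
    'M[R[i]]_n * 'M[R[i]]_n :=
  (castmx (cf_dim c, cf_dim c)
     (dsummx 1%:M (\mxdiag_(k < cf_s c) (Jordan (cf_r k) 0)^t*)),
   castmx (cf_dim c, cf_dim c) (dsummx (regular_part c) 1%:M)).

Definition transform (R : realType) (n : nat) (U V E Q : 'M[R[i]]_n) :
    'M[R[i]]_n * 'M[R[i]]_n :=
  (U *m E *m V, (invmx U)^t* *m Q *m V).

(* A pair of summands is determined by its type and parameters, so a permutation
   of pairs of summands is a permutation within each of the three families. *)
Definition same_up_to_perm (R : realType) (n : nat)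
    (c c' : canonical_data R n) : Prop :=
  [/\ exists2 f : 'I_(cf_p c) -> 'I_(cf_p c'), bijective f &
        forall l, cf_m (f l) = cf_m l /\ cf_mu (f l) = cf_mu l,
      exists2 g : 'I_(cf_q c) -> 'I_(cf_q c'), bijective g &
        forall j, cf_n (g j) = cf_n j /\ cf_theta (g j) = cf_theta j
    & exists2 h : 'I_(cf_s c) -> 'I_(cf_s c'), bijective h &
        forall k, cf_r (h k) = cf_r k].

(* Main.v *)
(* Both cases reduce to *congruence A -> S^* A S. If E is nonsingular, (E, Q) is
   taken to (I, C) exactly when Q E^-1 is *congruent to C. If Q is nonsingular, it
   is taken to (I + N^*, X + I), X regular and N nilpotent, exactly when (E Q^-1)^*
   is *congruent to X^-* + N, hence to X + N, because X^-* = (X^-1)^* X X^-1.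

   Existence. For singular A, restrict the form to the right orthogonal of its
   right kernel and divide by the kernel vectors in it: every block J_r(0) becomes
   J_{r-2}(0), and conversely the canonical form of this smaller form can be lifted
   to A. For nonsingular A, let l be an eigenvalue of T = A^-* A and k the index of
   T - l. If |l| <> 1, chains of length k for l and for 1 / conj l that pair
   nontrivially span a summand H_{2k}(l). If l = u^2 with |u| = 1, the form
   x^* A (T - l)^(k-1) y on ker (T - l)^k is nonzero, hence by polarization nonzero
   for some x = y, whose span under T splits off. There conj(u) A = H + i K with
   H^-1 K nilpotent, and a real change of generator makes all moments
   x^* H (H^-1 K)^e x vanish except the last, which becomes 1 or -1: this is
   u Delta_k or - u Delta_k.

   Uniqueness. The sizes r are read off from the dimensions of the iterated right
   orthogonals of the whole space. The other multiplicities are the rank of a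
   pairing on chains at l (for H_{2k}(l)) and the positive index of a Hermitian
   form on chains at u^2 (for u Delta_k), to which no other block contributes. *)
From mathcomp Require Import all_boot all_order all_algebra.
From mathcomp Require Import reals trigo.
From mathcomp Require Import perm ring lra zify.
Require Import Defs.
Set Implicit Arguments.
Unset Strict Implicit.
Unset Printing Implicit Defensive.
Import Order.TTheory GRing.Theory Num.Theory.
Local Open Scope ring_scope.
Local Open Scope sesquilinear_scope.
Reserved Notation "A ^H" (at level 2, left associativity, format "A ^H").

(** Nearly every vanishing statement, in existence and in uniqueness, comes from one linear
    equation, [K X = H X P] with [K] invertible and [P] nilpotent. For this reason generalized
    eigenspaces never appear: chains are matrices intertwined with a Jordan block. Their Gram
    matrices intertwine with Jordan blocks as well, so that a single corner entry decides whether
    they are invertible; taking the index of the eigenvalue as chain length is what makes this entry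
    nonzero for suitable chains.

    Multiplicities of the regular blocks are compared without forming a rank or a signature. On one
    of two congruent sums there is a linear family of chains with one parameter per counted block,
    on which the form takes the value [u^H u] or [2 u^H u]. On the other, one linear condition per
    counted block on the first column of the chain makes the value zero, respectively at most zero.
    With more parameters than conditions some nonzero [u] would satisfy them all, against the
    positivity of [u^H u]. This gives one inequality, and exchanging the two sums gives the
    other. *)

Definition adjmx (C : numClosedFieldType) m n (A : 'M[C]_(m, n)) : 'M[C]_(n, m) :=
  A^t*.
Notation "A ^H" := (adjmx A) : ring_scope.

(** * Congruence *)

Section Adjoint.
Variable C : numClosedFieldType.
Implicit Types (m n p q : nat).

Lemma adjK m n (A : 'M[C]_(m, n)) : A^H^H = A.
Proof. exact: trmxCK. Qed.

Lemma adjE m n (A : 'M[C]_(m, n)) i j : A^H i j = (A j i)^*.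
Proof. by rewrite !mxE. Qed.

Lemma adjM m n p (A : 'M[C]_(m, n)) (B : 'M[C]_(n, p)) :
  (A *m B)^H = B^H *m A^H.
Proof. by rewrite /adjmx trmx_mul map_mxM. Qed.

Lemma adjD m n (A B : 'M[C]_(m, n)) : (A + B)^H = A^H + B^H.
Proof. by rewrite /adjmx linearD map_mxD. Qed.

Lemma adjN m n (A : 'M[C]_(m, n)) : (- A)^H = - A^H.
Proof. by rewrite /adjmx linearN map_mxN. Qed.

Lemma adjZ m n a (A : 'M[C]_(m, n)) : (a *: A)^H = a^* *: A^H.
Proof. by rewrite /adjmx linearZ map_mxZ. Qed.

Lemma adj0 m n : (0 : 'M[C]_(m, n))^H = 0.
Proof. by rewrite /adjmx trmx0 map_mx0. Qed.

Lemma adj1 n : (1%:M : 'M[C]_n)^H = 1%:M.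
Proof. by rewrite /adjmx trmx1 map_mx1. Qed.

Lemma adj_scalar n (a : C) : (a%:M : 'M[C]_n)^H = (a^*)%:M.
Proof. by rewrite /adjmx tr_scalar_mx map_scalar_mx. Qed.

Lemma adj_row m n p (A : 'M[C]_(m, n)) (B : 'M[C]_(m, p)) :
  (row_mx A B)^H = col_mx A^H B^H.
Proof. by rewrite /adjmx tr_row_mx map_col_mx. Qed.

Lemma adj_col m n p (A : 'M[C]_(m, n)) (B : 'M[C]_(p, n)) :
  (col_mx A B)^H = row_mx A^H B^H.
Proof. by rewrite /adjmx tr_col_mx map_row_mx. Qed.

Lemma adj_block m n p q (A : 'M[C]_(m, n)) (B : 'M[C]_(m, p))
    (D : 'M[C]_(q, n)) (E : 'M[C]_(q, p)) :
  (block_mx A B D E)^H = block_mx A^H D^H B^H E^H.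
Proof. by rewrite /adjmx tr_block_mx map_block_mx. Qed.

Lemma adjX n (A : 'M[C]_n) k : (A ^+ k)^H = (A^H) ^+ k.
Proof.
elim: k => [|k IH]; first by rewrite !expr0 adj1.
by rewrite exprSr exprS -!mulmxE adjM IH.
Qed.

Lemma unitmx_adj n (A : 'M[C]_n) : (A^H \in unitmx) = (A \in unitmx).
Proof. by rewrite /adjmx map_unitmx unitmx_tr. Qed.

Lemma adjV n (A : 'M[C]_n) : (invmx A)^H = invmx A^H.
Proof. by rewrite /adjmx trmx_inv map_invmx. Qed.

Lemma adj_inj m n : injective (@adjmx C m n).
Proof. exact: can_inj (@adjK m n). Qed.

Lemma adj_form m n p q (X : 'M[C]_(m, n)) (A : 'M[C]_(m, p)) (Y : 'M[C]_(p, q)) :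
  (X^H *m A *m Y)^H = Y^H *m A^H *m X.
Proof. by rewrite !adjM adjK mulmxA. Qed.

(* Two sizes are allowed, although [S] and [T] force them to be equal, so that
   direct sums can be reassociated without casts. *)
Definition congruent m n (A : 'M[C]_m) (B : 'M[C]_n) :=
  exists (S : 'M[C]_(m, n)) (T : 'M[C]_(n, m)),
    [/\ S *m T = 1%:M, T *m S = 1%:M & B = S^H *m A *m S].

Lemma congruent_refl n (A : 'M[C]_n) : congruent A A.
Proof.
by exists 1%:M, 1%:M; rewrite adj1 !mul1mx mulmx1; split.
Qed.

Lemma congruent_sym m n (A : 'M[C]_m) (B : 'M[C]_n) :
  congruent A B -> congruent B A.
Proof.
case=> S [T [ST TS ->]]; exists T, S; split=> //.
by rewrite -!mulmxA ST mulmx1 mulmxA -adjM ST adj1 mul1mx.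
Qed.

Lemma congruent_trans m n p (B : 'M[C]_n) (A : 'M[C]_m) (D : 'M[C]_p) :
  congruent A B -> congruent B D -> congruent A D.
Proof.
case=> S [T [ST TS ->]] [S' [T' [ST' TS' ->]]].
exists (S *m S'), (T' *m T); split; last by rewrite adjM !mulmxA.
  by rewrite mulmxA -(mulmxA S) ST' mulmx1.
by rewrite mulmxA -(mulmxA T') TS mulmx1.
Qed.

Lemma congruent_dim m n (A : 'M[C]_m) (B : 'M[C]_n) : congruent A B -> m = n.
Proof.
case=> S [T [ST TS _]]; apply/eqP; rewrite eqn_leq.
have h1 := mulmx1_min ST; have h2 := mulmx1_min TS.
by rewrite h1 h2.
Qed.

Lemma congruent_unit m n (A : 'M[C]_m) (B : 'M[C]_n) :
  congruent A B -> (A \in unitmx) = (B \in unitmx).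
Proof.
move=> h; have e := congruent_dim h; move: B h; rewrite -{n}e => B.
case=> S [T [ST TS ->]]; have [SU _] := mulmx1_unit ST.
by rewrite !unitmx_mul unitmx_adj SU andbT.
Qed.

Lemma congruent_of_unit n (A S : 'M[C]_n) :
  S \in unitmx -> congruent A (S^H *m A *m S).
Proof. by move=> SU; exists S, (invmx S); rewrite mulmxV ?mulVmx. Qed.

Lemma congruentP n (A B : 'M[C]_n) :
  congruent A B <-> exists2 S, S \in unitmx & B = S^H *m A *m S.
Proof.
split=> [[S [T [ST _ ->]]]|[S SU ->]]; last exact: congruent_of_unit.
by exists S => //; case/mulmx1_unit: ST.
Qed.

Lemma congruent_cast m n (e : m = n) (A : 'M[C]_m) : congruent A (castmx (e, e) A).
Proof. by case: _ / e; rewrite castmx_id; apply: congruent_refl. Qed.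

(* [X = invmx A] carries [A] to [X^* A X = A^-*]. *)
Lemma congruent_cosquare n (A : 'M[C]_n) :
  A \in unitmx -> congruent A (invmx A)^H.
Proof.
move=> AU; have -> : (invmx A)^H = (invmx A)^H *m A *m invmx A.
  by rewrite -mulmxA mulmxV ?mulmx1.
by apply: congruent_of_unit; rewrite unitmx_inv.
Qed.

Definition dsum m n (A : 'M[C]_m) (B : 'M[C]_n) : 'M[C]_(m + n) :=
  block_mx A 0 0 B.

Lemma congruent_dsum m n p q (A : 'M[C]_m) (B : 'M[C]_n) (A' : 'M[C]_p)
    (B' : 'M[C]_q) :
  congruent A A' -> congruent B B' -> congruent (dsum A B) (dsum A' B').
Proof.
case=> S [T [ST TS ->]] [S' [T' [ST' TS' ->]]].
exists (block_mx S 0 0 S'), (block_mx T 0 0 T'); rewrite /dsum adj_block !adj0.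
split; rewrite !mulmx_block !(mulmx0, mul0mx, addr0, add0r).
- by rewrite ST ST' -scalar_mx_block.
- by rewrite TS TS' -scalar_mx_block.
- by [].
Qed.

Lemma unitmx_dsum m n (A : 'M[C]_m) (B : 'M[C]_n) :
  (dsum A B \in unitmx) = (A \in unitmx) && (B \in unitmx).
Proof. by rewrite /dsum !unitmxE det_ublock unitrM. Qed.

Lemma congruent_mxsub m n (f : 'I_m -> 'I_n) (A : 'M[C]_n) :
  bijective f -> congruent A (mxsub f f A).
Proof.
case=> g fK gK.
exists (\matrix_(i, j) (i == f j)%:R), (\matrix_(i, j) (j == f i)%:R).
split.
- apply/matrixP=> i j; rewrite !mxE (bigD1 (g i)) //= big1 => [|k kN].
    by rewrite !mxE gK eqxx mul1r addr0 eq_sym.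
  rewrite !mxE; case: eqP => [e|]; last by rewrite mul0r.
  by rewrite e fK eqxx in kN.
- apply/matrixP=> i j; rewrite !mxE (bigD1 (f i)) //= big1 => [|k kN].
    by rewrite !mxE eqxx mul1r addr0 (inj_eq (can_inj fK)).
  by rewrite !mxE (negPf kN) mul0r.
- apply/matrixP=> i j; rewrite !mxE (bigD1 (f j)) //= big1 => [|k kN]; last first.
    by rewrite !mxE (negPf kN) mulr0.
  rewrite !mxE eqxx mulr1 addr0 (bigD1 (f i)) //= big1 => [|k kN]; last first.
    by rewrite adjE !mxE (negPf kN) conjC0 mul0r.
  by rewrite adjE !mxE eqxx conjC1 mul1r addr0.
Qed.

(* Matrices indexed by arbitrary finite types: block permutations become case
   analyses on sum types. *)
Definition gmx (I : finType) (g : I -> I -> C) : 'M[C]_#|I| :=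
  \matrix_(i, j) g (enum_val i) (enum_val j).

Lemma congruent_gmx (I J : finType) (g : I -> I -> C) (h : J -> J -> C)
    (s : J -> I) :
  bijective s -> (forall i j, h i j = g (s i) (s j)) ->
  congruent (gmx g) (gmx h).
Proof.
case=> t sK tK hg.
pose f (i : 'I_#|J|) := enum_rank (s (enum_val i)).
have fB : bijective f.
  exists (fun i : 'I_#|I| => enum_rank (t (enum_val i))) => i.
    by rewrite /f enum_rankK sK enum_valK.
  by rewrite /f enum_rankK tK enum_valK.
have -> : gmx h = mxsub f f (gmx g).
  by apply/matrixP=> i j; rewrite !mxE hg /f !enum_rankK.
exact: congruent_mxsub.
Qed.

Lemma congruent_gmx_ord n (A : 'M[C]_n) : congruent A (gmx A).
Proof.
have -> : gmx A = mxsub enum_val enum_val A by apply/matrixP=> i j; rewrite !mxE.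
by apply: congruent_mxsub; apply: enum_val_bij.
Qed.

Definition gblock (I J : finType) (A : I -> I -> C) (B : I -> J -> C)
    (D : J -> I -> C) (E : J -> J -> C) : (I + J)%type -> (I + J)%type -> C :=
  fun x y => match x, y with
  | inl i, inl j => A i j | inl i, inr j => B i j
  | inr i, inl j => D i j | inr i, inr j => E i j
  end.

Lemma congruent_block_gmx m n (A : 'M[C]_m) (B : 'M[C]_(m, n))
    (D : 'M[C]_(n, m)) (E : 'M[C]_n) :
  congruent (block_mx A B D E) (gmx (gblock A B D E)).
Proof.
apply: (congruent_trans (congruent_gmx_ord _)).
apply: (congruent_gmx (s := unsplit)).
  by exists (@split m n); [apply: unsplitK | apply: splitK].
move=> [i|i] [j|j] /=.
- by rewrite block_mxEul.
- by rewrite block_mxEur.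
- by rewrite block_mxEdl.
- by rewrite block_mxEdr.
Qed.

Lemma congruent_dsumC m n (A : 'M[C]_m) (B : 'M[C]_n) :
  congruent (dsum A B) (dsum B A).
Proof.
apply: (congruent_trans (congruent_block_gmx _ _ _ _)).
apply: congruent_trans (congruent_sym (congruent_block_gmx _ _ _ _)).
apply: (congruent_gmx (s := fun x => match x with inl i => inr i | inr i => inl i
  end)).
  by exists (fun x => match x with inl i => inr i | inr i => inl i end); case.
by move=> [i|i] [j|j] /=; rewrite ?mxE.
Qed.

Lemma bij_sum (I J I' J' : Type) (f : I -> I') (g : J -> J') :
  bijective f -> bijective g ->
  bijective (fun x => match x with inl i => inl (f i) | inr j => inr (g j) end
             : (I' + J')%type).
Proof.
case=> f' fK f'K [g' gK g'K].
exists (fun x => match x with inl i => inl (f' i) | inr j => inr (g' j) end).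
  by case=> x /=; rewrite ?fK ?gK.
by case=> x /=; rewrite ?f'K ?g'K.
Qed.

Lemma congruent_dsumA m n p (A : 'M[C]_m) (B : 'M[C]_n) (D : 'M[C]_p) :
  congruent (dsum A (dsum B D)) (dsum (dsum A B) D).
Proof.
apply: (congruent_trans (congruent_gmx_ord _)).
apply: (congruent_trans _ (congruent_sym (congruent_gmx_ord _))).
pose g := gblock (gblock A (fun _ _ => 0) (fun _ _ => 0) B) (fun _ _ => 0)
  (fun _ _ => 0) D.
apply: (congruent_trans (B := gmx g)).
  apply: (congruent_gmx (s := fun x : 'I_m + 'I_n + 'I_p => match x with
    | inl (inl i) => lshift _ i | inl (inr j) => rshift _ (lshift _ j)
    | inr k => rshift _ (rshift _ k) end)).
    pose h (x : 'I_m + 'I_(n + p)) : 'I_m + 'I_n + 'I_p := match x with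
      | inl i => inl (inl i) | inr y => match split y with
        inl j => inl (inr j) | inr k => inr k end end.
    exists (h \o @split _ _) => [[[i|i]|i]|x] /=.
    - by rewrite (unsplitK (inl _)).
    - by rewrite (unsplitK (inr _)) /= (unsplitK (inl _)).
    - by rewrite (unsplitK (inr _)) /= (unsplitK (inr _)).
    - rewrite -[RHS]splitK /h; case: (split x) => //= y.
      by rewrite -[y in RHS]splitK; case: (split y).
  by move=> [[i|i]|i] [[j|j]|j] /=; rewrite /dsum
    ?(block_mxEul, block_mxEur, block_mxEdl, block_mxEdr) ?mxE.
apply: congruent_sym; apply: (congruent_gmx (s := fun x : 'I_m + 'I_n + 'I_p =>
  match x with
    | inl y => lshift _ (unsplit y) | inr k => rshift _ k end)).
  exists (fun x => match split x with inl y => inl (split y) | inr k => inr k end).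
    by case=> x; rewrite (unsplitK (inl _), unsplitK (inr _)) ?unsplitK.
  by move=> x; rewrite -[RHS]splitK; case: (split x) => y //=; rewrite splitK.
by move=> [[i|i]|i] [[j|j]|j] /=; rewrite /dsum
    ?(block_mxEul, block_mxEur, block_mxEdl, block_mxEdr) ?mxE.
Qed.

Lemma congruent_dsum0l m n (A : 'M[C]_m) (B : 'M[C]_n) :
  n = 0%N -> congruent A (dsum B A).
Proof.
move=> n0; subst n; apply: congruent_sym.
have {2}-> : A = mxsub (@rshift 0 m) (@rshift 0 m) (dsum B A).
  by apply/matrixP=> i j; rewrite mxE /dsum block_mxEdr.
by apply: congruent_mxsub; exists id => i; apply: val_inj.
Qed.

Lemma congruent_dsum0r m n (A : 'M[C]_m) (B : 'M[C]_n) :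
  n = 0%N -> congruent A (dsum A B).
Proof.
move=> n0; apply: (congruent_trans (congruent_dsum0l A B n0)).
exact: congruent_dsumC.
Qed.

(** The complement is [ker Z]: [W Z] projects onto the columns of [W], so [1 - W Z] maps into
    [ker Z], which yields the coordinates [Q] there. *)
Lemma basis_complement n w (W : 'M[C]_(n, w)) (Z : 'M[C]_(w, n)) :
  Z *m W = 1%:M -> exists n' (V : 'M[C]_(n, n')) (Q : 'M[C]_(n', n)),
    [/\ row_mx W V *m col_mx Z Q = 1%:M, col_mx Z Q *m row_mx W V = 1%:M
      & Z *m V = 0].
Proof.
move=> ZW; pose V := (row_base (kermx Z^T))^T.
have ZV : Z *m V = 0.
  apply: trmx_inj; rewrite trmx_mul trmxK trmx0.
  by apply/sub_kermxP; rewrite eq_row_base.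
have [Q VQ] : exists Q, V *m Q = 1%:M - W *m Z.
  have : ((1%:M - W *m Z)^T <= row_base (kermx Z^T))%MS.
    rewrite eq_row_base; apply/sub_kermxP; rewrite -trmx_mul mulmxBr mulmx1.
    by rewrite mulmxA ZW mul1mx subrr trmx0.
  case/submxP=> D hD; exists D^T; apply: trmx_inj.
  by rewrite trmx_mul !trmxK.
have Vinj q (X : 'M[C]_(_, q)) : V *m X = 0 -> X = 0.
  move=> VX; apply: trmx_inj; rewrite trmx0.
  apply: (row_free_inj (row_base_free (kermx Z^T))).
  by rewrite mul0mx -[row_base _]trmxK -trmx_mul VX trmx0.
have QV : Q *m V = 1%:M.
  apply/eqP; rewrite -subr_eq0; apply/eqP/Vinj.
  by rewrite mulmxBr mulmxA VQ mulmxBl mul1mx mulmx1 -mulmxA ZV mulmx0 subr0 subrr.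
have QW : Q *m W = 0.
  by apply: Vinj; rewrite mulmxA VQ mulmxBl mul1mx -mulmxA ZW mulmx1 subrr.
exists _, V, Q; split=> //.
  by rewrite mul_row_col VQ addrC subrK.
by rewrite mul_col_row ZW ZV QV QW -scalar_mx_block.
Qed.

(* If the rows of [Z] restrict to coordinates on the columns of [W] and detect
   both orthogonals of [W], then [W] splits off. *)
Lemma congruent_split n w (A : 'M[C]_n) (W : 'M[C]_(n, w)) (Z : 'M[C]_(w, n)) :
  Z *m W \in unitmx ->
  (forall p (V : 'M[C]_(n, p)), Z *m V = 0 ->
     W^H *m A *m V = 0 /\ V^H *m A *m W = 0) ->
  exists n' (A' : 'M[C]_n'), n = (w + n')%N /\ congruent A (dsum (W^H *m A *m W) A').
Proof.
move=> ZWu ZV.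
have ZW1 : invmx (Z *m W) *m Z *m W = 1%:M by rewrite -mulmxA mulVmx.
have [n' [V [Q [h1 h2 h3]]]] := basis_complement ZW1.
have [|WV VW] := ZV _ V.
  by rewrite -(mulKVmx ZWu (Z *m V)) (mulmxA (invmx _)) h3 mulmx0.
exists n', (V^H *m A *m V).
have cg : congruent A (dsum (W^H *m A *m W) (V^H *m A *m V)).
  exists (row_mx W V), (col_mx (invmx (Z *m W) *m Z) Q); split=> //.
  by rewrite adj_row mul_col_mx mul_col_row WV VW.
by split=> //; apply: congruent_dim cg.
Qed.
End Adjoint.

(** * Jordan chains *)

Section Jordan.
Variable C : numClosedFieldType.
Implicit Types (m n p q k : nat).

Definition jblock n (l : C) : 'M[C]_n :=
  \matrix_(a, b) (if a == b :> nat then l else if a.+1 == b :> nat then 1 else 0).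

Local Notation N n := (jblock n 0).

Lemma jblockE n l : jblock n l = l%:M + N n.
Proof.
apply/matrixP=> i j; rewrite !mxE -val_eqE /=.
by case: eqP => _; rewrite ?mulr1n ?addr0 ?mulr0n ?add0r.
Qed.

Lemma nilX n e i j : (N n ^+ e) i j = (i + e == j)%N%:R.
Proof.
elim: e i j => [|e IH] i j; first by rewrite expr0 mxE addn0 -val_eqE.
rewrite exprS -mulmxE mxE.
have [hi|hi] := ltnP i.+1 n.
  rewrite (bigD1 (Ordinal hi)) //= big1 => [|a aN]; last first.
    rewrite !mxE; case: eqP => [|_]; first by rewrite mul0r.
    case: eqP => [e'|_]; last by rewrite mul0r.
    by rewrite -val_eqE /= -e' eqxx in aN.
  by rewrite IH !mxE /= eqxx eqn_leq ltnn andbF mul1r addr0 addSnnS.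
rewrite big1 => [|a _]; last first.
  rewrite !mxE; case: eqP => _; rewrite ?mul0r //.
  case: eqP => [e'|_]; rewrite ?mul0r //.
  by move: (ltn_ord a); rewrite -e' ltnNge hi.
by case: eqP => // e'; move: (ltn_ord j); rewrite -e' addnS; lia.
Qed.

Lemma nil_nilp n : N n ^+ n = 0.
Proof.
apply/matrixP=> i j; rewrite nilX mxE; case: eqP => // e.
by move: (ltn_ord j); rewrite -e; lia.
Qed.

Lemma mul_nil_lt n p (X : 'M[C]_(n, p)) (i : 'I_n) j (h : (i.+1 < n)%N) :
  (N n *m X) i j = X (Ordinal h) j.
Proof.
rewrite mxE (bigD1 (Ordinal h)) //= big1 => [|a aN].
  by rewrite -[N n]expr1 nilX addn1 eqxx mul1r addr0.
rewrite -[N n]expr1 nilX addn1; case: eqP => [e|_]; last by rewrite mul0r.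
by rewrite -val_eqE /= -e eqxx in aN.
Qed.

Lemma mul_nil_last n p (X : 'M[C]_(n, p)) (i : 'I_n) j :
  (n <= i.+1)%N -> (N n *m X) i j = 0.
Proof.
move=> h; rewrite mxE big1 // => a _; rewrite -[N n]expr1 nilX addn1.
by case: eqP => [e|_]; rewrite ?mul0r //; move: (ltn_ord a); rewrite -e; lia.
Qed.

Lemma mul_nilr_S n p (X : 'M[C]_(p, n)) i (j j' : 'I_n) :
  j'.+1 = j -> (X *m N n) i j = X i j'.
Proof.
move=> h; rewrite mxE (bigD1 j') //= big1 => [|a aN].
  by rewrite -[N n]expr1 nilX addn1 h eqxx mulr1 addr0.
rewrite -[N n]expr1 nilX addn1; case: eqP => [e|_]; last by rewrite mulr0.
by rewrite -val_eqE /= in aN; case/eqP: aN; apply: succn_inj; rewrite e -h.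
Qed.

Lemma mul_nilr_0 n p (X : 'M[C]_(p, n)) i (j : 'I_n) :
  j = 0%N :> nat -> (X *m N n) i j = 0.
Proof.
move=> h; rewrite mxE big1 // => a _; rewrite -[N n]expr1 nilX addn1 h.
by rewrite mulr0.
Qed.

(** Finite geometric series in the nilpotent [x = - P / a], since [a + P = a (1 - x)]. *)
Lemma unitmx_nilp n (P : 'M[C]_n) k a :
  P ^+ k = 0 -> a != 0 -> a%:M + P \in unitmx.
Proof.
move=> Pk a0; pose x := - a^-1 *: P.
have xk : x ^+ k = 0.
  by rewrite /x -mul_scalar_mx mulmxE exprMn_comm ?Pk ?mulr0 // /GRing.comm
    -!mulmxE scalar_mxC.
have : (1 - x) * \sum_(i < k) x ^+ i = 1.
  by rewrite -opprB mulNr -subrX1 xk sub0r opprK.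
rewrite -mulmxE => /mulmx1_unit [xu _].
have -> : a%:M + P = a%:M *m (1 - x).
  rewrite mulmxBr mulmx1 /x mul_scalar_mx scalerA mulrN mulfV // scaleN1r.
  by rewrite opprK.
by rewrite unitmx_mul xu andbT unitmxE det_scalar unitrX // unitfE.
Qed.

Lemma unitmx_jblock n l : l != 0 -> jblock n l \in unitmx.
Proof. by move=> l0; rewrite jblockE; apply: unitmx_nilp (nil_nilp n) l0. Qed.

(** The equation gives [X = (K^-1 H) X P], which can be iterated until the power of [P] vanishes.
    This replaces arguments by disjoint spectra. *)
Lemma sylvester_nilp m k e (K H : 'M[C]_m) (P : 'M[C]_k) (X : 'M[C]_(m, k)) :
  K \in unitmx -> P ^+ e = 0 -> K *m X = H *m X *m P -> X = 0.
Proof.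
move=> Ku Pe h.
have hX : X = (invmx K *m H) *m X *m P.
  by rewrite -[LHS](mulKmx Ku) h !mulmxA.
have h2 i : X = (invmx K *m H) ^+ i *m X *m P ^+ i.
  elim: i => [|i IH]; first by rewrite !expr0 mul1mx mulmx1.
  by rewrite exprSr exprS -!mulmxE {1}IH {1}hX !mulmxA.
by rewrite (h2 e) Pe mulmx0.
Qed.

Lemma sylvester_nilp_r m k e (K H : 'M[C]_m) (P : 'M[C]_k) (X : 'M[C]_(k, m)) :
  K \in unitmx -> P ^+ e = 0 -> X *m K = P *m X *m H -> X = 0.
Proof.
move=> Ku Pe h; apply: trmx_inj; rewrite trmx0.
apply: (@sylvester_nilp _ _ e K^T H^T P^T); rewrite ?unitmx_tr //.
  have tX i : (P^T) ^+ i = (P ^+ i)^T.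
    elim: i => [|i IH]; first by rewrite !expr0 trmx1.
    by rewrite exprSr exprS -!mulmxE trmx_mul IH.
  by rewrite tX Pe trmx0.
by rewrite -!trmx_mul h mulmxA.
Qed.

(** If [M v = 0] and [a] is the last index with [v_a] nonzero, then [N^a v] is [v_a] times the first
    basis vector, while [M N^a v = B^a M v = 0]. So the first column of [M] would vanish. *)
Lemma unitmx_jordan k (M B : 'M[C]_k) (i0 i : 'I_k) :
  i0 = 0%N :> nat -> M *m N k = B *m M -> M i i0 != 0 -> M \in unitmx.
Proof.
move=> i00 MN M0; rewrite -unitmx_tr -row_free_unit -kermx_eq0.
apply: contraNT M0 => /rowV0Pn [v /sub_kermxP vM v0].
have {vM} Mv : M *m v^T = 0.
  by apply: trmx_inj; rewrite trmx_mul trmxK vM trmx0.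
have [a0 va0] : exists a, v 0 a != 0 by apply/rV0Pn.
pose a := [arg max_(a > a0 | v 0 a != 0) val a].
have [va amax] : v 0 a != 0 /\ forall b, v 0 b != 0 -> (b <= a)%N.
  by rewrite /a; case: arg_maxnP.
have MNe e : M *m N k ^+ e = B ^+ e *m M.
  elim: e => [|e IH]; first by rewrite !expr0 mul1mx mulmx1.
  by rewrite !exprSr -!mulmxE mulmxA IH -!mulmxA MN.
have : M *m (N k ^+ a *m v^T) = 0 by rewrite mulmxA MNe -mulmxA Mv mulmx0.
move/matrixP/(_ i 0); rewrite mxE (bigD1 i0) //= big1 => [|b b0].
  rewrite addr0 mxE (bigD1 a) //= big1 => [|b ba].
    rewrite nilX i00 eqxx mul1r !mxE addr0 => /eqP.
    by rewrite mulf_eq0 (negPf va) orbF.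
  rewrite nilX i00 add0n; case: eqP => [e|_]; last by rewrite mul0r.
  by case/eqP: ba; apply: val_inj.
rewrite mxE big1 ?mulr0 // => c _; rewrite nilX !mxE.
case: eqP => [e|_]; last by rewrite mul0r.
have [->|vc] := eqVneq (v 0 c) 0; first by rewrite mulr0.
have := amax _ vc; rewrite -e => h.
case/eqP: b0; apply: val_inj => /=; rewrite i00; lia.
Qed.

(** Here [k] is the first exponent at which the ranks of the powers of [D] stabilize. If every
    [f D^(k-1) x] vanished, [D^(k-1)] would map [ker D^k] into the image of [D^k]. As
    [D^k = Q D^(k+1)], that image of [ker D^k] would be zero, and the ranks would have stabilized
    one step earlier. *)
Lemma max_chain n (D : 'M[C]_n) :
  D \notin unitmx ->
  exists k (x : 'cV[C]_n) (f : 'rV[C]_n),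
    [/\ (0 < k)%N, D ^+ k *m x = 0, f *m D ^+ k = 0
      & (f *m D ^+ k.-1 *m x) 0 0 != 0].
Proof.
move=> Dnu.
have mono e : (\rank (D ^+ e.+1) <= \rank (D ^+ e))%N.
  by rewrite exprS -mulmxE mxrankM_maxr.
have ex : exists e, \rank (D ^+ e.+1) == \rank (D ^+ e).
  have [h|h] := boolP [exists e : 'I_n.+1, \rank (D ^+ e.+1) == \rank (D ^+ e)].
    by case/existsP: h => e he; exists e.
  have dec e : (e <= n.+1)%N -> (\rank (D ^+ e) + e <= n)%N.
    elim: e => [|e IH] he; first by rewrite expr0 addn0 rank_leq_row.
    have := existsPn h (Ordinal he); rewrite /= => hne.
    have := mono e; rewrite leq_eqVlt (negPf hne) /= => hlt.
    by have := IH (ltnW he); lia.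
  by have := dec n.+1 (leqnn _); lia.
case: (ex_minnP ex) => k /eqP hk kmin.
have k0 : (0 < k)%N.
  rewrite lt0n; apply: contraNneq Dnu => k0; move: hk; rewrite k0 expr1 expr0.
  by rewrite mxrank1 -row_free_unit => /eqP.
pose Kc := cokermx (D ^+ k); pose Kr := kermx (D ^+ k).
have DKc : D ^+ k *m Kc = 0 by apply: mulmx_coker.
have KrD : Kr *m D ^+ k = 0 by apply: mulmx_ker.
have ek : D ^+ k = D *m D ^+ k.-1 by rewrite mulmxE -exprS prednK.
have [nz|] := boolP (Kr *m D ^+ k.-1 *m Kc != 0).
  have [i [j ij]] : exists i j, (Kr *m D ^+ k.-1 *m Kc) i j != 0.
    by apply/matrix0Pn.
  exists k, (col j Kc), (row i Kr); split=> //.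
  - by rewrite colE mulmxA DKc mul0mx.
  - by rewrite -row_mul KrD row0.
  - by rewrite colE -!row_mul mulmxA -colE mxE mxE.
rewrite negbK => /eqP z.
have /submxP[V hV] : ((D ^+ k.-1 *m Kc)^T <= (D ^+ k)^T)%MS.
  rewrite submxE -[cokermx _]trmxK -trmx_mul.
  have /submxP[W ->] : ((cokermx (D ^+ k)^T)^T <= Kr)%MS.
    apply/sub_kermxP; apply: trmx_inj.
    by rewrite trmx_mul trmxK mulmx_coker trmx0.
  by rewrite -mulmxA (mulmxA Kr) z mulmx0 trmx0.
have {}hV : D ^+ k.-1 *m Kc = D ^+ k *m V^T.
  by apply: trmx_inj; rewrite hV trmx_mul trmxK.
have /submxP[Q hQ] : (D ^+ k <= D ^+ k.+1)%MS.
  by rewrite -(geq_leqif (mxrank_leqif_sup _)) ?hk // exprS -mulmxE submxMl.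
have : D ^+ k.-1 *m Kc = 0.
  rewrite hV hQ exprS -mulmxE -!mulmxA -hV (mulmxA D) -ek DKc.
  by rewrite mulmx0.
move/eqP; rewrite -submxE => /mxrankS hs.
have : (k <= k.-1)%N by apply: kmin; rewrite prednK // eqn_leq hs andbT; have :=
  mono k.-1; rewrite prednK.
by move: k0; clear; lia.
Qed.

Lemma polarization n (B : 'M[C]_n) :
  B != 0 -> exists v : 'cV[C]_n, (v^H *m B *m v) 0 0 != 0.
Proof.
move/matrix0Pn=> [i [j Bij]].
pose q (v : 'cV[C]_n) := (v^H *m B *m v) 0 0.
pose s (x y : 'cV[C]_n) := (x^H *m B *m y) 0 0.
have sE a b : s (delta_mx a 0) (delta_mx b 0) = B a b.
  rewrite /s /adjmx trmx_delta map_delta_mx -rowE -colE !mxE //.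
have qD x y (c : C) : q (x + c *: y) = q x + c * s x y + c^* * s y x + c^* * c * q y.
  rewrite /q /s adjD adjZ !(mulmxDl, mulmxDr) -?scalemxAl -?scalemxAr -?scalemxAl
    -?scalemxAr -?scalemxAl.
  move: (x^H *m B *m x) (x^H *m B *m y) (y^H *m B *m x) (y^H *m B *m y) => X Y Z T.
  by rewrite !mxE; ring.
pose x : 'cV[C]_n := delta_mx i 0; pose y : 'cV[C]_n := delta_mx j 0.
have [qx|qx] := eqVneq (q x) 0; last by exists x.
have [qy|qy] := eqVneq (q y) 0; last by exists y.
have [q1|q1] := eqVneq (q (x + 1 *: y)) 0; last by exists (x + 1 *: y).
have [q2|q2] := eqVneq (q (x + 'i *: y)) 0; last by exists (x + 'i *: y).
case/eqP: Bij; rewrite -sE -/x -/y; clear sE.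
move: q1 q2; rewrite !qD qx qy !(mulr0, addr0, add0r) conjC1 !mul1r conjCi mulNr.
move=> h1 h2.
have h3 : s x y - s y x = 0.
  apply: (mulfI (neq0Ci C)); rewrite mulr0 -[RHS]h2; ring.
have : 2%:R * s x y = 0 by rewrite -[RHS](addr0 0) -{1}h1 -h3; ring.
by move/eqP; rewrite mulf_eq0 pnatr_eq0 /= => /eqP.
Qed.
End Jordan.

(** * Splitting off H_{2k}(l) *)

Section Regular.
Variable C : numClosedFieldType.
Implicit Types (m n p q k : nat) (l : C).
Local Notation N n := (jblock n (0 : C)).

(** The columns run from [D^(k-1) x] down to [x], so that [D] acts on them as the upper Jordan block
    multiplied on the right. The first column is the one killed by [D]. *)
Definition chain n (D : 'M[C]_n) (x : 'cV[C]_n) k : 'M[C]_(n, k) :=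
  \matrix_(i, j) (D ^+ (k.-1 - j) *m x) i 0.

Lemma mul_chain n p (B : 'M[C]_(p, n)) (D : 'M[C]_n) x k i (j : 'I_k) :
  (B *m chain D x k) i j = (B *m D ^+ (k.-1 - j) *m x) i 0.
Proof. by rewrite -mulmxA !mxE; apply: eq_bigr => a _; rewrite !mxE. Qed.

Lemma chainP n (D : 'M[C]_n) x k :
  D ^+ k *m x = 0 -> D *m chain D x k = chain D x k *m N k.
Proof.
move=> Dx; apply/matrixP=> i j; rewrite mul_chain mulmxE -exprS.
case: k Dx j => [|k] Dx [[|j] hj] //=.
  by rewrite mul_nilr_0 // subn0 Dx mxE.
have hj' : (j < k.+1)%N by apply: ltnW.
by rewrite (@mul_nilr_S _ _ _ _ _ _ (Ordinal hj')) // subnSK // [RHS]mxE.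
Qed.

Definition rchain n (D : 'M[C]_n) (f : 'rV[C]_n) k : 'M[C]_(k, n) :=
  \matrix_(i, j) (f *m D ^+ i) 0 j.

Lemma rchain_mul n p (B : 'M[C]_(n, p)) (D : 'M[C]_n) f k (i : 'I_k) j :
  (rchain D f k *m B) i j = (f *m D ^+ i *m B) 0 j.
Proof. by rewrite !mxE; apply: eq_bigr => a _; rewrite !mxE. Qed.

Lemma rchainP n (D : 'M[C]_n) f k :
  f *m D ^+ k = 0 -> rchain D f k *m D = N k *m rchain D f k.
Proof.
move=> fD; apply/matrixP=> i j; rewrite rchain_mul -mulmxA mulmxE -exprSr.
have [h|h] := ltnP i.+1 k.
  by rewrite (mul_nil_lt _ _ h) [RHS]mxE.
rewrite mul_nil_last //; have -> : i.+1 = k by apply/eqP; rewrite eqn_leq h ltn_ord.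
by rewrite fD mxE.
Qed.

Lemma commute_jblock m k l l' (X : 'M[C]_(m, k)) (D : 'M[C]_m) :
  l = l' -> (D - l%:M) *m X = X *m N k -> D *m X = X *m jblock k l'.
Proof.
move=> <- h; rewrite (jblockE k) mulmxDr -h mulmxBl mul_scalar_mx mul_mx_scalar.
by rewrite addrC subrK.
Qed.

Definition hblock k (l : C) : 'M[C]_(k + k) := block_mx 0 1%:M (jblock k l) 0.

Lemma adj_jblock k l : (jblock k l)^H = (l^*)%:M + (N k)^H :> 'M[C]_k.
Proof. by rewrite jblockE adjD adj_scalar. Qed.

Lemma adj_nil_nilp k : (N k)^H ^+ k = 0.
Proof. by rewrite -adjX nil_nilp adj0. Qed.

Lemma unit_norm_jblock k l : `|l| != 1 -> 1%:M - l *: (jblock k l)^H \in unitmx.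
Proof.
move=> l1; rewrite adj_jblock scalerDr opprD addrA.
have -> : 1%:M - l *: (l^*)%:M = (1 - l * l^*)%:M :> 'M[C]_k.
  by rewrite scale_scalar_mx raddfB.
rewrite -scaleNr; apply: (unitmx_nilp (k := k)).
  rewrite -mul_scalar_mx mulmxE exprMn_comm ?adj_nil_nilp ?mulr0 //.
  by rewrite /GRing.comm -!mulmxE scalar_mxC.
by rewrite subr_eq0 -normCK eq_sym pexpr_eq1.
Qed.

(** Writing the right factor as [l + N] turns the equation into [(1 - l J^H) M = J^H M N], and
    [1 - l J^H] has the single eigenvalue [1 - |l|^2]. *)
Lemma stein_jblock k l (M : 'M[C]_k) :
  `|l| != 1 -> M = (jblock k l)^H *m M *m jblock k l -> M = 0.
Proof.
move=> l1 h; apply: (@sylvester_nilp _ _ _ k (1%:M - l *: (jblock k l)^H)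
  (jblock k l)^H (N k)); rewrite ?nil_nilp ?unit_norm_jblock //.
rewrite mulmxBl mul1mx {1}h (jblockE k l) mulmxDr mul_mx_scalar.
by rewrite -scalemxAl addrC addKr.
Qed.

Lemma stein_jblock_r k l (M : 'M[C]_k) :
  `|l| != 1 -> M = jblock k l *m M *m (jblock k l)^H -> M = 0.
Proof.
move=> l1 h; apply: (@sylvester_nilp_r _ _ _ k (1%:M - l *: (jblock k l)^H)
  (jblock k l)^H (N k)); rewrite ?nil_nilp ?unit_norm_jblock //.
rewrite mulmxBr mulmx1 {1}h {1}(jblockE k l) mulmxDl mul_scalar_mx mulmxDl.
by rewrite -scalemxAl -scalemxAr addrC addKr.
Qed.

(** The columns of [X] form a chain at [l], those of [Y] a dual chain at [1 / conj l]. The Gram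
    matrix of each chain solves a Stein equation, so both chains are isotropic, and the Gram matrix
    of the two together is exactly that of H_{2k}(l). *)
Lemma split_hblock n k l (A : 'M[C]_n) (X Y : 'M[C]_(n, k)) :
  `|l| != 1 ->
  A *m X = A^H *m X *m jblock k l ->
  Y^H *m A = jblock k l *m (Y^H *m A^H) ->
  Y^H *m A^H *m X = 1%:M ->
  exists n' (A' : 'M[C]_n'), congruent A (dsum (hblock k l) A').
Proof.
move=> l1 hX hY YX; set J := jblock k l in hX hY *.
have XY : X^H *m A *m Y = 1%:M.
  by apply: adj_inj; rewrite adj_form YX adj1.
have XX : X^H *m A *m X = 0.
  apply: (@stein_jblock _ l) => //.
  have e1 : X^H *m A *m X = (X^H *m A *m X)^H *m J.
    by rewrite adj_form -mulmxA hX !mulmxA.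
  by rewrite {1}e1 {1}e1 adjM adjK.
have YY : Y^H *m A *m Y = 0.
  apply: (@stein_jblock_r _ l) => //.
  have e1 : Y^H *m A *m Y = J *m (Y^H *m A *m Y)^H.
    by rewrite adj_form hY !mulmxA.
  by rewrite {1}e1 {1}e1 adjM adjK mulmxA.
have YX' : Y^H *m A *m X = J by rewrite hY -mulmxA YX mulmx1.
have YY' : Y^H *m A^H *m Y = 0.
  by apply: adj_inj; rewrite adj_form ?adjK YY adj0.
(* Each chain is tested on one side only; the chain relations turn annihilation by these rows into
   annihilation on the other side. *)
have [||n' [A' [_ cA]]] := @congruent_split _ _ _ A (row_mx X Y)
    (col_mx (X^H *m A) (Y^H *m A^H)).
- rewrite mul_col_row XX XY YX YY'.
  have : block_mx 0 1%:M 1%:M 0 *m block_mx 0 1%:M 1%:M 0 = 1%:M :> 'M[C]_(k + k).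
    by rewrite mulmx_block !(mulmx0, mul0mx, addr0, add0r, mulmx1) -scalar_mx_block.
  by case/mulmx1_unit.
- move=> p V; rewrite mul_col_mx -[0]col_mx0 => /eq_col_mx [h1 h2].
  have h3 : V^H *m A^H *m X = 0.
    by apply: adj_inj; rewrite adj_form ?adjK h1 adj0.
  have h4 : V^H *m A *m Y = 0.
    by apply: adj_inj; rewrite adj_form ?adjK h2 adj0.
  rewrite adj_row !mul_col_mx h1 hY -(mulmxA J) h2 mulmx0 col_mx0; split=> //.
  by rewrite mul_mx_row h4 -mulmxA hX !mulmxA h3 mul0mx row_mx0.
exists n', A'; apply: (congruent_trans cA).
by rewrite adj_row mul_col_mx mul_col_row XX XY YX' YY; apply: congruent_refl.
Qed.

Lemma exists_hblock n l (A : 'M[C]_n) :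
  A \in unitmx -> `|l| != 1 -> A - l *: A^H \notin unitmx ->
  exists k n' (A' : 'M[C]_n'), (0 < k)%N /\ congruent A (dsum (hblock k l) A').
Proof.
move=> Au l1 sing; have Au' : A^H \in unitmx by rewrite unitmx_adj.
pose T := invmx A^H *m A.
have AT : A^H *m T = A by rewrite mulmxA mulmxV // mul1mx.
pose D := T - l%:M.
have /max_chain[k [x [f [k0 Dx fD fx]]]] : D \notin unitmx.
  apply: contraNN sing => Du.
  have -> : A - l *: A^H = A^H *m D by rewrite mulmxBr AT mul_mx_scalar.
  by rewrite unitmx_mul Au' Du.
pose X := chain D x k; pose Z := rchain D f k.
have TX : T *m X = X *m jblock k l by apply: (commute_jblock (erefl l)); apply:
  chainP.
have ZT : Z *m T = jblock k l *m Z.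
  have := rchainP fD; rewrite -/Z mulmxBr (jblockE k l) mulmxDl mul_scalar_mx
    mul_mx_scalar.
  by move=> <-; rewrite addrC subrK.
have ZXJ : Z *m X *m jblock k l = jblock k l *m (Z *m X).
  by rewrite -(mulmxA Z) -TX (mulmxA Z T X) ZT -mulmxA.
(* [Z X] commutes with the Jordan block, and its corner entry is [f D^(k-1) x]. *)
have ZXu : Z *m X \in unitmx.
  apply: (@unitmx_jordan _ _ _ (N k) (Ordinal k0) (Ordinal k0)) => //.
    move: ZXJ; rewrite (jblockE k l) mulmxDl mulmxDr mul_scalar_mx mul_mx_scalar.
    by move/addrI.
  by rewrite rchain_mul mul_chain /= expr0 mulmx1 subn0.
pose Z' := invmx (Z *m X) *m Z.
have ZX1 : Z' *m X = 1%:M by rewrite -mulmxA mulVmx.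
have ZT' : Z' *m T = jblock k l *m Z'.
  rewrite /Z' -mulmxA ZT !mulmxA; congr (_ *m _).
  apply: (can_inj (mulmxK ZXu)); rewrite -mulmxA -ZXJ mulKmx //.
  by rewrite -mulmxA mulVmx // mulmx1.
pose Y := invmx A *m Z'^H.
have YA : Y^H *m A^H = Z'.
  by rewrite adjM adjK adjV -mulmxA mulVmx // mulmx1.
have [||| n' [A' cA]] := @split_hblock n k l A X Y l1.
- by rewrite -mulmxA -TX mulmxA AT.
- by rewrite YA -ZT' -{1}AT mulmxA YA.
- by rewrite YA.
by exists k, n', A'.
Qed.
End Regular.

(** * Splitting off a multiple of Delta_k *)

Section Unimodular.
Variable C : numClosedFieldType.
Implicit Types (m n p q k : nat) (l u : C).
Local Notation N n := (jblock n (0 : C)).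

Definition dblock k : 'M[C]_k :=
  \matrix_(a, b) (if (a + b).+1 == k then 1 else if (a + b)%N == k then 'i else 0).

(** For [|l| = 1] one has [A^H D = - l D^H A]: up to a factor, [D] is its own adjoint for the form.
    Hence a left null vector [f] of [D^k] is [y^H A] with [D^k y = 0], and the pairing [f D^(k-1) x]
    becomes a value of a form on [ker D^k] alone, to which polarization applies. *)
Lemma exists_anisotropic n u (A : 'M[C]_n) :
  A \in unitmx -> `|u| = 1 -> A - u ^+ 2 *: A^H \notin unitmx ->
  exists k (X : 'M[C]_(n, k)), [/\ (0 < k)%N,
    A *m X = A^H *m X *m jblock k (u ^+ 2) & X^H *m A *m X \in unitmx].
Proof.
move=> Au u1 sing; have Au' : A^H \in unitmx by rewrite unitmx_adj.
set l := u ^+ 2 in sing *.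
have l1 : l * l^* = 1 by rewrite -normCK normrX u1 !expr1n.
have l0 : l != 0 by rewrite -normr_eq0 normrX u1 expr1n oner_eq0.
have [T AT Tu] : exists2 T, A^H *m T = A & T \in unitmx.
  exists (invmx A^H *m A); first by rewrite mulmxA mulmxV // mul1mx.
  by rewrite unitmx_mul unitmx_inv Au' Au.
pose D := T - l%:M.
have AD : A^H *m D = A - l *: A^H by rewrite mulmxBr AT mul_mx_scalar.
have DA : A^H *m D = - l *: (D^H *m A).
  have TA : T^H *m A = A^H.
    by rewrite -[in RHS]AT adjM adjK.
  rewrite AD /D adjD adjN adj_scalar mulmxBl TA.
  rewrite mul_scalar_mx scalerBr scaleNr scaleNr scalerA l1 scale1r opprK.
  by rewrite addrC.
have TD : GRing.comm T D.
  by rewrite /GRing.comm -!mulmxE mulmxBl mulmxBr mul_mx_scalar mul_scalar_mx.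
(* Each [D] that crosses the form leaves a factor [T] behind, from [A = A^H T]; it is harmless
   because [T] is invertible. *)
have ADk k : A^H *m D ^+ k = (- l) ^+ k *: ((D^H) ^+ k *m A^H *m T ^+ k).
  elim: k => [|k IH]; first by rewrite !expr0 scale1r mul1mx mulmx1.
  have e : A *m D ^+ k = A^H *m D ^+ k *m T.
    by rewrite -{1}AT -!mulmxA; congr (_ *m _); exact: (commrX k TD).
  rewrite exprS -mulmxE mulmxA DA -scalemxAl -mulmxA e IH.
  rewrite -scalemxAl -scalemxAr scalerA -exprS; congr (_ *: _).
  by rewrite exprS exprSr -!mulmxE !mulmxA.
have TXu k : T ^+ k \in unitmx.
  elim: k => [|k IH]; first by rewrite expr0 unitmx1.
  by rewrite exprS -mulmxE unitmx_mul Tu.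
have /max_chain[k [x [f [k0 Dx fD fx]]]] : D \notin unitmx.
  by apply: contraNN sing => Du; rewrite -AD unitmx_mul Au' Du.
have [y yA] : exists y : 'cV_n, y^H *m A = f.
  by exists (f *m invmx A)^H; rewrite adjK mulmxKV.
have Dy : D ^+ k *m y = 0.
  apply: adj_inj; rewrite adjM adj0 adjX.
  apply: (can_inj (mulmxK Au')); apply: (can_inj (mulmxK (TXu k))).
  apply: (can_inj (mulmxK Tu)); rewrite !mul0mx.
  apply: (@scalerI _ _ ((- l) ^+ k)); first by rewrite expf_neq0 ?oppr_eq0.
  rewrite scaler0 -(mulmxA y^H) -(mulmxA y^H) scalemxAl scalemxAr -ADk.
  rewrite -!mulmxA.
  have -> : D ^+ k *m T = T *m D ^+ k by exact/esym/(commrX k TD).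
  by rewrite (mulmxA A^H) AT mulmxA yA fD.
(* Its columns span [ker D^k]; polarization is applied to the form restricted to them, so that the
   vector found stays in the kernel. *)
pose Kc := (kermx (D ^+ k)^T)^T.
have DKc : D ^+ k *m Kc = 0.
  by apply: trmx_inj; rewrite trmx_mul trmxK mulmx_ker trmx0.
have Kcov (v : 'cV[C]_n) : D ^+ k *m v = 0 -> exists w, v = Kc *m w.
  move=> Dv; have /submxP[w hw] : (v^T <= kermx (D ^+ k)^T)%MS.
    by apply/sub_kermxP; rewrite -trmx_mul Dv trmx0.
  by exists w^T; apply: trmx_inj; rewrite hw trmx_mul !trmxK.
have /polarization[v hv] : Kc^H *m (A *m D ^+ k.-1) *m Kc != 0.
  have [x' ex] := Kcov _ Dx; have [y' ey] := Kcov _ Dy.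
  apply: contraNneq fx => h.
  have -> : f *m D ^+ k.-1 *m x = y'^H *m (Kc^H *m (A *m D ^+ k.-1) *m Kc) *m x'.
    by rewrite -yA ex ey adjM !mulmxA.
  by rewrite h mulmx0 mul0mx mxE.
pose z := Kc *m v.
have Dz : D ^+ k *m z = 0 by rewrite mulmxA DKc mul0mx.
have hz : (z^H *m A *m D ^+ k.-1 *m z) 0 0 != 0.
  by rewrite /z adjM !mulmxA; rewrite !mulmxA in hv.
pose X := chain D z k; set J := jblock k l.
have TX : T *m X = X *m J by apply: (commute_jblock (erefl l)); apply: chainP.
have AX : A *m X = A^H *m X *m J by rewrite -mulmxA -TX mulmxA AT.
exists k, X; split=> //; set M := X^H *m A *m X.
have M1 : M = M^H *m J by rewrite /M adj_form -mulmxA AX !mulmxA.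
have M2 : M = J^H *m M *m J by rewrite {1}M1 {1}M1 adjM adjK.
have Ju : J^H \in unitmx by rewrite unitmx_adj unitmx_jblock.
have hk : (k.-1 < k)%N by rewrite prednK.
(* From [M = J^H M J] follows [M N = (J^-H - l) M]. The entry in the last row and first column is
   [z^H A D^(k-1) z]. *)
apply: (@unitmx_jordan _ _ _ (invmx J^H - l%:M) (Ordinal k0) (Ordinal hk)) => //.
  have -> : N k = J - l%:M by rewrite /J (jblockE k l) addrAC subrr add0r.
  rewrite mulmxBr mulmxBl mul_mx_scalar mul_scalar_mx; congr (_ - _).
  by rewrite [in RHS]M2 -mulmxA mulKmx.
have XB (B : 'cV[C]_n) : (X^H *m B) (Ordinal hk) 0 = (z^H *m B) 0 0.
  rewrite !mxE; apply: eq_bigr => a _.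
  by rewrite !adjE mxE /= subnn expr0 mul1mx.
by rewrite /M mul_chain /= subn0; clearbody z; rewrite -!mulmxA XB !mulmxA.
Qed.
End Unimodular.

(** * Normal form of the Gram matrix of a single chain *)

Section UnimodularBlock.
Variable C : numClosedFieldType.
Implicit Types (m n p q k : nat) (l u : C).
Local Notation N n := (jblock n (0 : C)).

Lemma expmxZ n a (A : 'M[C]_n) e : (a *: A) ^+ e = a ^+ e *: A ^+ e.
Proof.
elim: e => [|e IH]; first by rewrite !expr0 scale1r.
by rewrite !exprS IH -!mulmxE -scalemxAl -scalemxAr scalerA.
Qed.

Lemma expmxM n (A B : 'M[C]_n) e :
  A *m B = B *m A -> (A *m B) ^+ e = A ^+ e *m B ^+ e.
Proof. by move=> AB; rewrite mulmxE exprMn_comm. Qed.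

Definition revmx k : 'M[C]_k := \matrix_(a, b) ((a + b).+1 == k)%:R.

Lemma dblockE k : dblock C k = revmx k + 'i *: (revmx k *m N k).
Proof.
apply/matrixP=> a [[|b] hb]; rewrite [LHS]mxE [RHS]mxE [in X in _ = _ + X]mxE.
  rewrite mul_nilr_0 // mulr0 addr0 !mxE /= addn0.
  by case: eqP => // _; case: eqP => // e; move: (ltn_ord a); rewrite e ltnn.
have hb' : (b < k)%N by apply: ltnW.
rewrite (@mul_nilr_S _ _ _ _ _ _ (Ordinal hb')) // !mxE /= addnS.
case: eqP => [e|_]; case: eqP => [e'|_]; rewrite ?mulr1 ?mulr0 ?addr0 ?add0r //.
by move: e; rewrite e'; lia.
Qed.

Section HermitianPair.
Variables (k : nat) (H P : 'M[C]_k).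
Hypothesis HH : H^H = H.
Hypothesis PH : P^H *m H = H *m P.
Hypothesis Pk : P ^+ k = 0.

(** The moments of [y]. As [P] is selfadjoint for [H], they are real and are the only entries of the
    Gram matrix of the chain generated by [y], so normalizing them normalizes that matrix. *)
Let s e (y : 'cV[C]_k) := (y^H *m (H *m P ^+ e) *m y) 0 0.

Lemma selfadj_pow e : (P ^+ e)^H *m H = H *m P ^+ e.
Proof.
rewrite adjX; elim: e => [|e IH]; first by rewrite !expr0 mul1mx mulmx1.
by rewrite !exprSr -!mulmxE -mulmxA PH mulmxA IH mulmxA.
Qed.

Lemma moment_conj e y : (s e y)^* = s e y.
Proof.
rewrite -adjE adj_form adjM HH selfadj_pow //.
Qed.

Lemma moment_ge e y : (k <= e)%N -> s e y = 0.
Proof.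
by move=> h; rewrite /s -(subnK h) exprD Pk mulr0 !mulmx0 mul0mx mxE.
Qed.

Lemma moment_shift a b e y :
  ((P ^+ a *m y)^H *m (H *m P ^+ e) *m (P ^+ b *m y)) 0 0 = s (a + b + e) y.
Proof.
have -> : (P ^+ a *m y)^H *m (H *m P ^+ e) *m (P ^+ b *m y)
    = y^H *m ((P ^+ a)^H *m H) *m (P ^+ e *m P ^+ b) *m y by rewrite adjM !mulmxA.
rewrite selfadj_pow.
have -> : (a + b + e = a + (e + b))%N by lia.
by rewrite /s !exprD -!mulmxE !mulmxA.
Qed.

Lemma moment_normalize y : s k.-1 y != 0 ->
  exists z (e : bool), s k.-1 z = (-1) ^+ e.
Proof.
move=> sy; set t := s k.-1 y in sy.
pose c := (sqrtC `|t|)^-1.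
have c0 : 0 <= c by rewrite invr_ge0 sqrtC_ge0 normr_ge0.
have tR : t \is Num.real by apply/CrealP; apply: moment_conj.
exists (c *: y), (t < 0).
have -> : s k.-1 (c *: y) = c ^+ 2 * t.
  by rewrite /t /s adjZ -!scalemxAl -scalemxAr scalerA mxE (geC0_conj c0) expr2.
rewrite exprVn sqrtCK {2}(realEsign tR) mulrCA mulVf ?mulr1 //.
by rewrite normr_eq0.
Qed.

(* Replacing [y] by [y + c P^m.+1 y] with [c] real leaves the moments of index
   at least [k - 1 - m] unchanged and shifts the next one by [2 c s k.-1 y]. *)
Lemma moment_clear y b m : s k.-1 y = (-1) ^+ (b : bool) ->
  exists z, s k.-1 z = (-1) ^+ b /\
    forall e, (k.-1 <= e + m)%N -> (e < k.-1)%N -> s e z = 0.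
Proof.
move=> sy; elim: m => [|m [z [sz hz]]].
  by exists y; split=> // e; rewrite addn0; lia.
have [hm|hm] := ltnP m.+1 k; last first.
  by exists z; split=> // e h1 h2; apply: hz; lia.
pose e0 := (k.-1 - m.+1)%N.
pose c := - s e0 z / (2%:R * (-1) ^+ b).
have cR : c^* = c.
  rewrite /c rmorphM rmorphN /= moment_conj fmorphV rmorphM rmorphXn rmorphN /=.
  by rewrite conjC1 conjC_nat.
have sE e : s e (z + c *: (P ^+ m.+1 *m z))
    = s e z + 2%:R * c * s (e + m.+1) z + c ^+ 2 * s (e + m.+1 + m.+1) z.
  have h1 := moment_shift m.+1 0 e z; have h2 := moment_shift 0 m.+1 e z.
  have h3 := moment_shift m.+1 m.+1 e z.
  rewrite expr0 mul1mx addn0 in h1; rewrite expr0 mul1mx add0n in h2.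
  rewrite [LHS]/s adjD adjZ !(mulmxDl, mulmxDr) -!scalemxAl -!scalemxAr cR.
  have mD (A B : 'M[C]_1) : (A + B) 0 0 = A 0 0 + B 0 0 by rewrite mxE.
  have mZ a (A : 'M[C]_1) : (a *: A) 0 0 = a * A 0 0 by rewrite mxE.
  rewrite ?(mD, mZ) h1 h2 h3 -/(s e z).
  rewrite (addnC m.+1 e) (addnC (m.+1 + m.+1)%N) addnA; ring.
exists (z + c *: (P ^+ m.+1 *m z)); split.
  by rewrite sE sz !moment_ge ?mulr0 ?addr0 //; lia.
move=> e h1 h2; rewrite sE (@moment_ge (e + m.+1 + m.+1)); last by lia.
have [h|h] := leqP k.-1 (e + m).
  by rewrite hz // (@moment_ge (e + m.+1)) ?mulr0 ?addr0 //; lia.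
have -> : e = e0 by rewrite /e0; lia.
have -> : (e0 + m.+1)%N = k.-1 by rewrite /e0; lia.
rewrite sz /c mulr0 addr0; case: b {sy sz c cR sE} => /=; field; lia.
Qed.

Hypothesis k0 : (0 < k)%N.
Hypothesis Hu : H \in unitmx.
Hypothesis Pk1 : P ^+ k.-1 != 0.

(** The Gram matrix of a chain is a Hankel matrix of moments. Once all moments except that of index
    [k - 1] vanish, only the antidiagonal remains. *)
Lemma hermitian_pair : exists (Y : 'M[C]_k) (b : bool),
  [/\ Y \in unitmx, P *m Y = Y *m N k & Y^H *m H *m Y = (-1) ^+ b *: revmx k].
Proof.
have /polarization[y0 hy0] : H *m P ^+ k.-1 != 0.
  apply: contraNneq Pk1 => h; by rewrite -(mulKmx Hu (P ^+ k.-1)) h mulmx0.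
have [y1 [b hy1]] := moment_normalize hy0.
have [y [sy hy]] := moment_clear k hy1.
exists (chain P y k), b.
have PY : P *m chain P y k = chain P y k *m N k by apply: chainP; rewrite Pk mul0mx.
split=> //.
  have : P ^+ k.-1 *m y != 0.
    apply: contraPneq sy => h; rewrite /s -!mulmxA h !mulmx0 mxE => /eqP.
    by rewrite eq_sym signr_eq0.
  case/matrix0Pn=> i [j hi].
  apply: (@unitmx_jordan _ _ _ P (Ordinal k0) i) => //.
  by rewrite mxE /= subn0; rewrite ord1 in hi.
apply/matrixP=> i j; rewrite mul_chain.
have -> : ((chain P y k)^H *m H *m P ^+ (k.-1 - j) *m y) i 0 =
    ((P ^+ (k.-1 - i) *m y)^H *m (H *m P ^+ 0) *m (P ^+ (k.-1 - j) *m y)) 0 0.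
  rewrite expr0 mulmx1 -!mulmxA; move: (H *m _) => B.
  by rewrite !mxE; apply: eq_bigr => a _; rewrite !adjE mxE.
rewrite moment_shift addn0 !mxE.
have hi := ltn_ord i; have hj := ltn_ord j.
case: eqP => e.
  have -> : (k.-1 - i + (k.-1 - j))%N = k.-1 by lia.
  by rewrite sy mulr1.
rewrite mulr0; have [h|h] := leqP k (k.-1 - i + (k.-1 - j)).
  by rewrite moment_ge.
by apply: hy; lia.
Qed.
End HermitianPair.

(** Put [G = u M^H]. Then [conj u M = G (1 + L)] with [L] a multiple of [N], so the Hermitian part
    of [conj u M] is [H = G (1 + L / 2)], and [K = H P] with [P = (1 + L / 2)^-1 L / (2 i)]. This
    makes [H] invertible and [P] nilpotent of the same index as [N]; [P] is selfadjoint for [H]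
    because [K] is Hermitian. The sign of the last moment selects [u] or [- u]. *)
Lemma congruent_dblock k u (M : 'M[C]_k) :
  (0 < k)%N -> `|u| = 1 -> M \in unitmx -> M = M^H *m jblock k (u ^+ 2) ->
  exists2 v, v = u \/ v = - u & congruent M (v *: dblock C k).
Proof.
move=> k0 u1 Mu hM.
have uu : u * u^* = 1 by rewrite -normCK u1 expr1n.
have u0 : u != 0 by rewrite -normr_eq0 u1 oner_eq0.
have i0 := neq0Ci C.
have two0 : 2%:R != 0 :> C by rewrite pnatr_eq0.
pose L := (u^*) ^+ 2 *: N k.
have Lk : L ^+ k = 0 by rewrite expmxZ nil_nilp scaler0.
have Lk1 : L ^+ k.-1 != 0.
  rewrite expmxZ scaler_eq0 negb_or !expf_neq0 ?conjC_eq0 //=.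
  have hk : (k.-1 < k)%N by rewrite prednK.
  apply/matrix0Pn; exists (Ordinal k0), (Ordinal hk).
  by rewrite nilX /= add0n eqxx oner_neq0.
pose G := u *: M^H.
have Gu : G \in unitmx by rewrite unitmxZ ?unitfE // unitmx_adj.
have uM : u^* *: M = G *m (1%:M + L).
  rewrite {1}hM (jblockE k (u ^+ 2)) /G /L !mulmxDr mulmx1 mul_mx_scalar.
  rewrite scalerDr scalerA -scalemxAl -scalemxAr scalerA.
  have -> : u^* * u ^+ 2 = u by rewrite expr2 mulrA [u^* * u]mulrC uu mul1r.
  by rewrite expr2 mulrA uu mul1r.
clearbody L; have [Q QE] : exists Q, Q = 1%:M + 2%:R^-1 *: L by eexists.
have Qu : Q \in unitmx.
  rewrite QE; apply: (unitmx_nilp (k := k)); rewrite ?oner_neq0 //.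
  by rewrite expmxZ Lk scaler0.
have QL : Q *m L = L *m Q.
  by rewrite QE mulmxDl mulmxDr mul1mx mulmx1 -scalemxAl -scalemxAr.
have QVL : invmx Q *m L = L *m invmx Q.
  apply: (can_inj (mulmxK Qu)); rewrite mulmxKV // -mulmxA -QL mulKmx //.
pose P := (2%:R * 'i)^-1 *: (invmx Q *m L).
have Pe e : P ^+ e = (2%:R * 'i)^-1 ^+ e *: (invmx Q ^+ e *m L ^+ e).
  by rewrite expmxZ expmxM.
have Pk : P ^+ k = 0 by rewrite Pe Lk mulmx0 scaler0.
have QVu e : invmx Q ^+ e \in unitmx.
  elim: e => [|e IH]; first by rewrite expr0 unitmx1.
  by rewrite exprS -mulmxE unitmx_mul unitmx_inv Qu.
have Pk1 : P ^+ k.-1 != 0.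
  rewrite Pe scaler_eq0 negb_or expf_neq0 ?invr_eq0 ?mulf_neq0 //=.
  apply: contraNneq Lk1 => h.
  by rewrite -(mulKmx (QVu k.-1) (L ^+ k.-1)) h mulmx0.
pose H := 2%:R^-1 *: (u^* *: M + G).
pose K := (2%:R * 'i)^-1 *: (u^* *: M - G).
have GH : G^H = u^* *: M by rewrite adjZ adjK.
have half : 2%:R^-1 * 2%:R = 1 :> C by rewrite mulVf.
have half2 : 2%:R^-1 + 2%:R^-1 = 1 :> C by rewrite -div1r -splitr.
have HG : H = G *m Q.
  rewrite QE /H uM !mulmxDr mulmx1 -scalemxAr scalerDr scalerDr.
  rewrite addrAC -scalerDl; congr (_ + _).
  by rewrite half2 scale1r.
have KG : K = H *m P.
  rewrite HG /K /P -scalemxAr mulmxA mulmxK // uM mulmxDr mulmx1; congr (_ *: _).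
  by rewrite addrAC subrr add0r.
have Hu : H \in unitmx by rewrite HG unitmx_mul Gu Qu.
have HH : H^H = H.
  by rewrite /H adjZ adjD GH adjZ -/G fmorphV /= conjC_nat conjCK addrC.
have KH : K^H = K.
  rewrite /K adjZ adjD adjN GH adjZ -/G fmorphV rmorphM /= conjC_nat conjCi conjCK.
  by rewrite mulrN invrN scaleNr -scalerN opprB.
have PH : P^H *m H = H *m P by rewrite -{1}HH -adjM -KG KH.
have MHK : u^* *: M = H + 'i *: K.
  rewrite /K scalerA invfM mulrA [_ * 2%:R^-1]mulrC -mulrA mulfV // mulr1.
  by rewrite -scalerDr addrACA subrr addr0 -mulr2n -scaler_nat scalerA half scale1r.
have [Y [b [Yu PY YY]]] := hermitian_pair HH PH Pk k0 Hu Pk1.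
exists ((-1) ^+ b * u); first by case: b {YY}; [right|left]; rewrite ?expr1 ?expr0
  ?mulN1r ?mul1r.
apply/congruentP; exists Y => //.
have -> : M = u *: (H + 'i *: K) by rewrite -MHK scalerA uu scale1r.
rewrite -scalemxAr -scalemxAl mulmxDr mulmxDl YY KG -scalemxAr -scalemxAl.
rewrite mulmxA -(mulmxA _ P) PY mulmxA YY dblockE mulrC -scalerA.
by congr (_ *: _); rewrite scalerDr -scalemxAl !scalerA [_ * 'i]mulrC.
Qed.

Lemma exists_dblock n u (A : 'M[C]_n) :
  A \in unitmx -> `|u| = 1 -> A - u ^+ 2 *: A^H \notin unitmx ->
  exists k n' v (A' : 'M[C]_n'), [/\ (0 < k)%N, v = u \/ v = - u
    & congruent A (dsum (v *: dblock C k) A')].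
Proof.
move=> Au u1 sing; have [k [X [k0 hX Mu]]] := exists_anisotropic Au u1 sing.
have [|p V hV|n' [A' [_ cA]]] := congruent_split (W := X) (Z := X^H *m A) (A := A).
- exact: Mu.
- split=> //; rewrite -mulmxA hX !mulmxA; have -> : V^H *m A^H *m X = 0.
    by apply: adj_inj; rewrite adj_form adjK hV adj0.
  by rewrite mul0mx.
set M := X^H *m A *m X in cA Mu.
have hM : M = M^H *m jblock k (u ^+ 2) by rewrite /M adj_form -mulmxA hX !mulmxA.
have [v vu cM] := congruent_dblock k0 u1 Mu hM.
exists k, n', v, A'; split=> //; apply: (congruent_trans cA).
by apply: congruent_dsum => //; apply: congruent_refl.
Qed.
End UnimodularBlock.

(** * Lists of canonical blocks *)

(* [BH k l], [BD k u] and [BJ r] stand for the summands H_{2k}(l), u Delta_k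
   (with u = e^{i theta}) and J_r(0). *)
Notation BH k l := (inl (inl (k, l))).
Notation BD k u := (inl (inr (k, u))).
Notation BJ r := (inr r).

Section Blocks.
Variable C : numClosedFieldType.
Implicit Types (m n p q k : nat) (l u : C).

Definition btype := ((nat * C) + (nat * C) + nat)%type.

Definition bdim (t : btype) : nat :=
  match t with BH k _ => k + k | BD k _ => k | BJ r => r end.

Definition bmx (t : btype) : 'M[C]_(bdim t) :=
  match t with
  | BH k l => hblock k l
  | BD k u => u *: dblock C k
  | BJ r => jblock r 0
  end.

Definition bvalid (t : btype) : bool :=
  match t with
  | BH k l => (0 < k)%N && (1 < `|l|)
  | BD k u => (0 < k)%N && (`|u| == 1)
  | BJ r => (0 < r)%N
  end.

Definition bregular (t : btype) : bool := if t is BJ _ then false else true.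

Fixpoint bsdim (ts : seq btype) : nat :=
  if ts is t :: ts' then bdim t + bsdim ts' else 0.

Fixpoint bsum (ts : seq btype) : 'M[C]_(bsdim ts) :=
  match ts return 'M[C]_(bsdim ts) with
  | [::] => 0
  | t :: ts' => dsum (bmx t) (bsum ts')
  end.

Lemma bsum_cat ts ts' : congruent (bsum (ts ++ ts')) (dsum (bsum ts) (bsum ts')).
Proof.
elim: ts => [|t ts IH] /=; first exact: congruent_dsum0l.
apply: congruent_trans (congruent_dsumA _ _ _).
by apply: congruent_dsum => //; apply: congruent_refl.
Qed.

Lemma bsum_perm ts ts' : perm_eq ts ts' -> congruent (bsum ts) (bsum ts').
Proof.
elim: ts ts' => [|t ts IH] ts' h.
  by rewrite perm_sym in h; move/perm_nilP: h => ->; apply: congruent_refl.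
have tin : t \in ts' by rewrite -(perm_mem h) mem_head.
case/splitPr: tin h => s1 s2; rewrite perm_sym perm_catC /= perm_cons => h.
have {}h : perm_eq ts (s1 ++ s2) by rewrite perm_sym perm_catC.
apply: (congruent_trans (congruent_dsum (congruent_refl _) (IH _ h))).
apply: (congruent_trans (congruent_dsum (congruent_refl _) (bsum_cat _ _))).
apply: congruent_trans (congruent_sym (bsum_cat _ _)).
apply: (congruent_trans (congruent_dsumA _ _ _)).
apply: congruent_trans (congruent_sym (congruent_dsumA _ _ _)).
by apply: congruent_dsum; [apply: congruent_dsumC|apply: congruent_refl].
Qed.

Lemma singular_pencil n (A : 'M[C]_n) :
  (0 < n)%N -> A \in unitmx -> exists2 l, l != 0 & A - l *: A^H \notin unitmx.
Proof.
move=> n0 Au; have Au' : A^H \in unitmx by rewrite unitmx_adj.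
pose T := invmx A^H *m A.
have [l hl] : exists l, root (char_poly T) l.
  by apply/closed_rootP; rewrite size_char_poly; lia.
have sing : A - l *: A^H \notin unitmx.
  have -> : A - l *: A^H = A^H *m (T - l%:M).
    by rewrite mulmxBr mulmxA mulmxV // mul1mx mul_mx_scalar.
  rewrite unitmx_mul Au' /=; apply: contraTN hl => Tu.
  by rewrite -eigenvalue_root_char /eigenvalue /eigenspace kermx_eq0 row_free_unit Tu.
exists l => //; apply: contraNneq sing => ->.
by rewrite scale0r subr0.
Qed.

Lemma regular_decomposition n (A : 'M[C]_n) :
  A \in unitmx -> exists ts,
    [/\ all bvalid ts, all bregular ts & congruent A (bsum ts)].
Proof.
have [b nb] := ubnP n; elim: b n A nb => // b IH n A nb Au.
have [n0|n0] := posnP n.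
  subst n; exists [::]; split=> //.
  rewrite [A]flatmx0 [X in congruent _ X]flatmx0; exact: congruent_refl.
suff [t [n' [A' [vt rt cA]]]] : exists t n' (A' : 'M[C]_n'),
    [/\ bvalid t, bregular t & congruent A (dsum (bmx t) A')].
  have hn := congruent_dim cA.
  have t0 : (0 < bdim t)%N.
    by case: t vt {rt cA hn} => [[[k l]|[k u]]|r] //= /andP[]; lia.
  have A'u : A' \in unitmx.
    by move: (congruent_unit cA); rewrite Au unitmx_dsum => /esym/andP[].
  have [|ts [vts rts cts]] := IH n' A' _ A'u; first by lia.
  exists (t :: ts); rewrite /= vt rt; split=> //.
  by apply: (congruent_trans cA); apply: congruent_dsum => //; apply: congruent_refl.
have [l l0 sing] := singular_pencil n0 Au.
have H_case l' : 1 < `|l'| -> A - l' *: A^H \notin unitmx ->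
    exists t n' (A' : 'M[C]_n'),
      [/\ bvalid t, bregular t & congruent A (dsum (bmx t) A')].
  move=> h s; have [|k [n' [A' [k0 cA]]]] := exists_hblock Au _ s.
    by rewrite gt_eqF.
  by exists (BH k l'), n', A'; rewrite /= k0 h.
have [h|h|h] := real_ltgtP (normr_real l) (real1 C).
(* Up to a nonzero factor the pencils at [l] and [1 / conj l] are adjoint to each other, so both are
   singular, and the second parameter lies outside the unit circle. *)
- apply: (H_case (l^*)^-1).
    by rewrite normfV norm_conjC invf_gt1 // normr_gt0.
  rewrite -unitmx_adj; have -> : (A - (l^*)^-1 *: A^H)^H = - l^-1 *: (A - l *: A^H).
    rewrite adjD adjN adjZ adjK fmorphV /= conjCK scalerBr !scaleNr scalerA.
    by rewrite mulVf // scale1r opprK addrC.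
  by rewrite unitmxZ // unitfE oppr_eq0 invr_eq0.
- exact: (H_case l h sing).
(* Either root serves: the block split off carries its own sign. *)
- pose u := sqrtC l; have uu : u ^+ 2 = l by apply: sqrtCK.
  have u1 : `|u| = 1.
    by apply/eqP; rewrite -(pexpr_eq1 (n := 2)) // -normrX uu h.
  rewrite -uu in sing; have [k [n' [v [A' [k0 vu cA]]]]] := exists_dblock Au u1 sing.
  exists (BD k v), n', A'; rewrite /= k0; split=> //.
  by case: vu => ->; rewrite ?normrN u1 eqxx.
Qed.
End Blocks.

(** * Splitting off the blocks J_r(0) *)

Section Nilpotent.
Variable C : numClosedFieldType.
Implicit Types (m n p q k u t : nat) (rs : seq nat).
Local Notation J rs := (bsum [seq (BJ r : btype C) | r <- rs]).

(* The form in a basis [U], [Z], [K] such that [U^* U], [Z^* U], [K^* Z] have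
   matrices [A], [D], [1] and all other products vanish; if [A] is J_r(0) and [D]
   the first coordinate, it is J_{r+2}(0) in the basis [K], [Z], [U]. *)
Definition ext u t (A : 'M[C]_u) (D : 'M[C]_(t, u)) : 'M[C]_(u + t + t) :=
  block_mx (block_mx A 0 D 0) 0 (row_mx 0 1%:M) 0.

(** The last basis vectors [K] lie in the right kernel and, from the left, pair only with [Z].
    Adding combinations of them to the other vectors therefore changes the [Z] columns of [M]
    arbitrarily and nothing else. *)
Lemma ext_absorb u t (M : 'M[C]_(u + t)) (X : 'M[C]_(u + t, t)) :
  congruent (block_mx M 0 (row_mx 0 1%:M) 0)
            (block_mx (M + X *m row_mx 0 1%:M) 0 (row_mx 0 1%:M) (0 : 'M[C]_t)).
Proof.
exists (block_mx 1%:M 0 X^H 1%:M), (block_mx 1%:M 0 (- X^H) 1%:M); split.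
- by rewrite mulmx_block !(mulmx0, mul0mx, mul1mx, mulmx1, addr0, add0r) subrr
  -scalar_mx_block.
- by rewrite mulmx_block !(mulmx0, mul0mx, mul1mx, mulmx1, addr0, add0r) addNr
  -scalar_mx_block.
- rewrite adj_block !adj1 adj0 adjK !mulmx_block.
  by rewrite !(mulmx0, mul0mx, mul1mx, mulmx1, addr0, add0r).
Qed.

(** The new basis is [U a], [U b + Z q] and [K q'^H]; the last must be contragredient to [q] to keep
    [K^H Z = 1]. The products with the new [Z] on the right are then absorbed. *)
Lemma ext_change u t u' t' (A : 'M[C]_u) (D : 'M[C]_(t, u)) (a : 'M[C]_(u, u'))
    (a' : 'M[C]_(u', u)) (b : 'M[C]_(u, t')) (q : 'M[C]_(t, t')) (q' : 'M[C]_(t',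
      t)) :
  a *m a' = 1%:M -> a' *m a = 1%:M -> q *m q' = 1%:M -> q' *m q = 1%:M ->
  congruent (ext A D) (ext (a^H *m A *m a) (b^H *m A *m a + q^H *m D *m a)).
Proof.
move=> aa' a'a qq' q'q.
pose S0 := block_mx a b 0 q; pose T0 := block_mx a' (- (a' *m b *m q')) 0 q'.
pose M := block_mx (a^H *m A *m a) (a^H *m A *m b)
  (b^H *m A *m a + q^H *m D *m a) (b^H *m A *m b + q^H *m D *m b).
apply: (congruent_trans (B := block_mx M 0 (row_mx 0 1%:M) (0 : 'M[C]_t'))).
  exists (block_mx S0 0 0 q'^H), (block_mx T0 0 0 q^H); split.
  - rewrite !mulmx_block !(mulmx0, mul0mx, addr0, add0r) aa' qq' -adjM qq' adj1.
    by rewrite mulmxN !mulmxA aa' mul1mx addNr -!scalar_mx_block.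
  - rewrite !mulmx_block !(mulmx0, mul0mx, addr0, add0r) a'a q'q -adjM q'q adj1.
    by rewrite mulNmx -!mulmxA q'q mulmx1 subrr -!scalar_mx_block.
  - rewrite /S0 !adj_block !adj0 adjK !mulmx_block !(mulmx0, mul0mx, addr0, add0r).
    rewrite mul_mx_row mul_row_block !mulmx_block.
    by rewrite !(mulmx0, mul0mx, addr0, add0r, mulmx1) q'q !mulmxDl.
have := ext_absorb M (- col_mx (a^H *m A *m b) (b^H *m A *m b + q^H *m D *m b)).
rewrite mulNmx mul_col_row !mulmx0 !mulmx1 /M opp_block_mx add_block_mx.
by rewrite !oppr0 !addr0 !subrr.
Qed.

Lemma inj_bij_card (I K : finType) (f : I -> K) :
  injective f -> #|K| = #|I| -> bijective f.
Proof. by move=> fI e; apply: inj_card_bij => //; rewrite e. Qed.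

Definition gext (I K : finType) (A : I -> I -> C) (D : K -> I -> C) :=
  gblock (gblock A (fun _ _ => 0) D (fun _ _ => 0)) (fun _ _ => 0)
    (fun (k : K) (x : I + K) => if x is inr k' then (k == k')%:R else 0) (fun _ _
      => 0).

Lemma congruent_ext_gmx u t (A : 'M[C]_u) (D : 'M[C]_(t, u)) :
  congruent (ext A D) (gmx (gext A D)).
Proof.
apply: (congruent_trans (congruent_gmx_ord _)).
apply: (congruent_gmx (s := fun x : 'I_u + 'I_t + 'I_t => match x with
  | inl (inl i) => lshift _ (lshift _ i) | inl (inr i) => lshift _ (rshift _ i)
  | inr i => rshift _ i end)).
  apply: inj_bij_card; last by rewrite !card_sum !card_ord.
  move=> [[x|x]|x] [[y|y]|y] /(congr1 val) /= h;
    try (by do ?congr (_ _); apply: val_inj => /=; lia);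
    by move: (ltn_ord x) (ltn_ord y); lia.
by move=> [[x|x]|x] [[y|y]|y] /=; rewrite /ext
  ?(block_mxEul, block_mxEur, block_mxEdl, block_mxEdr, row_mxEl, row_mxEr) ?mxE.
Qed.

Definition gdsum (I K : finType) (A : I -> I -> C) (B : K -> K -> C) :=
  gblock A (fun _ _ => 0) (fun _ _ => 0) B.

Lemma congruent_dsum_gmx (I K : finType) m n (A : 'M[C]_m) (B : 'M[C]_n)
    (g : I -> I -> C) (h : K -> K -> C) :
  congruent A (gmx g) -> congruent B (gmx h) -> congruent (dsum A B) (gmx (gdsum g
    h)).
Proof.
move=> cA cB; apply: (congruent_trans (congruent_dsum cA cB)).
apply: (congruent_trans (congruent_block_gmx _ _ _ _)).
apply: (congruent_gmx (s := fun x : I + K => match x with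
  inl i => inl (enum_rank i) | inr k => inr (enum_rank k) end)).
  by apply: bij_sum; apply: enum_rank_bij.
by move=> [x|x] [y|y]; rewrite /= !mxE ?enum_rankK.
Qed.

Lemma ext_dsum u t u' t' (A : 'M[C]_u) (D : 'M[C]_(t, u)) (A' : 'M[C]_u')
    (D' : 'M[C]_(t', u')) :
  congruent (ext (dsum A A') (block_mx D 0 0 D')) (dsum (ext A D) (ext A' D')).
Proof.
apply: (congruent_trans (congruent_ext_gmx _ _)).
apply: (congruent_trans _ (congruent_sym (congruent_dsum_gmx
  (congruent_ext_gmx A D) (congruent_ext_gmx A' D')))).
pose s (x : ('I_u + 'I_t + 'I_t) + ('I_u' + 'I_t' + 'I_t')) :
    'I_(u + u') + 'I_(t + t') + 'I_(t + t') := match x with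
  | inl (inl (inl i)) => inl (inl (lshift _ i))
  | inl (inl (inr i)) => inl (inr (lshift _ i))
  | inl (inr i) => inr (lshift _ i)
  | inr (inl (inl i)) => inl (inl (rshift _ i))
  | inr (inl (inr i)) => inl (inr (rshift _ i))
  | inr (inr i) => inr (rshift _ i) end.
apply: (congruent_gmx (s := s)).
  apply: inj_bij_card; last by rewrite !card_sum !card_ord; lia.
  move=> [[[x|x]|x]|[[x|x]|x]] [[[y|y]|y]|[[y|y]|y]] //= [] h;
    try (by rewrite h); try (by do ?congr (_ _); apply: val_inj => /=; lia);
    by move: (ltn_ord x) (ltn_ord y); lia.
move=> [[[x|x]|x]|[[x|x]|x]] [[[y|y]|y]|[[y|y]|y]] //=; rewrite /dsum
  ?(block_mxEul, block_mxEur, block_mxEdl, block_mxEdr) ?mxE //.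
- by rewrite eq_lrshift.
- by rewrite eq_rlshift.
- by rewrite (inj_eq (@rshift_inj _ _)).
Qed.

Lemma ext_row0 u t u' (A : 'M[C]_u) (A' : 'M[C]_u') (D' : 'M[C]_(t, u')) :
  congruent (ext (dsum A A') (row_mx 0 D')) (dsum A (ext A' D')).
Proof.
apply: (congruent_trans (congruent_ext_gmx _ _)).
apply: (congruent_trans _ (congruent_sym (congruent_dsum_gmx
  (congruent_gmx_ord A) (congruent_ext_gmx A' D')))).
pose s (x : 'I_u + ('I_u' + 'I_t + 'I_t)) : 'I_(u + u') + 'I_t + 'I_t := match x with
  | inl i => inl (inl (lshift _ i))
  | inr (inl (inl i)) => inl (inl (rshift _ i))
  | inr (inl (inr i)) => inl (inr i)
  | inr (inr i) => inr i end.
apply: (congruent_gmx (s := s)).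
  apply: inj_bij_card; last by rewrite !card_sum !card_ord; lia.
  move=> [x|[[x|x]|x]] [y|[[y|y]|y]] //= [] h;
    try (by rewrite h); try (by do ?congr (_ _); apply: val_inj => /=; lia);
    by move: (ltn_ord x) (ltn_ord y); lia.
by move=> [x|[[x|x]|x]] [y|[[y|y]|y]] //=; rewrite /dsum
  ?(block_mxEul, block_mxEur, block_mxEdl, block_mxEdr, row_mxEl, row_mxEr) ?mxE.
Qed.

(** A [Z] vector whose row in [D] is zero is orthogonal, together with its dual [K] vector, to
    everything else; such pairs become blocks J_2(0). *)
Lemma ext_col0 u t t' (A : 'M[C]_u) (D : 'M[C]_(t, u)) :
  congruent (ext A (col_mx D (0 : 'M_(t', u))))
    (dsum (ext A D) (block_mx 0 0 1%:M (0 : 'M_t'))).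
Proof.
apply: (congruent_trans (congruent_ext_gmx _ _)).
apply: (congruent_trans _ (congruent_sym (congruent_dsum_gmx
  (congruent_ext_gmx A D) (congruent_block_gmx _ _ _ _)))).
pose s (x : ('I_u + 'I_t + 'I_t) + ('I_t' + 'I_t')) :
    'I_u + 'I_(t + t') + 'I_(t + t') := match x with
  | inl (inl (inl i)) => inl (inl i)
  | inl (inl (inr i)) => inl (inr (lshift _ i))
  | inl (inr i) => inr (lshift _ i)
  | inr (inl i) => inl (inr (rshift _ i))
  | inr (inr i) => inr (rshift _ i) end.
apply: (congruent_gmx (s := s)).
  apply: inj_bij_card; last by rewrite !card_sum !card_ord; lia.
  move=> [[[x|x]|x]|[x|x]] [[[y|y]|y]|[y|y]] //= [] h;
    try (by rewrite h); try (by do ?congr (_ _); apply: val_inj => /=; lia);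
    by move: (ltn_ord x) (ltn_ord y); lia.
move=> [[[x|x]|x]|[x|x]] [[[y|y]|y]|[y|y]] //=; rewrite
  ?(col_mxEu, col_mxEd) ?mxE //.
- by rewrite eq_lrshift.
- by rewrite eq_rlshift.
- by rewrite (inj_eq (@rshift_inj _ _)).
Qed.

Definition first_row r : 'M[C]_(1, r) := \row_j (j == 0%N :> nat)%:R.

Lemma ext_jblock r : congruent (ext (jblock r 0) (first_row r)) (jblock r.+2 0).
Proof.
apply: (congruent_trans (congruent_ext_gmx _ _)).
apply: (congruent_trans _ (congruent_sym (congruent_gmx_ord _))).
apply: congruent_sym.
pose s (x : 'I_r + 'I_1 + 'I_1) : 'I_r.+2 := match x with
  | inl (inl i) => lift ord0 (lift ord0 i)
  | inl (inr i) => lift ord0 ord0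
  | inr i => ord0 end.
apply: (congruent_gmx (s := s)).
  apply: inj_bij_card; last by rewrite !card_sum !card_ord; lia.
  move=> [[x|x]|x] [[y|y]|y] /(congr1 val) //=; rewrite ?ord1 //.
  by rewrite /bump /= !add1n => -[] /val_inj ->.
move=> [[x|x]|x] [[y|y]|y] //=; rewrite ?mxE //= /bump ?add1n ?eqSS //.
  by rewrite eq_sym; case: eqP.
by rewrite (ord1 x) (ord1 y) eqxx.
Qed.

Lemma congruent_empty m n (A : 'M[C]_m) (B : 'M[C]_n) :
  m = 0%N -> n = 0%N -> congruent A B.
Proof.
move=> m0 n0; subst m n; have -> : A = B by apply/matrixP=> -[].
exact: congruent_refl.
Qed.

Lemma swap_jblock t :
  congruent (block_mx 0 0 1%:M (0 : 'M[C]_t)) (J (nseq t 2%N)).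
Proof.
elim: t => [|t IH] /=.
  exact: congruent_empty.
apply: congruent_trans (congruent_dsum (congruent_refl _) IH).
apply: (congruent_trans (congruent_block_gmx _ _ _ _)).
apply: (congruent_trans _ (congruent_sym (congruent_dsum_gmx
  (congruent_gmx_ord _) (congruent_block_gmx _ _ _ _)))).
pose s (x : 'I_2 + ('I_t + 'I_t)) : 'I_t.+1 + 'I_t.+1 := match x with
  | inl i => if i == ord0 then inr ord0 else inl ord0
  | inr (inl i) => inl (lift ord0 i)
  | inr (inr i) => inr (lift ord0 i) end.
have ord2 (x : 'I_2) : x = ord0 \/ x = lift ord0 ord0.
  by case: x => [[|[|?]] ?] //; [left|right]; apply: val_inj.
apply: (congruent_gmx (s := s)).
  apply: inj_bij_card; last by rewrite !card_sum !card_ord; lia.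
  move=> [x|[x|x]] [y|[y|y]] //=; do 1?[case: (ord2 x) => ->]; do 1?[case: (ord2 y)
    => ->] => //=.
  - move/(congr1 (fun z => if z is inl a then val a else 0%N)) => /=.
    by rewrite /bump !add1n => -[] /val_inj ->.
  - move/(congr1 (fun z => if z is inr a then val a else 0%N)) => /=.
    by rewrite /bump !add1n => -[] /val_inj ->.
move=> [x|[x|x]] [y|[y|y]] //=; do 1?[case: (ord2 x) => ->]; do 1?[case: (ord2 y)
  => ->] => //=;
  rewrite ?mxE //=.
Qed.

Lemma zero_jblock d : congruent (0 : 'M[C]_d) (J (nseq d 1%N)).
Proof.
elim: d => [|d IH] /=; first exact: congruent_refl.
apply: congruent_trans (congruent_dsum (congruent_refl _) IH).
have -> : jblock 1 (0 : C) = 0.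
  by apply/matrixP=> i j; rewrite !mxE !ord1.
by rewrite /dsum block_mx0; apply: congruent_refl.
Qed.
End Nilpotent.

(** * Kernels of nilpotent sums and reduction of a singular form *)

Section NilpotentDecomposition.
Variable C : numClosedFieldType.
Implicit Types (m n p q k u t : nat) (rs : seq nat).
Local Notation J rs := (bsum [seq (BJ r : btype C) | r <- rs]).

Fixpoint first_rows rs : 'M[C]_(size rs, bsdim [seq (BJ r : btype C) | r <- rs]) :=
  match rs with
  | [::] => 0
  | r :: rs' => block_mx (first_row C r) 0 0 (first_rows rs')
  end.

Lemma ext_first_rows rs :
  congruent (ext (J rs) (first_rows rs)) (J [seq r.+2 | r <- rs]).
Proof.
elim: rs => [|r rs IH] /=; first exact: congruent_empty.
apply: (congruent_trans (ext_dsum (jblock r 0) (first_row C r) (J rs) (first_rows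
  rs))).
by apply: congruent_dsum => //; apply: ext_jblock.
Qed.

Lemma first_row_mul r p (X : 'M[C]_(r, p)) (h : (0 < r)%N) i j :
  (first_row C r *m X) i j = X (Ordinal h) j.
Proof.
rewrite mxE (bigD1 (Ordinal h)) //= big1 => [|a aN]; rewrite mxE.
  by rewrite eqxx mul1r addr0.
by move: aN; rewrite -val_eqE /= => /negPf->; rewrite mul0r.
Qed.

Lemma complement_dsum a s b t (A : 'M[C]_a) (F : 'M[C]_(s, a)) G
    (A' : 'M[C]_b) (F' : 'M[C]_(t, b)) G' :
  A *m F^T = 0 -> F *m F^T = 1%:M -> G *m A = 1%:M - F^T *m F ->
  A' *m F'^T = 0 -> F' *m F'^T = 1%:M -> G' *m A' = 1%:M - F'^T *m F' ->
  [/\ dsum A A' *m (block_mx F 0 0 F')^T = 0,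
      block_mx F 0 0 F' *m (block_mx F 0 0 F')^T = 1%:M
    & block_mx G 0 0 G' *m dsum A A'
      = 1%:M - (block_mx F 0 0 F')^T *m block_mx F 0 0 F'].
Proof.
move=> e1 e2 e3 h1 h2 h3; rewrite /dsum tr_block_mx !trmx0.
rewrite !mulmx_block !(mulmx0, mul0mx, addr0, add0r) e1 e2 e3 h1 h2 h3.
rewrite block_mx0 -scalar_mx_block; split=> //.
by rewrite [in RHS]scalar_mx_block opp_block_mx add_block_mx !oppr0 !addr0.
Qed.

(** The kernel of J_r(0) is its first coordinate line, so the transpose of [first_rows] embeds
    [ker (J rs)]. The last identity says that linear forms vanishing on this kernel factor through
    [J rs]; blockwise [G] is the transpose of the Jordan block. *)
Lemma first_rows_complement rs : all (leq 1) rs ->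
  exists G, [/\ J rs *m (first_rows rs)^T = 0,
    first_rows rs *m (first_rows rs)^T = 1%:M
    & G *m J rs = 1%:M - (first_rows rs)^T *m first_rows rs].
Proof.
elim: rs => [|r rs IH] /=.
  by move=> _; exists 0; split; apply/matrixP=> -[].
case/andP=> r0 /IH[G [h1 h2 h3]].
have e1 : jblock r 0 *m (first_row C r)^T = 0.
  apply/matrixP=> i j; have [h|h] := ltnP i.+1 r.
    by rewrite (mul_nil_lt _ _ h) !mxE.
  by rewrite mul_nil_last // mxE.
have e2 : first_row C r *m (first_row C r)^T = 1%:M.
  by apply/matrixP=> i j; rewrite (first_row_mul _ r0) !mxE !ord1 eqxx.
have e3 : (jblock r 0)^T *m jblock r 0 = 1%:M - (first_row C r)^T *m first_row C r.
  apply/matrixP=> i [[|j] hj].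
    rewrite mul_nilr_0 // !mxE big_ord1 !mxE -val_eqE /= mulr1.
    by case: eqP => _; rewrite ?subrr ?subr0.
  have hj' : (j < r)%N by apply: ltnW.
  rewrite (@mul_nilr_S _ _ _ _ _ _ (Ordinal hj')) // !mxE big_ord1 !mxE -val_eqE /=.
  rewrite mulr0 subr0; case: eqP => [<-|_]; first by rewrite ltn_eqF.
  by rewrite eq_sym; case: eqP.
exists (block_mx (jblock r 0)^T 0 0 G).
exact: complement_dsum e1 e2 e3 h1 h2 h3.
Qed.

Lemma left_inverse m n (W : 'M[C]_(m, n)) :
  (forall p (x : 'M[C]_(n, p)), W *m x = 0 -> x = 0) -> exists Z, Z *m W = 1%:M.
Proof.
move=> inj; have : row_free W^T.
  rewrite -kermx_eq0; apply/eqP/trmx_inj; rewrite trmx0.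
  by apply: inj; apply: trmx_inj; rewrite trmx_mul trmxK mulmx_ker trmx0.
case/row_freeP=> B hB; exists B^T; apply: trmx_inj.
by rewrite trmx_mul trmxK hB trmx1.
Qed.

Lemma kernel_basis m n (A : 'M[C]_(m, n)) :
  exists d (K : 'M[C]_(n, d)) (L : 'M[C]_(d, n)),
    [/\ d = (n - \rank A)%N, A *m K = 0, L *m K = 1%:M
      & forall p (x : 'M[C]_(n, p)), A *m x = 0 -> exists w, x = K *m w].
Proof.
pose K := (row_base (kermx A^T))^T.
have /row_freeP[B hB] := row_base_free (kermx A^T).
exists _, K, B^T; split.
- by rewrite mxrank_ker mxrank_tr.
- apply: trmx_inj; rewrite trmx_mul trmxK trmx0.
  by apply/sub_kermxP; rewrite eq_row_base.
- by apply: trmx_inj; rewrite trmx_mul !trmxK hB trmx1.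
- move=> p x Ax; have /submxP[w hw] : (x^T <= row_base (kermx A^T))%MS.
    by rewrite eq_row_base; apply/sub_kermxP; rewrite -trmx_mul Ax trmx0.
  by exists w^T; apply: trmx_inj; rewrite hw trmx_mul !trmxK.
Qed.

(** Modulo the right kernel [K], the vectors [U] span the right orthogonal of [K], and [Zd]
    complements them. The kernel splits into [K1], dual to [Zd], and [K0], which is null on both
    sides and gives the zero summand. The remaining products with [Zd] on the right are absorbed by
    [K1]. *)
Lemma singular_reduction n (A : 'M[C]_n) : A \notin unitmx ->
  exists u t d (A1 : 'M[C]_u) (D : 'M[C]_(t, u)),
    [/\ (u < n)%N,
        forall p (x : 'M[C]_(u, p)), A1 *m x = 0 -> D *m x = 0 -> x = 0
      & congruent A (dsum (ext A1 D) (0 : 'M[C]_d))].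
Proof.
move=> Anu; have [d0 [K [L [hd AK LK Kker]]]] := kernel_basis A.
have d00 : (0 < d0)%N.
  rewrite hd subn_gt0 ltn_neqAle rank_leq_row andbT.
  by move: Anu; rewrite -row_free_unit.
have [v [V [Q [KVLQ LQKV LV]]]] := basis_complement LK.
move: LQKV; rewrite mul_col_row LK LV scalar_mx_block => /eq_block_mx[_ _ QK QV].
rewrite mul_row_col in KVLQ.
pose A21 := K^H *m A *m V.
have [u [W1 [L1 [_ AW1 LW1 W1ker]]]] := kernel_basis A21.
have [t [V1 [Q1 [WVLQ LQWV LV1]]]] := basis_complement LW1.
move: LQWV; rewrite mul_col_row LW1 LV1 scalar_mx_block => /eq_block_mx[_ _ QW1 QV1].
rewrite mul_row_col in WVLQ.
(* [Zd] meets the right orthogonal of the kernel trivially, so its pairing with the kernel is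
   injective; the left inverse selects the part of the kernel dual to [Zd]. *)
have [Z2 ZW2] : exists Z, Z *m (A21 *m V1) = 1%:M.
  apply: left_inverse => p x; rewrite -mulmxA => /W1ker[w hw].
  by rewrite -[x]mul1mx -QV1 -mulmxA hw mulmxA QW1 mul0mx.
have [d [V2 [Q2 [WVZQ ZQWV ZV2]]]] := basis_complement ZW2.
have hdim : d0 = (t + d)%N.
  by apply/eqP; rewrite eqn_leq (mulmx1_min WVZQ) (mulmx1_min ZQWV).
move: ZQWV; rewrite mul_col_row ZW2 ZV2 scalar_mx_block => /eq_block_mx[_ _ QW2 QV2].
rewrite mul_row_col in WVZQ.
pose U := V *m W1; pose Zd := V *m V1; pose K1 := K *m Z2^H; pose K0 := K *m Q2^H.
pose S := row_mx (row_mx (row_mx U Zd) K1) K0.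
pose T := col_mx (col_mx (col_mx (L1 *m Q) (Q1 *m Q)) ((A21 *m V1)^H *m L)) (V2^H
  *m L).
have ST : S *m T = 1%:M.
  have ZWV : Z2^H *m (A21 *m V1)^H + Q2^H *m V2^H = 1%:M.
    by rewrite -!adjM -adjD WVZQ adj1.
  have a1 : U *m (L1 *m Q) + Zd *m (Q1 *m Q) = V *m Q.
    rewrite -!(mulmxA V) -mulmxDr; congr (_ *m _).
    by rewrite !mulmxA -mulmxDl WVLQ mul1mx.
  have a2 : K1 *m ((A21 *m V1)^H *m L) + K0 *m (V2^H *m L) = K *m L.
    rewrite -!(mulmxA K) -mulmxDr; congr (_ *m _).
    by rewrite !(mulmxA _ _ L) -mulmxDl ZWV mul1mx.
  by rewrite /S /T !mul_row_col -addrA a1 a2 addrC.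
have TS : T *m S = 1%:M.
  have Z1 : (A21 *m V1)^H *m Z2^H = 1%:M by rewrite -adjM ZW2 adj1.
  have Z3 : V2^H *m Z2^H = 0 by rewrite -adjM ZV2 adj0.
  have Z4 : (A21 *m V1)^H *m Q2^H = 0 by rewrite -adjM QW2 adj0.
  have Z5 : V2^H *m Q2^H = 1%:M by rewrite -adjM QV2 adj1.
  have QVx a b (x : 'M_(a, _)) (y : 'M_(_, b)) : x *m Q *m (V *m y) = x *m y.
    by rewrite mulmxA -(mulmxA x) QV mulmx1.
  have QKx a b (x : 'M_(a, _)) (y : 'M_(_, b)) : x *m Q *m (K *m y) = 0.
    by rewrite mulmxA -(mulmxA x) QK mulmx0 mul0mx.
  have LVx a b (x : 'M_(a, _)) (y : 'M_(_, b)) : x *m L *m (V *m y) = 0.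
    by rewrite mulmxA -(mulmxA x) LV mulmx0 mul0mx.
  have LKx a b (x : 'M_(a, _)) (y : 'M_(_, b)) : x *m L *m (K *m y) = x *m y.
    by rewrite mulmxA -(mulmxA x) LK mulmx1.
  rewrite /S /T !mul_col_row ?mul_col_mx ?mul_mx_row.
  rewrite /U /Zd /K1 /K0 !(QVx, QKx, LVx, LKx).
  rewrite LW1 LV1 QW1 QV1 Z1 Z3 Z4 Z5 !(row_mx0, col_mx0).
  by rewrite -!scalar_mx_block.
exists u, t, d, (U^H *m A *m U), (Zd^H *m A *m U).
have AK1 : A *m K1 = 0 by rewrite mulmxA AK mul0mx.
have AK0 : A *m K0 = 0 by rewrite mulmxA AK mul0mx.
have KU : K1^H *m A *m U = 0.
  by rewrite adjM adjK -!mulmxA (mulmxA A) (mulmxA K^H) (mulmxA K^H) AW1 mulmx0.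
have KZ : K1^H *m A *m Zd = 1%:M.
  by rewrite adjM adjK -!mulmxA (mulmxA A) (mulmxA K^H) (mulmxA K^H) ZW2.
have K0U : K0^H *m A *m U = 0.
  by rewrite adjM adjK -!mulmxA (mulmxA A) (mulmxA K^H) (mulmxA K^H) AW1 mulmx0.
have K0Z : K0^H *m A *m Zd = 0.
  by rewrite adjM adjK -!mulmxA (mulmxA A) (mulmxA K^H) (mulmxA K^H) QW2.
have cA : congruent A (dsum (block_mx (block_mx (U^H *m A *m U) (U^H *m A *m Zd)
    (Zd^H *m A *m U) (Zd^H *m A *m Zd)) 0 (row_mx 0 1%:M) (0 : 'M[C]_t)) (0 :
      'M[C]_d)).
  exists S, T; split=> //.
  rewrite /S !adj_row !mul_col_mx !mul_mx_row.
  have ZZ a (x : 'M[C]_(a, n)) : (x *m A *m K1 = 0) * (x *m A *m K0 = 0).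
    by rewrite -!mulmxA AK1 AK0 !mulmx0.
  have colrow a b c e (X : 'M[C]_(a, b)) (Y : 'M[C]_(c, b)) :
      col_mx (row_mx X (0 : 'M_(a, e))) (row_mx Y 0) = row_mx (col_mx X Y) 0.
    by rewrite -block_mxEv block_mxEh col_mx0.
  have colrow0 a b c e (X : 'M[C]_(a, b)) :
      col_mx (row_mx X (0 : 'M_(a, e))) (0 : 'M_(c, b + e)) = row_mx (col_mx X 0) 0.
    by rewrite -colrow row_mx0.
  by rewrite !ZZ KU KZ K0U K0Z !colrow !row_mx0 /dsum /block_mx !colrow colrow0.
split.
- have hn := congruent_dim cA; lia.
- move=> p x h1 h2.
  (* Every basis vector is left orthogonal to [U x]: [U] and [Zd] by hypothesis, the kernel vectors
     by construction. So [U x] lies in the kernel, which [U] meets trivially. *)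
  have AUx : A *m U *m x = 0.
    rewrite -[LHS]mul1mx -adj1 -ST adjM -mulmxA.
    suff -> : S^H *m (A *m U *m x) = 0 by rewrite mulmx0.
    rewrite /S !adj_row !mul_col_mx; clearbody U Zd K1 K0.
    by rewrite !mulmxA h1 h2 KU K0U !mul0mx !col_mx0.
  have [w hw] : exists w, U *m x = K *m w by apply: Kker; rewrite mulmxA.
  have LU : L1 *m Q *m U = 1%:M by rewrite /U mulmxA -(mulmxA L1) QV mulmx1.
  clearbody U.
  by rewrite -[x]mul1mx -LU -!mulmxA hw (mulmxA Q) QK mul0mx mulmx0.
- apply: (congruent_trans cA); apply: congruent_dsum; last exact: congruent_refl.
  have := ext_absorb (block_mx (U^H *m A *m U) (U^H *m A *m Zd)
    (Zd^H *m A *m U) (Zd^H *m A *m Zd)) (- col_mx (U^H *m A *m Zd) (Zd^H *m A *m Zd)).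
  rewrite mulNmx mul_col_row !mulmx0 !mulmx1 opp_block_mx add_block_mx.
  by rewrite !oppr0 !addr0 !subrr.
Qed.
End NilpotentDecomposition.

Section Decomposition.
Variable C : numClosedFieldType.
Implicit Types (m n p q k u t : nat) (rs : seq nat).
Local Notation J rs := (bsum [seq (BJ r : btype C) | r <- rs]).

(** [D] is injective on [ker B], which contains the columns of [F^T], so a change [q] of the [Z]
    vectors brings [D F^T] to [1] above [0]. The rest of [q^H D] vanishes on these columns, hence
    factors through [B], and is removed by adding combinations of [U] to [Z]; this is the choice of
    [b] in [ext_change]. *)
Lemma ext_normal u t (B : 'M[C]_u) s (F : 'M[C]_(s, u)) (G : 'M[C]_u) (D :
  'M[C]_(t, u)) :
  B *m F^T = 0 -> F *m F^T = 1%:M -> G *m B = 1%:M - F^T *m F ->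
  (forall p (x : 'M[C]_(u, p)), B *m x = 0 -> D *m x = 0 -> x = 0) ->
  exists t', congruent (ext B D) (ext B (col_mx F (0 : 'M_(t', u)))).
Proof.
move=> BF FF GB inj.
have [Z ZW] : exists Z, Z *m (D *m F^T) = 1%:M.
  apply: left_inverse => p x Dx.
  have /inj : B *m (F^T *m x) = 0 by rewrite mulmxA BF mul0mx.
  rewrite mulmxA Dx => /(_ erefl) h.
  by rewrite -[x]mul1mx -FF -mulmxA h mulmx0.
have [t' [V [Q [h1 h2 _]]]] := basis_complement ZW.
pose q := (col_mx Z Q)^H; pose q' := (row_mx (D *m F^T) V)^H.
exists t'; have := @ext_change _ _ _ _ _ B D 1%:M 1%:M (- (q^H *m D *m G)^H) q q'.
rewrite adj1 !mulmx1 !mul1mx adjN adjK; case=> //.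
- by rewrite -adjM h1 adj1.
- by rewrite -adjM h2 adj1.
have -> : - (q^H *m D *m G) *m B + q^H *m D = col_mx F 0.
  rewrite mulNmx -!mulmxA GB !mulmxBr !mulmx1 opprB addrNK /q adjK.
  move: h2; rewrite mul_col_row scalar_mx_block => /eq_block_mx[e1 _ e3 _].
  by rewrite (mulmxA D) !mul_col_mx (mulmxA Z) (mulmxA Q) e1 e3 mul1mx mul0mx.
by move=> S [T hS]; exists S, T.
Qed.

Lemma nilpotent_decomposition n (A : 'M[C]_n) :
  exists n' (A' : 'M[C]_n') rs,
    [/\ A' \in unitmx, all (leq 1) rs & congruent A (dsum A' (J rs))].
Proof.
have [b nb] := ubnP n; elim: b n A nb => // b IH n A nb.
have [Au|Anu] := boolP (A \in unitmx).
  by exists n, A, [::]; split=> //; apply: congruent_dsum0r.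
have [u [t [d [A1 [D [un inj cA]]]]]] := singular_reduction Anu.
have [|n' [A' [rs [A'u rs0 cA1]]]] := IH u A1 _; first by lia.
have [S [T [ST TS eA1]]] := cA1.
have [G [h1 h2 h3]] := first_rows_complement C rs0.
(* The invertible summand contributes nothing to the kernel, so [F] is zero there and [invmx A']
   completes [G]. *)
pose F := row_mx (0 : 'M[C]_(size rs, n')) (first_rows C rs).
pose G' := block_mx (invmx A') 0 0 G.
have [||||t' cE] := @ext_normal _ t (dsum A' (J rs)) _ F G' (D *m S).
- rewrite /F /dsum tr_row_mx trmx0 mul_block_col !(mulmx0, mul0mx, addr0, add0r).
  by rewrite h1 col_mx0.
- by rewrite /F tr_row_mx mul_row_col mul0mx add0r h2.
- rewrite /F /G' /dsum tr_row_mx trmx0 mulmx_block mul_col_row.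
  rewrite !(mulmx0, mul0mx, addr0, add0r) mulVmx // h3 scalar_mx_block.
  by rewrite opp_block_mx add_block_mx !oppr0 !addr0.
- move=> p x hx1 hx2; have Sx : S *m x = 0.
    apply: inj; last by rewrite mulmxA.
    have : T^H *m (S^H *m A1 *m S *m x) = 0 by rewrite -eA1 hx1 mulmx0.
    by rewrite !mulmxA -adjM ST adj1 mul1mx -mulmxA.
  by rewrite -[x]mul1mx -TS -mulmxA Sx mulmx0.
(* Blocks of the reduced form grow by two, the [t'] unmatched pairs of [Z] and [K] vectors give
   J_2(0), and the two-sided kernel gives J_1(0). *)
exists n', A', ([seq r.+2 | r <- rs] ++ nseq t' 2%N ++ nseq d 1%N); split=> //.
  rewrite !all_cat !all_nseq !orbT !andbT all_map.
  by apply/allP.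
apply: (congruent_trans cA).
rewrite !map_cat.
have c1 : congruent (ext A1 D) (ext (dsum A' (J rs)) (D *m S)).
  have := @ext_change _ _ _ _ _ A1 D S T 0 1%:M 1%:M ST TS.
  rewrite -eA1 adj0 adj1 !mul0mx add0r !mul1mx; exact.
have c2 := ext_col0 t' (dsum A' (J rs)) F.
have c3 := ext_row0 A' (J rs) (first_rows C rs).
have c4 := ext_first_rows C rs.
have c5 : congruent (ext A1 D) (dsum (dsum A' (J [seq r.+2 | r <- rs])) (J (nseq t'
  2%N))).
  apply: (congruent_trans c1); apply: (congruent_trans cE).
  apply: (congruent_trans c2); apply: congruent_dsum; last exact: swap_jblock.
  apply: (congruent_trans c3); apply: congruent_dsum c4; exact: congruent_refl.
apply: (congruent_trans (congruent_dsum c5 (zero_jblock C d))).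
apply: (congruent_trans (congruent_sym (congruent_dsumA _ _ _))).
apply: (congruent_trans (congruent_sym (congruent_dsumA _ _ _))).
apply: congruent_dsum; first exact: congruent_refl.
apply: congruent_trans (congruent_sym (bsum_cat _ _)).
apply: congruent_dsum; first exact: congruent_refl.
exact: congruent_sym (bsum_cat _ _).
Qed.

Lemma decomposition n (A : 'M[C]_n) :
  exists2 ts, all (@bvalid C) ts & congruent A (bsum ts).
Proof.
have [n' [A' [rs [A'u rs0 cA]]]] := nilpotent_decomposition A.
have [ts [vts _ cts]] := regular_decomposition A'u.
exists (ts ++ [seq (BJ r : btype C) | r <- rs]).
  by rewrite all_cat vts all_map.
apply: (congruent_trans cA); apply: congruent_trans (congruent_sym (bsum_cat _ _)).
by apply: congruent_dsum => //; apply: congruent_refl.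
Qed.
End Decomposition.

(** * Uniqueness of the blocks J_r(0) *)

Section Perps.
Variable C : numClosedFieldType.
Implicit Types (m n p q k u t j : nat).

(* Subspaces are row spaces: the rows [v] of [perp A W] are those such that
   [w^* A v = 0] for the (transposed) rows [w] of [W]. *)
Definition perp n (A : 'M[C]_n) (W : 'M[C]_n) : 'M[C]_n := kermx (A^T *m W^H).

Definition perps n (A : 'M[C]_n) j : 'M[C]_n := iter j (perp A) 1%:M.

Lemma perpP n (A W : 'M[C]_n) p (V : 'M[C]_(p, n)) :
  (V <= perp A W)%MS = (V *m A^T *m W^H == 0).
Proof. by rewrite sub_kermx mulmxA. Qed.

Lemma perpS n (A W W' : 'M[C]_n) : (W' <= W)%MS -> (perp A W <= perp A W')%MS.
Proof.
case/submxP=> D ->; rewrite perpP adjM mulmxA.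
have := submx_refl (perp A W); rewrite perpP => /eqP->.
by rewrite mul0mx.
Qed.

Lemma perp_eqmx n (A W W' : 'M[C]_n) : (W :=: W')%MS -> (perp A W :=: perp A W')%MS.
Proof.
by move=> e; apply/eqmxP; rewrite !perpS ?e.
Qed.

Lemma rank_perp n (A W : 'M[C]_n) : A \in unitmx -> \rank (perp A W) = (n - \rank
  W)%N.
Proof.
move=> Au; rewrite mxrank_ker -mxrank_tr trmx_mul trmxK mxrankMfree.
  by rewrite mxrank_tr mxrank_map mxrank_tr.
by rewrite row_free_unit.
Qed.

Lemma rank_perps_congruent m n (A : 'M[C]_m) (B : 'M[C]_n) j :
  congruent A B -> \rank (perps A j) = \rank (perps B j).
Proof.
move=> cAB; have e := congruent_dim cAB; subst m.
case/congruentP: cAB => S Su ->; set B' := S^H *m A *m S.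
have eB : (perps B' j :=: perps A j *m (invmx S)^T)%MS.
  elim: j => [|j IH] /=.
    apply/eqmx_sym; rewrite mul1mx; apply/eqmxP.
    by rewrite submx1 sub1mx row_full_unit unitmx_tr unitmx_inv.
  apply: (eqmx_trans (perp_eqmx _ IH)).
  set W := perps A j.
  have key p (V : 'M_(p, n)) :
      V *m B'^T *m (W *m (invmx S)^T)^H = V *m S^T *m A^T *m W^H.
    rewrite /B' !trmx_mul adjM !mulmxA; congr (_ *m _); rewrite -!mulmxA.
    congr (_ *m (_ *m _)); have -> : ((invmx S)^T)^H = (invmx S)^H^T.
      by apply/matrixP=> a b; rewrite !(adjE, mxE).
    by rewrite -trmx_mul -adjM mulmxV // adj1 trmx1 mulmx1.
  apply/eqmxP/andP; split.
    have : (perp B' (W *m (invmx S)^T) *m S^T <= perp A W)%MS.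
      rewrite perpP -key; have := submx_refl (perp B' (W *m (invmx S)^T)).
      by rewrite perpP.
    by move/(submxMr (invmx S)^T); rewrite -mulmxA -trmx_mul mulVmx // trmx1 mulmx1.
  rewrite perpP key -!mulmxA (mulmxA _^T) -trmx_mul mulmxV // trmx1 mul1mx mulmxA.
  by have := submx_refl (perp A W); rewrite perpP -mulmxA.
by rewrite eB mxrankMfree // row_free_unit unitmx_tr unitmx_inv.
Qed.

Lemma rank_perps_dsum m n (A : 'M[C]_m) (B : 'M[C]_n) j :
  \rank (perps (dsum A B) j) = (\rank (perps A j) + \rank (perps B j))%N.
Proof.
rewrite -rank_diag_block_mx; apply/eqmx_rank/eqmxP.
elim: j => [|j IH] /=; first by rewrite -scalar_mx_block; apply: eqmx_refl.
apply: (eqmx_trans (perp_eqmx _ IH)).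
set V := perps A j; set W := perps B j.
have kV : perp A V *m (A^T *m V^H) = 0 by rewrite /perp mulmx_ker.
have kW : perp B W *m (B^T *m W^H) = 0 by rewrite /perp mulmx_ker.
have e : (dsum A B)^T *m (block_mx V 0 0 W)^H = block_mx (A^T *m V^H) 0 0 (B^T *m
  W^H).
  by rewrite tr_block_mx adj_block !trmx0 !adj0 mulmx_block
    !(mulmx0, mul0mx, addr0, add0r).
apply/eqmx_sym/eqmxP.
rewrite -(mxrank_leqif_eq (n := m + n)); last first.
  rewrite perpP -mulmxA e mulmx_block !(mulmx0, mul0mx, addr0, add0r) kV kW.
  by rewrite block_mx0.
rewrite rank_diag_block_mx /perp e !mxrank_ker rank_diag_block_mx.
have := rank_leq_row (A^T *m V^H); have := rank_leq_row (B^T *m W^H); lia.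
Qed.

Definition coord_mx n (P : pred 'I_n) : 'M[C]_n :=
  \matrix_(a, b) ((a == b) && P a)%:R.

Lemma rank_coord_mx n (P : pred 'I_n) : \rank (coord_mx P) = #|P|.
Proof.
pose E : 'M[C]_(#|P|, n) := \matrix_(i, j) (enum_val i == j)%:R.
have EE : E *m E^T = 1%:M.
  apply/matrixP=> i j; rewrite !mxE (bigD1 (enum_val i)) //= big1 => [|a ai].
    by rewrite !mxE eqxx mul1r addr0 (inj_eq enum_val_inj) eq_sym.
  by rewrite !mxE eq_sym (negPf ai) mul0r.
have EW : E^T *m E = coord_mx P.
  apply/matrixP=> a b; rewrite !mxE.
  have [Pa|Pa] := boolP (P a).
    rewrite andbT (bigD1 (enum_rank_in Pa a)) //= big1 => [|i ia].
      by rewrite !mxE enum_rankK_in // eqxx mul1r addr0.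
    rewrite !mxE; case: eqP => [e|_]; last by rewrite mul0r.
    by case/eqP: ia; apply: enum_val_inj; rewrite enum_rankK_in // -e.
  rewrite andbF big1 // => i _; rewrite !mxE; case: eqP => [e|_]; last by rewrite
    mul0r.
  by case/negP: Pa; rewrite -e; apply: (enum_valP i).
have -> : \rank (coord_mx P) = \rank E.
  apply/eqP; rewrite eqn_leq !mxrankS //.
    by rewrite -(mul1mx E) -EE -mulmxA EW submxMl.
  by rewrite -EW submxMl.
by apply/eqP; apply/row_freeP; exists E^T.
Qed.

(* Right orthogonality turns the coordinate subspace on [P] into the one on
   [{0} U {b + 1 : b not in P}]; [jperp j] is the result of [j] steps from the
   whole space. *)
Definition jperp j b := if (b < j)%N then ~~ odd b else ~~ odd j.

Lemma perps_jblock r j : (perps (jblock r 0) j :=: coord_mx (fun b : 'I_r => jperp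
  j b))%MS.
Proof.
elim: j => [|j IH] /=.
  suff -> : coord_mx (fun b : 'I_r => jperp 0 b) = 1%:M by apply: eqmx_refl.
  by apply/matrixP=> a b; rewrite !mxE /jperp /= andbT.
apply: (eqmx_trans (perp_eqmx _ IH)).
set P := fun b : 'I_r => jperp j b; set P' := fun b : 'I_r => jperp j.+1 b.
have PS (b b' : 'I_r) : b.+1 = b' -> P' b' = ~~ P b.
  by move=> e; rewrite /P /P' /jperp -e ltnS /=; case: ltnP => _; rewrite ?negbK.
have key p (V : 'M[C]_(p, r)) i b :
    (V *m (jblock r 0)^T *m (coord_mx P)^H) i b =
    (jblock r 0 *m V^T) b i *+ P b.
  rewrite -[V *m _]trmxK trmx_mul trmxK mxE (bigD1 b) //= big1 => [|a ab].
    by rewrite adjE !mxE eqxx conjC_nat /= mulr_natr addr0.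
  by rewrite adjE !mxE eq_sym (negPf ab) conjC0 mulr0.
have sub p (V : 'M[C]_(p, r)) : (V <= perp (jblock r 0) (coord_mx P))%MS =
    [forall i, forall b, (V i b != 0) ==> P' b].
  rewrite perpP; apply/eqP/forallP => [h i|h].
    apply/forallP=> -[[|b] hb]; first by rewrite /P' /jperp implybT.
    apply/implyP; apply: contraNT => nP.
    have hb' : (b < r)%N by apply: ltnW.
    have := congr1 (fun M : 'M_(p, r) => M i (Ordinal hb')) h.
    rewrite key (@mul_nil_lt _ _ _ _ (Ordinal hb') _ hb) !mxE => /eqP.
    move: nP; rewrite (PS (Ordinal hb') (Ordinal hb)) // negbK => ->.
    by rewrite mulr1n.
  apply/matrixP=> i b; rewrite key [RHS]mxE.
  have [hb|hb] := ltnP b.+1 r; last by rewrite mul_nil_last // mul0rn.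
  rewrite (mul_nil_lt _ _ hb) mxE.
  have := forallP (h i) (Ordinal hb); rewrite (PS b (Ordinal hb)) //.
  by case: (P b) => //=; rewrite implybF negbK => /eqP->; rewrite mul0rn.
apply/eqmxP/andP; split; last first.
  rewrite sub; apply/forallP=> i; apply/forallP=> b; rewrite mxE.
  have [->|_] := eqVneq i b; rewrite /= ?eqxx //.
  by case: (P' b); rewrite ?implybT ?eqxx.
have := submx_refl (perp (jblock r 0) (coord_mx P)); rewrite sub => h.
move: (perp _ _) h => V h; apply/submxP; exists V.
apply/matrixP=> i b; rewrite mxE (bigD1 b) //= big1 => [|a ab].
  rewrite mxE eqxx addr0 /=; have := forallP (forallP h i) b.
  case: (P' b); first by rewrite mulr1.
  by rewrite implybF negbK => /eqP->; rewrite mul0r.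
by rewrite mxE (negPf ab) mulr0.
Qed.

(** The iterates are not monotone: those of even index decrease and those of odd index increase. The
    index sets after [j] and [j + 2] steps differ exactly in the coordinate [j + 1], which exists
    when [j + 2 <= r]. *)
Lemma rank_perps_jblock r j :
  if odd j then \rank (perps (jblock r (0 : C)) j.+2) =
     (\rank (perps (jblock r (0 : C)) j) + (j.+2 <= r))%N
  else \rank (perps (jblock r (0 : C)) j) =
     (\rank (perps (jblock r (0 : C)) j.+2) + (j.+2 <= r))%N.
Proof.
rewrite !perps_jblock !rank_coord_mx -!sum1_card.
have [h|h] := leqP j.+2 r; last first.
  have e : (\sum_(i in (fun b : 'I_r => jperp j b)) 1 =
            \sum_(i in (fun b : 'I_r => jperp j.+2 b)) 1)%N.
    apply: eq_bigl => -[i hi]; rewrite !unfold_in /=; rewrite /jperp /= negbK.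
    have [h1|h1] := ltnP i j; first by rewrite ifT //; lia.
    have e : i = j by lia.
    by rewrite e ltnS leqnSn.
  by case: odd; rewrite addn0 e.
pose o := Ordinal h.
have aux (P P' : pred 'I_r) : (forall i, P' i = (i == o) || P i) -> ~~ P o ->
    (\sum_(i in P') 1 = \sum_(i in P) 1 + 1)%N.
  move=> hP Po; rewrite (bigD1 o) /=; last by rewrite unfold_in hP eqxx.
  rewrite addnC; congr (_ + _)%N; apply: eq_bigl => i.
  rewrite !unfold_in hP; have [->|] := eqVneq i o; last by rewrite andbT.
  by rewrite andbF (negPf Po).
have cases (i : 'I_r) : [\/ (i < j)%N, i = j :> nat, i = j.+1 :> nat | (j.+1 < i)%N].
  have [h1|h1|h1] := ltngtP i j; [exact: Or41| |exact: Or42].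
  by have [h2|h2|h2] := ltngtP i j.+1; [lia|exact: Or44|exact: Or43].
case: ifP => oj; apply: aux.
- move=> i; rewrite /jperp /= negbK -val_eqE /=; case: (cases i) => e.
  + have [-> -> ->] : [/\ (i < j.+2)%N, (i == j.+1 :> nat) = false & (i < j)%N] by
    split; lia.
    by [].
  + by rewrite e ltnS leqnSn ltnn oj /= orbF ltn_eqF.
  + by rewrite e ltnSn eqxx /= oj.
  + have [-> -> ->] : [/\ (i < j.+2)%N = false, (i == j.+1 :> nat) = false
      & (i < j)%N = false] by split; lia.
    by [].
- by rewrite /jperp /= ltnNge leqnSn /= oj.
- move=> i; rewrite /jperp /= negbK -val_eqE /=; case: (cases i) => e.
  + have [-> -> ->] : [/\ (i < j.+2)%N, (i == j.+1 :> nat) = false & (i < j)%N] by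
    split; lia.
    by [].
  + by rewrite e ltnS leqnSn ltnn oj orbT.
  + by rewrite e ltnSn eqxx ltnNge leqnSn /= oj.
  + have [-> -> ->] : [/\ (i < j.+2)%N = false, (i == j.+1 :> nat) = false
      & (i < j)%N = false] by split; lia.
    by [].
- by rewrite /jperp /= ltnS leqnn /= oj.
Qed.
End Perps.

(** * Multiplicities of J_r(0) from the ranks of iterated orthogonals *)

Section JordanCount.
Variable C : numClosedFieldType.
Implicit Types (m n p q k u j : nat).

Lemma adj_revmx k : (revmx C k)^H = revmx C k.
Proof. by apply/matrixP=> a b; rewrite adjE !mxE conjC_nat addnC. Qed.

Lemma mul_revmx k p (X : 'M[C]_(k, p)) (i : 'I_k) (j : 'I_p) :
  (revmx C k *m X) i j = X (rev_ord i) j.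
Proof.
rewrite mxE (bigD1 (rev_ord i)) //= big1 => [|a ai].
  by rewrite !mxE /= (_ : _ == _) ?mul1r ?addr0 //; have := ltn_ord i; lia.
rewrite mxE; case: eqP => [e|_]; last by rewrite mul0r.
by case/eqP: ai; apply: val_inj => /=; lia.
Qed.

Lemma revmxK k : revmx C k *m revmx C k = 1%:M.
Proof.
apply/matrixP=> i j; rewrite mul_revmx !mxE -val_eqE /=; congr (_%:R).
by apply/eqP/eqP; have := ltn_ord i; have := ltn_ord j; lia.
Qed.

Lemma dblock_factor k : dblock C k = revmx C k *m (1%:M + 'i *: jblock k 0).
Proof. by rewrite dblockE mulmxDr mulmx1 -scalemxAr. Qed.

Lemma mul_revmx_nil k (i j : 'I_k) :
  (revmx C k *m jblock k 0) i j = (i + j == k)%N%:R.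
Proof.
rewrite mul_revmx -[jblock k 0]expr1 nilX /=; congr (_%:R).
by apply/eqP/eqP; have := ltn_ord i; have := ltn_ord j; lia.
Qed.

Lemma adj_dblock k : (dblock C k)^H = revmx C k *m (1%:M - 'i *: jblock k 0).
Proof.
have h : (revmx C k *m jblock k 0)^H = revmx C k *m jblock k 0.
  by apply/matrixP=> i j; rewrite adjE !mul_revmx_nil conjC_nat addnC.
by rewrite dblockE adjD adjZ h adj_revmx conjCi scaleNr mulmxBr mulmx1 -scalemxAr.
Qed.

Lemma unitmx_bmx (t : btype C) : bvalid t -> bregular t -> bmx t \in unitmx.
Proof.
case: t => [[[k l]|[k v]]|r] //= /andP[_ h] _.
  have lu : jblock k l \in unitmx.
    by apply: unitmx_jblock; rewrite -normr_gt0 (lt_trans ltr01).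
  have : hblock k l *m block_mx 0 (invmx (jblock k l)) 1%:M 0 = 1%:M.
    by rewrite mulmx_block !(mulmx0, mul0mx, addr0, add0r, mulmx1) mulmxV //
      -scalar_mx_block.
  by case/mulmx1_unit.
have v0 : v != 0 by rewrite -normr_eq0 (eqP h) oner_eq0.
rewrite unitmxZ ?unitfE // dblock_factor unitmx_mul.
have [-> _] := mulmx1_unit (revmxK k).
apply: (unitmx_nilp (k := k)); last exact: oner_neq0.
by rewrite expmxZ nil_nilp scaler0.
Qed.

Definition jge j (t : btype C) : bool := if t is BJ r then (j <= r)%N else false.

Definition jcount j (ts : seq (btype C)) : nat := count (jge j) ts.

(** For an invertible form the iterates alternate between the whole space and zero, so regular
    blocks drop out of the two-step differences. *)
Lemma rank_perps_unit n (A : 'M[C]_n) j : A \in unitmx ->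
  \rank (perps A 1) = 0%N /\ \rank (perps A j.+2) = \rank (perps A j).
Proof.
move=> Au; rewrite /= !rank_perp // mxrank1 subnn; split=> //.
by rewrite subKn // rank_leq_row.
Qed.

Lemma rank_perps1 (ts : seq (btype C)) : all (@bvalid C) ts ->
  \rank (perps (bsum ts) 1) = jcount 1 ts.
Proof.
elim: ts => [|t ts IH]; first by move=> _; rewrite /= -[RHS](@mxrank0 C 0 0) [perp
  _ _]flatmx0.
case/andP=> vt vts; rewrite [bsum _]/= rank_perps_dsum {}IH //; congr (_ + _)%N.
case: t vt => [t|r] vt; first by case: (rank_perps_unit 0 (unitmx_bmx vt isT)).
rewrite [bmx _]/= perps_jblock rank_coord_mx; case: r vt => // r _.
rewrite (eq_card (B := pred1 ord0)) ?card1 // => i.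
by rewrite !inE unfold_in /jperp -val_eqE /=; case: (val i).
Qed.

Lemma rank_perps_step (ts : seq (btype C)) j : all (@bvalid C) ts ->
  if odd j then \rank (perps (bsum ts) j.+2) = (\rank (perps (bsum ts) j) + jcount
    j.+2 ts)%N
  else \rank (perps (bsum ts) j) = (\rank (perps (bsum ts) j.+2) + jcount j.+2 ts)%N.
Proof.
elim: ts => [|t ts IH].
  have z i : \rank (perps (0 : 'M[C]_0) i) = 0%N.
    by apply/eqP; rewrite -leqn0 rank_leq_row.
  by rewrite !z; case: odd.
case/andP=> vt /IH {}IH; rewrite [bsum _]/= !rank_perps_dsum.
suff : if odd j then \rank (perps (bmx t) j.+2) =
     (\rank (perps (bmx t) j) + jge j.+2 t)%N
  else \rank (perps (bmx t) j) =
     (\rank (perps (bmx t) j.+2) + jge j.+2 t)%N.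
  by move: IH; rewrite /jcount /=; case: odd => -> ->; rewrite addnACA.
case: t vt => [t|r] vt; last exact: rank_perps_jblock.
have [_ ->] := rank_perps_unit j (unitmx_bmx vt isT).
by rewrite addn0; case: odd.
Qed.

Lemma jcount_congruent (ts ts' : seq (btype C)) j :
  all (@bvalid C) ts -> all (@bvalid C) ts' -> congruent (bsum ts) (bsum ts') ->
  jcount j.+1 ts = jcount j.+1 ts'.
Proof.
move=> vts vts' cA; have e i := rank_perps_congruent i cA.
case: j => [|j]; first by rewrite -!rank_perps1.
have := rank_perps_step j vts; have := rank_perps_step j vts'.
by rewrite !e; case: odd => -> /addnI.
Qed.

Lemma count_BJ (ts : seq (btype C)) r : (0 < r)%N ->
  (count_mem (BJ r : btype C) ts + jcount r.+1 ts = jcount r ts)%N.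
Proof.
move=> r0; elim: ts => //= t ts IH; rewrite -IH addnACA; congr (_ + _)%N.
case: t => [t|r'] //=; rewrite (inj_eq (inr_inj)).
by case: ltngtP.
Qed.

Lemma count_BJ_congruent (ts ts' : seq (btype C)) r :
  all (@bvalid C) ts -> all (@bvalid C) ts' -> congruent (bsum ts) (bsum ts') ->
  count_mem (BJ r : btype C) ts = count_mem (BJ r : btype C) ts'.
Proof.
move=> vts vts' cA; case: r => [|r].
  have z us : all (@bvalid C) us -> count_mem (BJ 0 : btype C) us = 0%N.
    move=> vus; apply/eqP; rewrite -leqn0 leqNgt -has_count has_pred1.
    by apply/negP=> /(allP vus).
  by rewrite !z.
have h1 := count_BJ ts (ltn0Sn r); have h2 := count_BJ ts' (ltn0Sn r).
apply/eqP; rewrite -(eqn_add2r (jcount r.+2 ts)) h1.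
by rewrite !(jcount_congruent _ vts vts' cA) h2.
Qed.
End JordanCount.

(** * Uniqueness of the blocks H_{2k}(l) *)

Section HCount.
Variable C : numClosedFieldType.
Implicit Types (m n p q : nat).
Local Notation N n := (jblock n (0 : C)).

Lemma kernel_vector m n (M : 'M[C]_(m, n)) :
  (m < n)%N -> exists2 v : 'cV[C]_n, v != 0 & M *m v = 0.
Proof.
move=> mn; have : kermx M^T != 0.
  rewrite kermx_eq0 /row_free mxrank_tr; apply/negP => /eqP e.
  by have := rank_leq_row M; rewrite e; lia.
case/rowV0Pn=> v /sub_kermxP h v0; exists v^T.
  by apply: contra_neq v0 => e; rewrite -[v]trmxK e trmx0.
by apply: trmx_inj; rewrite trmx_mul trmxK h trmx0.
Qed.

Lemma sqnorm_eq0 n (v : 'cV[C]_n) : (v^H *m v) 0 0 = 0 -> v = 0.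
Proof.
rewrite mxE => h; apply/matrixP=> i j; rewrite ord1 [RHS]mxE.
have /psumr_eq0P : forall k, true -> 0 <= v^H 0 k * v k 0.
  by move=> k _; rewrite adjE mulrC -normCK exprn_ge0.
move=> /(_ h i isT) /eqP; rewrite adjE mulf_eq0 conjC_eq0 orbb.
by move/eqP.
Qed.

(* In a Jordan block, chains at an invertible parameter live on every other
   coordinate, because row 1 of [N X] must vanish and the relation has step 2. *)
Lemma jblock_odd_rows r k (X : 'M[C]_(r, k)) (M : 'M[C]_k) (b : 'I_r) (j : 'I_k) :
  N r *m X = (N r)^H *m X *m M -> odd b -> X b j = 0.
Proof.
move=> h; suff H : forall e (b : 'I_r), (b <= e)%N -> odd b -> forall j : 'I_k, X b
  j = 0.
  by move=> ob; apply: (H b).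
have Hh (c : 'I_r) i : ((N r)^H *m X) c i =
    if insub c.-1 is Some c' then if (c : nat) == 0%N then 0 else X c' i else 0.
  rewrite insubT; first by have := ltn_ord c; lia.
  move=> hc; case: eqP => [c0|c0].
    rewrite mxE big1 // => a _; rewrite adjE !mxE c0.
    by rewrite (_ : (a.+1 == 0%N) = false) // ?if_same conjC0 mul0r.
  rewrite mxE (bigD1 (Ordinal hc)) //= big1 => [|a ac].
    rewrite adjE !mxE /= prednK ?lt0n ?eqxx; last by apply/eqP.
    by rewrite (_ : (_ == _) = false) ?conjC1 ?mul1r ?addr0 //; apply/eqP; lia.
  rewrite adjE !mxE; case: eqP => e1; first by rewrite conjC0 mul0r.
  case: eqP => e2; last by rewrite conjC0 mul0r.
  by case/eqP: ac; apply: val_inj => /=; lia.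
elim=> [|e IH] {}b hb ob i; first by move: hb ob; rewrite leqn0 => /eqP->.
case: b hb ob => -[|b] hbr //= hb ob.
have hb' : (b < r)%N by apply: ltnW.
have := congr1 (fun Y : 'M_(r, k) => Y (Ordinal hb') i) h.
rewrite (@mul_nil_lt _ _ _ _ (Ordinal hb') _ hbr) => ->.
rewrite mxE big1 // => a _; rewrite Hh /=.
case: b hb ob hbr hb' => [|b] hb ob hbr hb'; first by case: insubP => *; rewrite
  mul0r.
rewrite /=; case: insubP => [c _ ec|]; last by rewrite mul0r.
rewrite (IH c) ?mul0r // ec; first by lia.
by move: ob; rewrite /= negbK.
Qed.

Lemma mul_nilX_r n p (X : 'M[C]_(p, n)) e i (j j' : 'I_n) :
  (j' + e = j)%N -> (X *m N n ^+ e) i j = X i j'.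
Proof.
move=> h; rewrite mxE (bigD1 j') //= big1 => [|a aN].
  by rewrite nilX h eqxx mulr1 addr0.
rewrite nilX; case: eqP => [e'|_]; last by rewrite mulr0.
by case/eqP: aN; apply: val_inj => /=; lia.
Qed.

Lemma mul_nilX_l n p (X : 'M[C]_(n, p)) e (i i' : 'I_n) j :
  (i + e = i')%N -> (N n ^+ e *m X) i j = X i' j.
Proof.
move=> h; rewrite mxE (bigD1 i') //= big1 => [|a aN].
  by rewrite nilX h eqxx mul1r addr0.
rewrite nilX; case: eqP => [e'|_]; last by rewrite mul0r.
by case/eqP: aN; apply: val_inj => /=; lia.
Qed.

Lemma intertwine_pow m n (X : 'M[C]_(m, n)) e : N m *m X = X *m N n ->
  N m ^+ e *m X = X *m N n ^+ e.
Proof.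
move=> h; elim: e => [|e IH]; first by rewrite !expr0 mul1mx mulmx1.
by rewrite !exprS -!mulmxE -mulmxA IH mulmxA h -!mulmxA.
Qed.

Lemma intertwine_first_col m k (X : 'M[C]_(m.+1, k.+1)) a :
  N m.+1 *m X = X *m N k.+1 -> a != 0 -> X a 0 = 0.
Proof.
case: a => -[|a] // ha h _.
have ha' : (a < m.+1)%N by apply: ltnW.
have := congr1 (fun Y : 'M_(m.+1, k.+1) => Y (Ordinal ha') 0) h.
by rewrite (@mul_nil_lt _ _ _ _ (Ordinal ha') _ ha) mul_nilr_0.
Qed.

(** [X N^(m+1) = N^(m+1) X = 0], and column [m + 1] of the left side is the first column of [X]. *)
Lemma intertwine_lt m k (X : 'M[C]_(m.+1, k.+1)) :
  N m.+1 *m X = X *m N k.+1 -> (m < k)%N -> X 0 0 = 0.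
Proof.
move=> h mk; have hm : (m.+1 < k.+1)%N by [].
have := congr1 (fun Y : 'M_(m.+1, k.+1) => Y 0 (Ordinal hm)) (intertwine_pow m.+1 h).
by rewrite nil_nilp mul0mx mxE (@mul_nilX_r _ _ _ _ _ _ 0).
Qed.

Variables (k : nat) (l : C).
Hypothesis l1 : 1 < `|l|.
Local Notation J := (jblock k.+1 l).

(* With [P = Y^* A^* X] the two equations give [Y^* A X = J P = P J], so [P] is
   upper triangular Toeplitz; [hvalue] is its diagonal entry, and it vanishes on
   every canonical block other than H_{2k}(l). *)
Definition hchain n (A : 'M[C]_n) (X Y : 'M[C]_(n, k.+1)) :=
  A *m X = A^H *m X *m J /\ A^H *m Y = A *m Y *m J^H.

Definition hvalue n (A : 'M[C]_n) (X Y : 'M[C]_(n, k.+1)) := ((A *m Y)^H *m X) 0 0.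

Lemma hchain_dsum m n (A : 'M[C]_m) (B : 'M[C]_n) X1 X2 Y1 Y2 :
  hchain (dsum A B) (col_mx X1 X2) (col_mx Y1 Y2) <-> hchain A X1 Y1 /\ hchain B X2
    Y2.
Proof.
rewrite /hchain /dsum adj_block !adj0 !mul_block_col !mul0mx !addr0 !add0r
  !mul_col_mx.
split=> [[/eq_col_mx[-> ->] /eq_col_mx[-> ->]]|[[-> ->] [-> ->]]] //.
Qed.

Lemma hvalue_dsum m n (A : 'M[C]_m) (B : 'M[C]_n) X1 X2 Y1 Y2 :
  hvalue (dsum A B) (col_mx X1 X2) (col_mx Y1 Y2) = hvalue A X1 Y1 + hvalue B X2 Y2.
Proof.
rewrite /hvalue /dsum mul_block_col !mul0mx !addr0 !add0r adj_col mul_row_col.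
by rewrite mxE.
Qed.

(** The lower half of [X] vanishes because [|l mu| > 1], the upper half unless [mu = l]. In that
    case the surviving halves of [X] and [Y^H] intertwine nilpotent blocks, so only their corner
    entries contribute, and one of these is zero unless the sizes agree. [K] has one row or none
    according to whether the block is the counted one, so that conditions of several blocks can be
    stacked. *)
Lemma hvalue_hblock m mu : 1 < `|mu| ->
  exists K : 'M[C]_(((m.+1, mu) == (k.+1, l))%N, m.+1 + m.+1), forall X Y,
    hchain (hblock m.+1 mu) X Y -> K *m col 0 X = 0 -> hvalue (hblock m.+1 mu) X Y
      = 0.
Proof.
move=> mu1.
suff H : forall X Y, hchain (hblock m.+1 mu) X Y ->
    ((m.+1, mu) = (k.+1, l) -> usubmx X 0 0 = 0) -> hvalue (hblock m.+1 mu) X Y = 0.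
  have [e|ne] := eqVneq (m.+1, mu) (k.+1, l); last first.
    by exists 0 => X Y /H{}H _; apply: H => e; rewrite e eqxx in ne.
  exists (delta_mx 0 0) => X Y /H{}H hK; apply: H => _.
  move/matrixP: hK => /(_ 0 0); rewrite mxE (bigD1 0) //= big1 => [|a a0].
    rewrite !mxE eqxx mul1r addr0 => <-; congr (X _ _); exact: val_inj.
  by rewrite !mxE (negPf a0) mul0r.
move=> X Y; rewrite -[X]vsubmxK -[Y]vsubmxK /hchain /hvalue col_mxKu.
move: (usubmx X) (dsubmx X) (usubmx Y) (dsubmx Y) => X1 X2 Y1 Y2.
rewrite /hblock adj_block !adj0 adj1 !mul_block_col !mul0mx !addr0 !add0r !mul1mx.
rewrite !mul_col_mx => -[/eq_col_mx[hX2 hX1] /eq_col_mx[hY2 hY1]] hK.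
have X20 : X2 = 0.
  apply: (@sylvester_nilp _ _ _ k.+1 (1%:M - l *: (jblock m.+1 mu)^H)
    (jblock m.+1 mu)^H (N k.+1)); rewrite ?nil_nilp //.
    rewrite adj_jblock scalerDr opprD addrA.
    have -> : 1%:M - l *: (mu^*)%:M = (1 - l * mu^*)%:M :> 'M[C]_m.+1.
      by rewrite scale_scalar_mx raddfB.
    rewrite -scaleNr; apply: (unitmx_nilp (k := m.+1)).
      by rewrite expmxZ adj_nil_nilp scaler0.
    rewrite subr_eq0; apply/eqP => /(congr1 (fun x => `|x|)).
    rewrite normr1 normrM norm_conjC => e.
    by have := mulr_egt1 l1 mu1; rewrite -e ltxx.
  rewrite mulmxBl mul1mx {1}hX2 (jblockE k.+1 l) mulmxDr mul_mx_scalar.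
  by rewrite -scalemxAl addrC addKr.
rewrite X20 adj_col mul_row_col mulmx0 addr0.
have [e|ne] := eqVneq mu l; last first.
  suff -> : X1 = 0 by rewrite mulmx0 mxE.
  apply: (@sylvester_nilp _ _ _ k.+1 ((mu - l)%:M + N m.+1) 1%:M (N k.+1)).
  - by apply: (unitmx_nilp (k := m.+1)); rewrite ?nil_nilp // subr_eq0.
  - exact: nil_nilp.
  - rewrite raddfB /= addrAC -jblockE mulmxBl hX1 (jblockE k.+1 l) mulmxDr mul1mx.
    by rewrite mul_scalar_mx mul_mx_scalar addrAC subrr add0r.
subst mu.
have NX : N m.+1 *m X1 = X1 *m N k.+1.
  move: hX1; rewrite (jblockE m.+1 l) (jblockE k.+1 l) mulmxDl mulmxDr.
  by rewrite mul_scalar_mx mul_mx_scalar => /addrI.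
have NY : N k.+1 *m Y2^H = Y2^H *m N m.+1.
  move: (congr1 (@adjmx C _ _) hY2); rewrite !adjM !adjK.
  rewrite (jblockE m.+1 l) (jblockE k.+1 l) mulmxDl mulmxDr.
  by rewrite mul_scalar_mx mul_mx_scalar => /addrI.
rewrite mxE (bigD1 0) //= big1 ?addr0 => [|a a0]; last first.
  by rewrite (intertwine_first_col NX a0) mulr0.
have [mk|km|e] := ltngtP m k.
- by rewrite (intertwine_lt NX mk) mulr0.
- by rewrite (intertwine_lt NY km) mul0r.
by rewrite hK ?mulr0 // e.
Qed.

Lemma dblock_mul m v p (X Y : 'M[C]_(m, p)) :
  (v *: dblock C m) *m X = (v *: dblock C m)^H *m Y ->
  v *: ((1%:M + 'i *: N m) *m X) = v^* *: ((1%:M - 'i *: N m) *m Y).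
Proof.
rewrite adjZ adj_dblock dblock_factor -!scalemxAl -!mulmxA !scalemxAr.
by move/(congr1 (mulmx (revmx C m))); rewrite !mulmxA revmxK !mul1mx.
Qed.

(** The pencil of this block has the single eigenvalue [v / conj v], of modulus one, hence no
    nonzero chain at [l]. *)
Lemma hvalue_dblock m v X Y : `|v| = 1 ->
  hchain (v *: dblock C m) X Y -> hvalue (v *: dblock C m) X Y = 0.
Proof.
move=> v1 [hX _]; suff -> : X = 0 by rewrite /hvalue mulmx0 mxE.
rewrite -mulmxA in hX; have {}hX := dblock_mul hX.
apply: (@sylvester_nilp _ _ _ k.+1
  (v *: (1%:M + 'i *: N m) - (v^* * l) *: (1%:M - 'i *: N m))
  (v^* *: (1%:M - 'i *: N m)) (N k.+1)); rewrite ?nil_nilp //.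
  have -> : v *: (1%:M + 'i *: N m) - (v^* * l) *: (1%:M - 'i *: N m)
      = (v - v^* * l)%:M + ('i * (v + v^* * l)) *: N m.
    move: (N m) => P; apply/matrixP=> a b; rewrite !mxE.
    by case: (a == b); rewrite ?mulr1n ?mulr0n; ring.
  apply: (unitmx_nilp (k := m)); first by rewrite expmxZ nil_nilp scaler0.
  rewrite subr_eq0; apply/eqP => /(congr1 (fun x => `|x|)).
  by rewrite normrM norm_conjC v1 mul1r => e; move: l1; rewrite -e ltxx.
rewrite mulmxBl -!scalemxAl hX (jblockE k.+1 l) mulmxDr mul_mx_scalar.
rewrite mulmxDr -scalemxAr scalerDr !scalerA mulmxA.
by rewrite addrC addKr.
Qed.

Lemma hvalue_jblock r X Y : hchain (N r) X Y -> hvalue (N r) X Y = 0.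
Proof.
case=> hX hY; have Ju : J^H \in unitmx.
  by rewrite unitmx_adj unitmx_jblock // -normr_gt0 (lt_trans ltr01).
(* Inverting the parameter gives the second chain equation the shape of the first, so the odd rows
   of [Y] vanish too. In each product [conj Y_(b+1) X_b] one of the two indices is odd. *)
have {}hY : N r *m Y = (N r)^H *m Y *m invmx J^H by rewrite hY mulmxK.
rewrite /hvalue mxE big1 // => b _; rewrite adjE.
have [ob|eb] := boolP (odd b).
  by rewrite (jblock_odd_rows _ hX ob) mulr0.
have [hb|hb] := ltnP b.+1 r; last by rewrite mul_nil_last // conjC0 mul0r.
by rewrite (mul_nil_lt _ _ hb) (jblock_odd_rows _ hY) ?conjC0 ?mul0r.
Qed.

Local Notation T := (BH k.+1 l : btype C).

Lemma hvalue_upper (ts : seq (btype C)) : all (@bvalid C) ts ->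
  exists K : 'M[C]_(count_mem T ts, bsdim ts), forall X Y,
    hchain (bsum ts) X Y -> K *m col 0 X = 0 -> hvalue (bsum ts) X Y = 0.
Proof.
elim: ts => [|t ts IH].
  by move=> _; exists 0 => X Y _ _; rewrite /hvalue mxE big_ord0.
case/andP=> vt /IH[K hK].
have [Kt hKt] : exists Kt : 'M[C]_((t == T)%N, bdim t), forall X Y,
    hchain (bmx t) X Y -> Kt *m col 0 X = 0 -> hvalue (bmx t) X Y = 0.
  case: t vt => [[[m mu]|[m v]]|r] /=.
  - by case: m => // m /andP[_ mu1]; apply: hvalue_hblock.
  - by case/andP=> _ /eqP v1; exists 0 => X Y h _; apply: hvalue_dblock.
  - by move=> _; exists 0 => X Y h _; apply: hvalue_jblock.
exists (block_mx Kt 0 0 K) => X Y.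
rewrite -[X](@vsubmxK _ (bdim t) (bsdim ts)); move: (usubmx X) (dsubmx X) => X1 X2.
rewrite -[Y](@vsubmxK _ (bdim t) (bsdim ts)); move: (usubmx Y) (dsubmx Y) => Y1 Y2.
case/hchain_dsum=> h1 h2 hc; rewrite [LHS]hvalue_dsum.
have ec : col 0 (col_mx X1 X2) = col_mx (col 0 X1) (col 0 X2) by rewrite col_col_mx.
have {}hc : block_mx Kt 0 0 K *m col_mx (col 0 X1) (col 0 X2) = 0.
  by rewrite -ec; exact: hc.
have : col_mx (Kt *m col 0 X1) (K *m col 0 X2) = col_mx 0 0.
  by rewrite col_mx0 -[RHS]hc mul_block_col !mul0mx addr0 add0r.
by case/eq_col_mx=> e1 e2; rewrite (hKt _ _ h1 e1) (hK _ _ h2 e2) addr0.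
Qed.

(** [L] records only the first columns, which is all that the conditions of [hvalue_upper] see; it
    makes them linear in the parameter. *)
Lemma hvalue_lower (ts : seq (btype C)) :
  exists (X Y : 'cV[C]_(count_mem T ts) -> 'M[C]_(bsdim ts, k.+1))
      (L : 'M[C]_(bsdim ts, count_mem T ts)),
    forall u, [/\ hchain (bsum ts) (X u) (Y u), col 0 (X u) = L *m u
      & hvalue (bsum ts) (X u) (Y u) = (u^H *m u) 0 0].
Proof.
have z n (A : 'M[C]_n) : exists (X Y : 'cV[C]_0 -> 'M[C]_(n, k.+1))
      (L : 'M[C]_(n, 0)), forall u,
    [/\ hchain A (X u) (Y u), col 0 (X u) = L *m u
      & hvalue A (X u) (Y u) = (u^H *m u) 0 0].
  exists (fun=> 0), (fun=> 0), 0 => u; split.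
  - by split; rewrite !(mulmx0, mul0mx).
  - by rewrite mul0mx col0.
  - by rewrite /hvalue mulmx0 !mxE big_ord0.
elim: ts => [|t ts [X2 [Y2 [L2 h2]]]]; first exact: z.
have [X1 [Y1 [L1 h1]]] : exists (X Y : 'cV[C]_(t == T) -> 'M[C]_(bdim t, k.+1))
      (L : 'M[C]_(bdim t, (t == T))), forall u,
    [/\ hchain (bmx t) (X u) (Y u), col 0 (X u) = L *m u
      & hvalue (bmx t) (X u) (Y u) = (u^H *m u) 0 0].
  have [->|_] := eqVneq t T; last exact: z.
  pose E1 : 'M[C]_(k.+1 + k.+1, k.+1) := col_mx 1%:M 0.
  pose E2 : 'M[C]_(k.+1 + k.+1, k.+1) := col_mx 0 1%:M.
  have e1 : hblock k.+1 l *m E1 = col_mx 0 J.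
    by rewrite mul_block_col !(mulmx0, mul0mx, mulmx1, addr0, add0r).
  have e2 : (hblock k.+1 l)^H *m E1 = E2.
    by rewrite adj_block adj1 !adj0 mul_block_col !(mulmx0, mul0mx, mulmx1, addr0,
      add0r).
  have e3 : hblock k.+1 l *m E2 = E1.
    by rewrite mul_block_col !(mulmx0, mul0mx, mulmx1, addr0, add0r).
  have e4 : (hblock k.+1 l)^H *m E2 = col_mx J^H 0.
    by rewrite adj_block adj1 !adj0 mul_block_col !(mulmx0, mul0mx, mulmx1, addr0,
      add0r).
  exists (fun u => u 0 0 *: E1), (fun u => u 0 0 *: E2), (col_mx (delta_mx 0 0) 0).
  move=> u; split.
  - split; rewrite -!scalemxAr -scalemxAl; congr (_ *: _).
      by rewrite e1 e2 mul_col_mx mul0mx mul1mx.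
    by rewrite e3 e4 mul_col_mx mul0mx mul1mx.
  - rewrite /E1; apply/matrixP=> a b; rewrite !mxE big_ord1 !mxE mulrC.
    by rewrite (ord1 b); case: splitP => c _; rewrite !mxE ?eqxx ?andbT.
  - rewrite /hvalue -!scalemxAr e3 adjZ -scalemxAl adj_col mul_row_col.
    rewrite adj1 adj0 mul0mx mulmx1 addr0 !mxE big_ord1 !mxE eqxx mulr1.
    by rewrite mulrC.
pose c1 := nat_of_bool (t == T); pose c2 := count_mem T ts.
exists (fun u : 'cV_(c1 + c2) => col_mx (X1 (usubmx u)) (X2 (dsubmx u))),
  (fun u : 'cV_(c1 + c2) => col_mx (Y1 (usubmx u)) (Y2 (dsubmx u))),
  (block_mx L1 0 0 L2 : 'M_(bdim t + bsdim ts, c1 + c2)) => u.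
have [a1 a2 a3] := h1 (usubmx u); have [b1 b2 b3] := h2 (dsubmx u).
split; first exact/hchain_dsum.
  by rewrite col_col_mx a2 b2 -{3}[u](@vsubmxK _ c1 c2) mul_block_col !mul0mx addr0
    add0r.
rewrite [LHS]hvalue_dsum a3 b3 -{5 6}[u](@vsubmxK _ c1 c2) adj_col mul_row_col.
by rewrite [RHS]mxE.
Qed.

Lemma count_BH_le (ts ts' : seq (btype C)) : all (@bvalid C) ts' ->
  congruent (bsum ts) (bsum ts') -> (count_mem T ts <= count_mem T ts')%N.
Proof.
move=> vts' [S [R [SR RS eA]]].
have [K hK] := hvalue_upper vts'; have [X [Y [L hL]]] := hvalue_lower ts.
rewrite leqNgt; apply/negP => /(kernel_vector (K *m R *m L))[u u0 hu].
have [[hX hY] hc hv] := hL u.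
have eA' : (bsum ts')^H = S^H *m (bsum ts)^H *m S by rewrite eA adj_form.
have key (A B : 'M[C]_(bsdim ts)) (Z Z' : 'M[C]_(bsdim ts, k.+1)) M :
    A *m Z = B *m Z' *m M ->
    (S^H *m A *m S) *m (R *m Z) = (S^H *m B *m S) *m (R *m Z') *m M.
  move=> h; rewrite -!mulmxA (mulmxA S) SR mul1mx (mulmxA S) SR mul1mx.
  by rewrite h !mulmxA.
have : hvalue (bsum ts') (R *m X u) (R *m Y u) = 0.
  apply: hK; first by split; rewrite eA' eA; apply: key.
  by rewrite colE -mulmxA -colE hc !mulmxA.
rewrite /hvalue eA -(mulmxA _ S) (mulmxA S) SR mul1mx -mulmxA adjM adjK.
rewrite -mulmxA (mulmxA S) SR mul1mx => /eqP; rewrite -/(hvalue _ _ _) hv.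
by move/eqP/sqnorm_eq0 => e; rewrite e eqxx in u0.
Qed.
End HCount.

Lemma count_BH_congruent (C : numClosedFieldType) (ts ts' : seq (btype C)) k l :
  all (@bvalid C) ts -> all (@bvalid C) ts' -> congruent (bsum ts) (bsum ts') ->
  count_mem (BH k l : btype C) ts = count_mem (BH k l : btype C) ts'.
Proof.
move=> vts vts' cA.
have [v|nv] := boolP (bvalid (BH k l : btype C)); last first.
  have z us : all (@bvalid C) us -> count_mem (BH k l : btype C) us = 0%N.
    move=> vus; apply/eqP; rewrite -leqn0 leqNgt -has_count has_pred1.
    by apply: contra nv => /(allP vus).
  by rewrite !z.
case: k v => // k /andP[_ l1]; apply/eqP; rewrite eqn_leq !count_BH_le //.
exact: congruent_sym.
Qed.

(** * Uniqueness of the blocks u Delta_k *)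

Section DCount.
Variable C : numClosedFieldType.
Implicit Types (m n p q : nat).
Local Notation N n := (jblock n (0 : C)).
Variables (k : nat) (u : C).
Hypothesis u1 : `|u| = 1.

(* [dpos] and [dneg] are, up to the factors [2] and [2 i], the Hermitian and
   skew-Hermitian parts of [u^* A]. *)
Definition dpos n (A : 'M[C]_n) := u^* *: A + u *: A^H.
Definition dneg n (A : 'M[C]_n) := u^* *: A - u *: A^H.

(* Chains of the Hermitian pencil at its eigenvalue [0]. The form [dvalue] pairs
   the first vector of the chain with the last one; it is [2 |a|^2] on u Delta_k,
   [- 2 |a|^2] on - u Delta_k and [0] on the other blocks, where [a] is the leading
   coefficient of the first vector. *)
Definition dchain n (A : 'M[C]_n) (X : 'M[C]_(n, k.+1)) :=
  dneg A *m X = 'i *: (dpos A *m X *m N k.+1).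

Definition dvalue n (A : 'M[C]_n) (X : 'M[C]_(n, k.+1)) :=
  (X^H *m dpos A *m X) 0 ord_max.

Lemma dpos_dsum m n (A : 'M[C]_m) (B : 'M[C]_n) :
  dpos (dsum A B) = dsum (dpos A) (dpos B).
Proof.
by rewrite /dpos /dsum adj_block !adj0 !scale_block_mx add_block_mx !scaler0 !addr0.
Qed.

Lemma dneg_dsum m n (A : 'M[C]_m) (B : 'M[C]_n) :
  dneg (dsum A B) = dsum (dneg A) (dneg B).
Proof.
rewrite /dneg /dsum adj_block !adj0 !scale_block_mx opp_block_mx add_block_mx.
by rewrite !scaler0 !oppr0 !addr0.
Qed.

Lemma dchain_dsum m n (A : 'M[C]_m) (B : 'M[C]_n) X1 X2 :
  dchain (dsum A B) (col_mx X1 X2) <-> dchain A X1 /\ dchain B X2.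
Proof.
rewrite /dchain dpos_dsum dneg_dsum /dsum !mul_block_col !mul0mx !addr0 !add0r.
rewrite mul_col_mx scale_col_mx.
by split=> [/eq_col_mx[-> ->]|[-> ->]].
Qed.

Lemma dvalue_dsum m n (A : 'M[C]_m) (B : 'M[C]_n) X1 X2 :
  dvalue (dsum A B) (col_mx X1 X2) = dvalue A X1 + dvalue B X2.
Proof.
rewrite /dvalue dpos_dsum -mulmxA mul_block_col !mul0mx !addr0 !add0r adj_col.
by rewrite mul_row_col mxE !mulmxA.
Qed.

Lemma dpos_dblock m v :
  dpos (v *: dblock C m) = revmx C m *m
    ((u^* * v + u * v^*)%:M + ('i * (u^* * v - u * v^*)) *: N m).
Proof.
rewrite /dpos adjZ adj_dblock dblock_factor !scalerA !scalemxAr -mulmxDr.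
congr (_ *m _); move: (N m) => P; apply/matrixP=> a b; rewrite !mxE.
by case: (a == b); rewrite ?mulr1n ?mulr0n; ring.
Qed.

Lemma dneg_dblock m v :
  dneg (v *: dblock C m) = revmx C m *m
    ((u^* * v - u * v^*)%:M + ('i * (u^* * v + u * v^*)) *: N m).
Proof.
rewrite /dneg adjZ adj_dblock dblock_factor !scalerA !scalemxAr -mulmxBr.
congr (_ *m _); move: (N m) => P; apply/matrixP=> a b; rewrite !mxE.
by case: (a == b); rewrite ?mulr1n ?mulr0n; ring.
Qed.

(** Let [w = conj u v]. If [w] is not real, the pencil is invertible at [0] and [X = 0]. Otherwise
    [w] is [1] or [-1], [X] intertwines nilpotent blocks, and the value is [2 w] times the conjugate
    of the first diagonal entry times the last entry. For different sizes one of these entries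
    vanishes; for equal sizes they agree, and the value is [2 w |X 0 0|^2]. *)
Lemma dvalue_dblock m v : `|v| = 1 ->
  exists K : 'M[C]_(((m.+1, v) == (k.+1, u))%N, m.+1), forall X,
    dchain (v *: dblock C m.+1) X -> K *m col 0 X = 0 ->
    dvalue (v *: dblock C m.+1) X <= 0.
Proof.
move=> v1.
suff H : forall X, dchain (v *: dblock C m.+1) X ->
    ((m.+1, v) = (k.+1, u) -> X 0 0 = 0) -> dvalue (v *: dblock C m.+1) X <= 0.
  have [e|ne] := eqVneq (m.+1, v) (k.+1, u); last first.
    by exists 0 => X /H{}H _; apply: H => e; rewrite e eqxx in ne.
  exists (delta_mx 0 0) => X /H{}H hK; apply: H => _.
  move/matrixP: hK => /(_ 0 0); rewrite mxE (bigD1 0) //= big1 => [|a a0].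
    by rewrite !mxE eqxx mul1r addr0 => <-.
  by rewrite !mxE (negPf a0) mul0r.
move=> X hX hK; pose w := u^* * v.
have ww : u * v^* = w^* by rewrite /w rmorphM /= conjCK.
have w1 : `|w| = 1 by rewrite normrM norm_conjC u1 v1 mulr1.
have vuw : v = u * w by rewrite /w mulrA -normCK u1 expr1n mul1r.
move: hX; rewrite /dchain /dvalue dpos_dblock dneg_dblock ww -/w => hX.
have {}hX : ((w - w^*)%:M + ('i * (w + w^*)) *: N m.+1) *m X =
    'i *: (((w + w^*)%:M + ('i * (w - w^*)) *: N m.+1) *m X) *m N k.+1.
  move/(congr1 (mulmx (revmx C m.+1))): hX.
  by rewrite -scalemxAr !mulmxA revmxK !mul1mx -!scalemxAl.
have [ew|nw] := eqVneq (w - w^*) 0; last first.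
  suff -> : X = 0 by rewrite mulmx0 mxE.
  move: hX; rewrite scalemxAl; apply: sylvester_nilp (nil_nilp _ _).
  by apply: (unitmx_nilp (k := m.+1)); rewrite ?expmxZ ?nil_nilp ?scaler0.
have wR : w^* = w by apply/esym/eqP; rewrite -subr_eq0 ew.
have w0 : w != 0 by rewrite -normr_eq0 w1 oner_eq0.
have w2 : w + w != 0 by rewrite -mulr2n -mulr_natl mulf_neq0 ?pnatr_eq0.
rewrite ew mulr0 scale0r addr0 wR in hX *; rewrite raddf0 add0r in hX.
have NX : N m.+1 *m X = X *m N k.+1.
  apply: (scalerI (mulf_neq0 (neq0Ci C) w2)).
  by rewrite scalemxAl hX mul_scalar_mx -!scalemxAl scalerA.
rewrite mul_mx_scalar -scalemxAr -scalemxAl mxE -mulmxA.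
have -> : (X^H *m (revmx C m.+1 *m X)) 0 ord_max = (X 0 0)^* * X ord_max ord_max.
  rewrite mxE (bigD1 0) //= big1 => [|a a0].
    by rewrite addr0 adjE mul_revmx; congr (_ * X _ _); apply: val_inj; rewrite /=
      subSS subn0.
  by rewrite adjE (intertwine_first_col NX a0) conjC0 mul0r.
have [mk|km|e] := ltngtP m k.
- by rewrite (intertwine_lt NX mk) conjC0 mul0r mulr0.
- have hm : (m - k.+1 < m.+1)%N by lia.
  have := congr1 (fun Y : 'M_(m.+1, k.+1) => Y (Ordinal hm) ord_max)
    (intertwine_pow k.+1 NX).
  rewrite nil_nilp mulmx0 [RHS]mxE (@mul_nilX_l _ _ _ _ _ _ ord_max) /=; last by lia.
  by move=> ->; rewrite !mulr0.
have eX : X ord_max ord_max = X 0 0.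
  clear -e NX; subst m.
  have := congr1 (fun Y : 'M_(k.+1, k.+1) => Y 0 ord_max) (intertwine_pow k NX).
  by rewrite /= (@mul_nilX_l _ _ _ _ _ _ ord_max) // (@mul_nilX_r _ _ _ _ _ _ _ 0).
rewrite eX [_^* * _]mulrC -normCK.
have [e1|n1] := eqVneq w 1.
  have -> : X 0 0 = 0 by apply: hK; rewrite e vuw e1 mulr1.
  by rewrite normr0 expr0n mulr0.
have -> : w = -1.
  have : (w - 1) * (w + 1) = 0.
    have : w * w^* = 1 by rewrite -normCK w1 expr1n.
    rewrite wR => h; have -> : (w - 1) * (w + 1) = w * w - 1 by ring.
    by rewrite h subrr.
  move/eqP; rewrite mulf_eq0 subr_eq0 (negPf n1) /= addr_eq0.
  by move/eqP.
by rewrite -opprD mulNr oppr_le0 mulr_ge0 ?exprn_ge0 ?addr_ge0 ?ler01.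
Qed.

Lemma unitmx_antidiag n (A B : 'M[C]_n) : A \in unitmx -> B \in unitmx ->
  block_mx 0 A B 0 \in unitmx.
Proof.
move=> Au Bu; have : block_mx 0 A B 0 *m block_mx 0 (invmx B) (invmx A) 0 = 1%:M.
  by rewrite mulmx_block !(mulmx0, mul0mx, addr0, add0r) !mulmxV // -scalar_mx_block.
by case/mulmx1_unit.
Qed.

(** The blocks of [dneg] have the single eigenvalues [conj u - u conj mu] and [conj u mu - u],
    nonzero since [|mu| > 1]; so there is no nonzero chain at [0]. *)
Lemma dvalue_hblock m mu X : 1 < `|mu| -> dchain (hblock m mu) X ->
  dvalue (hblock m mu) X = 0.
Proof.
move=> mu1; have u0 : u != 0 by rewrite -normr_eq0 u1 oner_eq0.
rewrite /dchain scalemxAl scalemxAl => hX.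
suff -> : X = 0 by rewrite /dvalue mulmx0 mxE.
apply: sylvester_nilp hX; last exact: nil_nilp.
rewrite /dneg /hblock adj_block !adj0 adj1 !scale_block_mx opp_block_mx add_block_mx.
rewrite !scaler0 !oppr0 !addr0; apply: unitmx_antidiag.
  rewrite adj_jblock scalerDr opprD addrA.
  have -> : u^* *: 1%:M - u *: (mu^*)%:M = (u^* - u * mu^*)%:M :> 'M[C]_m.
    by rewrite !scale_scalar_mx mulr1 raddfB.
  rewrite -scaleNr; apply: (unitmx_nilp (k := m)).
    by rewrite expmxZ adj_nil_nilp scaler0.
  rewrite subr_eq0; apply/eqP => /(congr1 (fun x => `|x|)).
  rewrite normrM !norm_conjC u1 mul1r => e.
  by move: mu1; rewrite -e ltxx.
rewrite jblockE scalerDr addrAC.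
have -> : u^* *: mu%:M - u *: 1%:M = (u^* * mu - u)%:M :> 'M[C]_m.
  by rewrite !scale_scalar_mx mulr1 raddfB.
apply: (unitmx_nilp (k := m)); first by rewrite expmxZ nil_nilp scaler0.
rewrite subr_eq0; apply/eqP => /(congr1 (fun x => `|x|)).
rewrite normrM !norm_conjC u1 mul1r => e.
by move: mu1; rewrite e ltxx.
Qed.

Lemma dvalue_jblock r X : dchain (N r) X -> dvalue (N r) X = 0.
Proof.
move=> hX; have u0 : u != 0 by rewrite -normr_eq0 u1 oner_eq0.
have Pu : 1%:M - 'i *: N k.+1 \in unitmx.
  rewrite -scaleNr; apply: (unitmx_nilp (k := k.+1)); last exact: oner_neq0.
  by rewrite expmxZ nil_nilp scaler0.
(* Solving the chain equation for [N X] makes the parameter, up to a factor, the Cayley transform of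
   [i N]. The odd rows of [X] then vanish, and [X^H N X] pairs only rows of opposite parity. *)
have {}hX : N r *m X = (N r)^H *m X *m
    (((u^*)^-1 * u) *: ((1%:M + 'i *: N k.+1) *m invmx (1%:M - 'i *: N k.+1))).
  rewrite -scalemxAr mulmxA; apply: (can_inj (mulmxK Pu)).
  rewrite -scalemxAl mulmxKV //; apply: (@scalerI _ _ u^*); first by rewrite
    conjC_eq0.
  rewrite scalerA mulrA mulfV ?conjC_eq0 // mul1r.
  move: hX; rewrite /dchain /dneg /dpos mulmxBl (mulmxDl (u^* *: N r)) -!scalemxAl.
  move: (N r *m X) ((N r)^H *m X) => a b.
  rewrite mulmxDl mulmxBr mulmxDr !mulmx1 -!scalemxAl -!scalemxAr.
  move: (a *m _) (b *m _) => a' b' /matrixP h.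
  apply/matrixP=> x y; move: (h x y); rewrite !mxE => hxy.
  have -> : u^* * (a x y - 'i * a' x y) =
      (u^* * a x y - u * b x y) + u * b x y - u^* * ('i * a' x y) by ring.
  by rewrite hxy; ring.
have e1 : X^H *m N r *m X = 0.
  apply/matrixP=> i j; rewrite -mulmxA mxE [RHS]mxE big1 // => b _; rewrite adjE.
  have [ob|eb] := boolP (odd b); first by rewrite (jblock_odd_rows _ hX ob) conjC0
    mul0r.
  have [hb|hb] := ltnP b.+1 r; last by rewrite mul_nil_last // mulr0.
  by rewrite (mul_nil_lt _ _ hb) [X (Ordinal hb) j](jblock_odd_rows _ hX) ?mulr0.
have e2 : X^H *m (N r)^H *m X = 0.
  by apply: adj_inj; rewrite adj_form adjK e1 adj0.
by rewrite /dvalue /dpos mulmxDr mulmxDl -!scalemxAr -!scalemxAl e1 e2 !scaler0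
  addr0 mxE.
Qed.

Local Notation T := (BD k.+1 u : btype C).

Lemma dvalue_upper (ts : seq (btype C)) : all (@bvalid C) ts ->
  exists K : 'M[C]_(count_mem T ts, bsdim ts), forall X,
    dchain (bsum ts) X -> K *m col 0 X = 0 -> dvalue (bsum ts) X <= 0.
Proof.
elim: ts => [|t ts IH].
  by move=> _; exists 0 => X _ _; rewrite /dvalue mxE big_ord0.
case/andP=> vt /IH[K hK].
have [Kt hKt] : exists Kt : 'M[C]_((t == T)%N, bdim t), forall X,
    dchain (bmx t) X -> Kt *m col 0 X = 0 -> dvalue (bmx t) X <= 0.
  case: t vt => [[[m mu]|[m v]]|r] /=.
  - by case/andP=> _ mu1; exists 0 => X h _; rewrite dvalue_hblock.
  - by case: m => // m /andP[_ /eqP v1]; apply: dvalue_dblock.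
  - by move=> _; exists 0 => X h _; rewrite dvalue_jblock.
exists (block_mx Kt 0 0 K) => X.
rewrite -[X](@vsubmxK _ (bdim t) (bsdim ts)); move: (usubmx X) (dsubmx X) => X1 X2.
case/dchain_dsum=> h1 h2 hc; rewrite [X in X <= 0]dvalue_dsum.
have ec : col 0 (col_mx X1 X2) = col_mx (col 0 X1) (col 0 X2) by rewrite col_col_mx.
have {}hc : block_mx Kt 0 0 K *m col_mx (col 0 X1) (col 0 X2) = 0.
  by rewrite -ec; exact: hc.
have : col_mx (Kt *m col 0 X1) (K *m col 0 X2) = col_mx 0 0.
  by rewrite col_mx0 -[RHS]hc mul_block_col !mul0mx addr0 add0r.
case/eq_col_mx=> e1 e2; rewrite -[X in _ <= X]addr0.
by apply: lerD; [apply: hKt | apply: hK].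
Qed.

Lemma dvalue_lower (ts : seq (btype C)) :
  exists (X : 'cV[C]_(count_mem T ts) -> 'M[C]_(bsdim ts, k.+1))
      (L : 'M[C]_(bsdim ts, count_mem T ts)),
    forall c, [/\ dchain (bsum ts) (X c), col 0 (X c) = L *m c
      & dvalue (bsum ts) (X c) = 2%:R * (c^H *m c) 0 0].
Proof.
have z n (A : 'M[C]_n) : exists (X : 'cV[C]_0 -> 'M[C]_(n, k.+1)) (L : 'M[C]_(n, 0)),
    forall c, [/\ dchain A (X c), col 0 (X c) = L *m c
      & dvalue A (X c) = 2%:R * (c^H *m c) 0 0].
  exists (fun=> 0), 0 => c; split.
  - by rewrite /dchain !(mulmx0, mul0mx) scaler0.
  - by rewrite mul0mx col0.
  - by rewrite /dvalue mulmx0 !mxE big_ord0 mulr0.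
elim: ts => [|t ts [X2 [L2 h2]]]; first exact: z.
have [X1 [L1 h1]] : exists (X : 'cV[C]_(t == T) -> 'M[C]_(bdim t, k.+1))
      (L : 'M[C]_(bdim t, (t == T))), forall c,
    [/\ dchain (bmx t) (X c), col 0 (X c) = L *m c
      & dvalue (bmx t) (X c) = 2%:R * (c^H *m c) 0 0].
  have [->|_] := eqVneq t T; last exact: z.
  have uu : u^* * u = 1 by rewrite mulrC -normCK u1 expr1n.
  have ep : dpos (u *: dblock C k.+1) = 2%:R *: revmx C k.+1.
    rewrite dpos_dblock uu [u * _]mulrC uu subrr mulr0 scale0r addr0 mul_mx_scalar.
    by rewrite -mulr2n.
  have en : dneg (u *: dblock C k.+1) = ('i * 2%:R) *: (revmx C k.+1 *m N k.+1).
    rewrite dneg_dblock uu [u * _]mulrC uu subrr raddf0 add0r -scalemxAr.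
    by rewrite -mulr2n.
  exists (fun c => c 0 0 *: 1%:M), (delta_mx 0 0) => c; split.
  - rewrite /dchain ep en -!scalemxAr -!scalemxAl !mulmx1 !scalerA.
    by congr (_ *: _); ring.
  - apply/matrixP=> a b; rewrite (ord1 b) !mxE big_ord1 !mxE eqxx andbT.
    by rewrite mulrC; case: (a == 0); rewrite ?mulr1 ?mulr0.
  - rewrite /dvalue ep adjZ adj1 -!scalemxAr -!scalemxAl mulmx1 mul1mx.
    by rewrite !mxE big_ord1 adjE /= eqxx mulr1 [c 0 0 * _]mulrC -!mulrA.
pose c1 := nat_of_bool (t == T); pose c2 := count_mem T ts.
exists (fun c : 'cV_(c1 + c2) => col_mx (X1 (usubmx c)) (X2 (dsubmx c))),
  (block_mx L1 0 0 L2 : 'M_(bdim t + bsdim ts, c1 + c2)) => c.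
have [a1 a2 a3] := h1 (usubmx c); have [b1 b2 b3] := h2 (dsubmx c).
split; first exact/dchain_dsum.
  by rewrite col_col_mx a2 b2 -{3}[c](@vsubmxK _ c1 c2) mul_block_col !mul0mx addr0
    add0r.
rewrite [LHS]dvalue_dsum a3 b3 -mulrDr -{5 6}[c](@vsubmxK _ c1 c2) adj_col
  mul_row_col.
by congr (_ * _); rewrite [RHS]mxE.
Qed.

Lemma count_BD_le (ts ts' : seq (btype C)) : all (@bvalid C) ts' ->
  congruent (bsum ts) (bsum ts') -> (count_mem T ts <= count_mem T ts')%N.
Proof.
move=> vts' [S [R [SR RS eA]]].
have [K hK] := dvalue_upper vts'; have [X [L hL]] := dvalue_lower ts.
rewrite leqNgt; apply/negP => /(kernel_vector (K *m R *m L))[c c0 hc].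
have [hX hcol hv] := hL c.
have eA' : (bsum ts')^H = S^H *m (bsum ts)^H *m S by rewrite eA adj_form.
have ep : dpos (bsum ts') = S^H *m dpos (bsum ts) *m S.
  by rewrite /dpos eA' eA mulmxDr mulmxDl -!scalemxAr -!scalemxAl.
have en : dneg (bsum ts') = S^H *m dneg (bsum ts) *m S.
  by rewrite /dneg eA' eA mulmxBr mulmxBl -!scalemxAr -!scalemxAl.
have : dvalue (bsum ts') (R *m X c) <= 0.
  apply: hK.
    rewrite /dchain ep en -!mulmxA (mulmxA S) SR mul1mx (mulmxA S R) SR mul1mx.
    by rewrite hX -scalemxAr !mulmxA.
  by rewrite colE -mulmxA -colE hcol !mulmxA.
rewrite /dvalue ep adjM -!mulmxA (mulmxA S) SR mul1mx (mulmxA R^H) -adjM SR adj1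
  mul1mx.
rewrite mulmxA -/(dvalue _ _) hv => h.
have e : (c^H *m c) 0 0 = 0.
  apply/eqP; rewrite eq_le; apply/andP; split.
    by move: h; rewrite pmulr_rle0 // ltr0n.
  rewrite mxE sumr_ge0 // => i _; rewrite adjE mulrC -normCK exprn_ge0 //.
by move/sqnorm_eq0: e => e; rewrite e eqxx in c0.
Qed.
End DCount.

Lemma count_BD_congruent (C : numClosedFieldType) (ts ts' : seq (btype C)) k u :
  all (@bvalid C) ts -> all (@bvalid C) ts' -> congruent (bsum ts) (bsum ts') ->
  count_mem (BD k u : btype C) ts = count_mem (BD k u : btype C) ts'.
Proof.
move=> vts vts' cA.
have [v|nv] := boolP (bvalid (BD k u : btype C)); last first.
  have z us : all (@bvalid C) us -> count_mem (BD k u : btype C) us = 0%N.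
    move=> vus; apply/eqP; rewrite -leqn0 leqNgt -has_count has_pred1.
    by apply: contra nv => /(allP vus).
  by rewrite !z.
case: k v => // k /andP[_ /eqP u1]; apply/eqP; rewrite eqn_leq !count_BD_le //.
exact: congruent_sym.
Qed.

Lemma perm_congruent (C : numClosedFieldType) (ts ts' : seq (btype C)) :
  all (@bvalid C) ts -> all (@bvalid C) ts' -> congruent (bsum ts) (bsum ts') ->
  perm_eq ts ts'.
Proof.
move=> vts vts' cA; apply/allP => t _ /=; apply/eqP.
case: t => [[[k l]|[k v]]|r].
- exact: count_BH_congruent.
- exact: count_BD_congruent.
- exact: count_BJ_congruent.
Qed.

(** * From congruence to pairs *)

Section Angle.
Variable R : realType.
Implicit Types (t : R) (z : R[i]).

Lemma norm_expi t : `|expi t| = 1.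
Proof. by rewrite normc_def /= cos2Dsin2 sqrtr1. Qed.

(** [acos] reaches only the upper half circle; the lower half is reflected, which keeps the value in
    [[0, 2 pi)]. *)
Definition angle z : R :=
  let: (a +i* b)%C := z in if 0 <= b then acos a else pi *+ 2 - acos a.

Lemma angleP z : `|z| = 1 -> expi (angle z) = z /\ 0 <= angle z < 2 * pi.
Proof.
case: z => a b; rewrite normc_def /= => -[h].
have pi0 : 0 < pi :> R by apply: pi_gt0.
have {}h : a ^+ 2 + b ^+ 2 = 1.
  by rewrite -[LHS]sqr_sqrtr ?h ?expr1n // addr_ge0 ?sqr_ge0.
have ha : -1 <= a <= 1.
  by rewrite -ler_norml -(@ler_pXn2r _ 2) ?nnegrE // expr1n real_normK ?num_real //
    -h lerDl sqr_ge0.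
have [h1 h2] := acos_def ha.
have hs : sin (acos a) = `|b|.
  by rewrite sin_acos // -h addrAC subrr add0r sqrtr_sqr.
rewrite /angle /expi; case: ifP => b0.
  rewrite h2 hs ger0_norm //; split=> //.
  by have /andP[-> h3] := h1; rewrite (le_lt_trans h3) // mulr_natl mulr2n ltrDl.
have {}b0 : b < 0 by rewrite ltNge b0.
rewrite addrC cosD2pi cosN sinD2pi sinN h2 hs ltr0_norm // opprK; split=> //.
have a1 : a < 1.
  rewrite lt_neqAle; have /andP[_ ->] := ha; rewrite andbT.
  apply: contraTneq b0 => a1; have /eqP : b ^+ 2 = 0 by move: h; rewrite a1 expr1n;
    lra.
  by rewrite sqrf_eq0 => /eqP->; rewrite ltxx.
have : 0 < acos a by apply: acos_gt0; rewrite a1 andbT; case/andP: ha.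
have /andP[_ h3] := h1 => h4.
rewrite mulr_natl mulr2n; apply/andP; split; lra.
Qed.

Lemma expi_inj t t' : 0 <= t < 2 * pi -> 0 <= t' < 2 * pi -> expi t = expi t' -> t
  = t'.
Proof.
have pi0 : 0 < pi :> R by apply: pi_gt0.
wlog le_tt' : t t' / t <= t'.
  by move=> W ht ht' e; have [h|h] := leP t t'; [|symmetry]; apply: W => //; apply:
    ltW.
move=> /andP[t0 t2] /andP[t0' t2'] [ec es].
have [t'pi|t'pi] := leP t' pi.
  by apply: cos_inj => //; rewrite in_itv /=; apply/andP; split; lra.
have sneg x : pi < x -> x < 2 * pi -> sin x < 0.
  move=> h1 h2; have : 0 < sin (x - pi) by apply: sin_gt0_pi; apply/andP; split; lra.
  by rewrite -[in sin x](subrK pi x) sinDpi oppr_lt0.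
have [tpi|tpi] := leP t pi.
  have : 0 <= sin t by apply: sin_ge0_pi; apply/andP.
  by rewrite es leNgt sneg.
(* Both angles exceed [pi]; the shift moves them into the interval on which the cosine is
   injective. *)
have : t - pi = t' - pi.
  apply: cos_inj; [rewrite in_itv /=; apply/andP; split; lra..|].
  apply: oppr_inj; rewrite -!cosDpi !subrK //.
lra.
Qed.
End Angle.

(** * Canonical data as lists of blocks *)

Section Transfer.
Variable R : realType.
Local Notation C := R[i].

Lemma JordanE n (l : C) : Jordan n l = jblock n l.
Proof. by apply/matrixP=> a b; rewrite !mxE. Qed.

Lemma HmxE n (l : C) : Hmx n l = hblock n l.
Proof. by rewrite /Hmx JordanE. Qed.

Lemma DeltaE n : Delta R n = dblock C n.
Proof. by apply/matrixP=> a b; rewrite !mxE complexiE. Qed.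

Lemma congruent_mxdiag p (d : 'I_p -> nat) (B : forall i, 'M[C]_(d i))
    (t : 'I_p -> btype C) :
  (forall i, congruent (B i) (bmx (t i))) ->
  congruent (\mxdiag_i B i) (bsum [seq t i | i <- enum 'I_p]).
Proof.
elim: p d B t => [|p IH] d B t h.
  by apply: congruent_empty; rewrite ?big_ord0 // enum_ord0.
rewrite mxdiag_recl enum_ordSl /= -map_comp.
apply: (congruent_trans (congruent_sym (congruent_cast _ _))).
apply: congruent_dsum (h _) _.
by apply: (IH _ (fun i => B (lift ord0 i)) (fun i => t (lift ord0 i))).
Qed.

Lemma perm_bij (T : eqType) p p' (F : 'I_p -> T) (F' : 'I_p' -> T) :
  perm_eq [seq F i | i <- enum 'I_p] [seq F' i | i <- enum 'I_p'] ->
  exists2 f : 'I_p -> 'I_p', bijective f & forall i, F' (f i) = F i.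
Proof.
move=> h; have e : p = p'.
  by have := perm_size h; rewrite [LHS]size_map [RHS]size_map !size_enum_ord.
subst p'; have /tuple_permP[s hs] : perm_eq [tuple F i | i < p] [tuple F' i | i < p].
  exact: h.
exists s; first exact: (Bijective (permK s) (permKV s)).
move=> i; have := congr1 (fun r => nth (F i) r i) hs.
by rewrite -tnth_nth tnth_mktuple -tnth_nth !tnth_mktuple.
Qed.

Definition block_list p q s (m : 'I_p -> nat) (mu : 'I_p -> C) (n : 'I_q -> nat)
    (v : 'I_q -> C) (r : 'I_s -> nat) : seq (btype C) :=
  [seq BH (m l) (mu l) | l <- enum 'I_p] ++ [seq BD (n j) (v j) | j <- enum 'I_q]
  ++ [seq BJ (r k) | k <- enum 'I_s].

Lemma congruent_block_list p q s (m : 'I_p -> nat) (mu : 'I_p -> C)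
    (n : 'I_q -> nat) (theta : 'I_q -> R) (r : 'I_s -> nat) :
  congruent (dsummx (dsummx (\mxdiag_l Hmx (m l) (mu l))
                            (\mxdiag_j (expi (theta j) *: Delta R (n j))))
                    (\mxdiag_k Jordan (r k) (0 : C)))
            (bsum (block_list m mu n (fun j => expi (theta j)) r)).
Proof.
apply: congruent_trans (congruent_sym (bsum_cat _ _)).
apply: (congruent_trans (congruent_sym (congruent_dsumA _ _ _))).
apply: congruent_dsum.
  by apply: congruent_mxdiag => l; rewrite HmxE; apply: congruent_refl.
apply: congruent_trans (congruent_sym (bsum_cat _ _)); apply: congruent_dsum.
  by apply: congruent_mxdiag => j; rewrite DeltaE; apply: congruent_refl.
by apply: congruent_mxdiag => k; rewrite JordanE; apply: congruent_refl.
Qed.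

Definition blocks_of n (c : canonical_data R n) : seq (btype C) :=
  block_list (@cf_m R n c) (@cf_mu R n c) (@cf_n R n c)
    (fun j => expi (cf_theta j)) (@cf_r R n c).

Lemma blocks_of_valid n (c : canonical_data R n) : all (@bvalid C) (blocks_of c).
Proof.
rewrite /blocks_of /block_list !all_cat !all_map; apply/and3P; split; apply/allP=>
  i _ /=.
- by rewrite cf_m_gt0 cf_mu_gt1.
- by rewrite cf_n_gt0 norm_expi eqxx.
- exact: cf_r_gt0.
Qed.

Lemma congruent_canonical n (c : canonical_data R n) :
  congruent (canonical_pair_E c).2 (bsum (blocks_of c)).
Proof.
apply: (congruent_trans (congruent_sym (congruent_cast _ _))).
exact: congruent_block_list.
Qed.

(** Filtering by constructor separates the three families, and the angles are recovered from [expi],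
    which is injective on [[0, 2 pi)]. *)
Lemma perm_same n (c c' : canonical_data R n) :
  perm_eq (blocks_of c) (blocks_of c') -> same_up_to_perm c c'.
Proof.
pose isH (t : btype C) := if t is BH _ _ then true else false.
pose isD (t : btype C) := if t is BD _ _ then true else false.
pose isJ (t : btype C) := if t is BJ _ then true else false.
have ft (T : Type) (I : Type) (f : I -> T) (a : pred T) (s : seq I) :
    (forall i, a (f i)) -> [seq x <- [seq f i | i <- s] | a x] = [seq f i | i <- s].
  by move=> h; elim: s => //= i s ->; rewrite h.
have ff (T : Type) (I : Type) (f : I -> T) (a : pred T) (s : seq I) :
    (forall i, a (f i) = false) -> [seq x <- [seq f i | i <- s] | a x] = [::].
  by move=> h; elim: s => //= i s ->; rewrite h.
have fH (c0 : canonical_data R n) : filter isH (blocks_of c0) =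
    [seq BH (cf_m l) (cf_mu l) | l : 'I_(cf_p c0) <- enum 'I_(cf_p c0)].
  by rewrite !filter_cat ft // ff // ff // !cats0.
have fD (c0 : canonical_data R n) : filter isD (blocks_of c0) =
    [seq BD (cf_n j) (expi (cf_theta j)) | j : 'I_(cf_q c0) <- enum 'I_(cf_q c0)].
  by rewrite !filter_cat ff // ft // ff // cats0.
have fJ (c0 : canonical_data R n) : filter isJ (blocks_of c0) =
    [seq BJ (cf_r k) | k : 'I_(cf_s c0) <- enum 'I_(cf_s c0)].
  by rewrite !filter_cat ff // ff // ft.
move=> h; split.
- have := perm_filter isH h; rewrite !fH => /perm_bij[f fB hf].
  by exists f => // l; case: (hf l).
- have := perm_filter isD h; rewrite !fD => /perm_bij[f fB hf].
  exists f => // j; case: (hf j) => -> e1 e2; split=> //.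
  by apply: expi_inj; rewrite ?cf_theta_itv // /expi e1 e2.
- have := perm_filter isJ h; rewrite !fJ => /perm_bij[f fB hf].
  by exists f => // k; case: (hf k).
Qed.

Lemma exists_canonical n (A : 'M[C]_n) :
  exists c : canonical_data R n, congruent A (canonical_pair_E c).2.
Proof.
have [ts vts cA] := decomposition A.
pose hs := pmap (fun t : btype C => if t is BH k l then Some (k, l) else None) ts.
pose ds := pmap (fun t : btype C => if t is BD k v then Some (k, v) else None) ts.
pose rs := pmap (fun t : btype C => if t is BJ r then Some r else None) ts.
have pts : perm_eq ts ([seq inl (inl x) | x <- hs] ++ [seq inl (inr x) | x <- ds]
    ++ [seq BJ r | r <- rs]).
  rewrite /hs /ds /rs; elim: (ts) => //= -[[[k l]|[k v]]|r] us IH //=.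
  - by rewrite perm_cons.
  - by rewrite perm_sym perm_catC /= -catA perm_cons perm_sym (perm_trans IH) //
    perm_catC -catA.
  - rewrite perm_sym catA perm_catC /= perm_cons perm_sym (perm_trans IH) //.
    by rewrite catA perm_catC.
have vhs x : x \in hs -> (0 < x.1)%N && (1 < `|x.2|).
  rewrite mem_pmap => /mapP[[[[k l]|t]|t] tin] // [->].
  exact: (allP vts _ tin).
have vds x : x \in ds -> (0 < x.1)%N && (`|x.2| == 1).
  rewrite mem_pmap => /mapP[[[t|[k v]]|t] tin] // [->].
  exact: (allP vts _ tin).
have vrs r : r \in rs -> (0 < r)%N.
  rewrite mem_pmap => /mapP[[t|r'] tin] // [->].
  exact: (allP vts _ tin).
pose h (i : 'I_(size hs)) := tnth (in_tuple hs) i.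
pose d (i : 'I_(size ds)) := tnth (in_tuple ds) i.
pose r (i : 'I_(size rs)) := tnth (in_tuple rs) i.
have hP i := vhs _ (mem_tnth i (in_tuple hs)).
have dP i := vds _ (mem_tnth i (in_tuple ds)).
have rP i := vrs _ (mem_tnth i (in_tuple rs)).
have aP i : expi (angle (d i).2) = (d i).2 /\ 0 <= angle (d i).2 < 2 * pi.
  by apply: angleP; have /andP[_ /eqP] := dP i.
have eb : perm_eq ts (block_list (fun i => (h i).1) (fun i => (h i).2)
    (fun i => (d i).1) (fun i => expi (angle (d i).2)) r).
  suff -> : block_list (fun i => (h i).1) (fun i => (h i).2)
    (fun i => (d i).1) (fun i => expi (angle (d i).2)) r =
    [seq inl (inl x) | x <- hs] ++ [seq inl (inr x) | x <- ds] ++ [seq BJ r | r <-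
      rs] by [].
  have et (T U : Type) (s : seq T) (f : T -> U) (g : 'I_(size s) -> U) :
      (forall i, g i = f (tnth (in_tuple s) i)) ->
      [seq g i | i <- enum 'I_(size s)] = [seq f x | x <- s].
    move=> hg; rewrite (eq_map hg) (map_comp f (tnth (in_tuple s))).
    by rewrite (map_tnth_enum (in_tuple s)).
  rewrite /block_list; congr (_ ++ (_ ++ _)); apply: et => i //.
  - by rewrite -/(h i); case: (h i).
  - by have [-> _] := aP i; rewrite -/(d i); case: (d i).
have cA' := congruent_trans (congruent_trans cA (bsum_perm eb))
  (congruent_sym (congruent_block_list _ _ _ _ _)).
exists (@CanonicalData R n _ _ _ (fun i => (h i).1) (fun i => (h i).2)
  (fun i => (d i).1) (fun i => angle (d i).2) r
  (fun i => proj1 (andP (hP i))) (fun i => proj2 (andP (hP i)))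
  (fun i => proj1 (andP (dP i))) (fun i => proj2 (aP i)) rP
  (esym (congruent_dim cA'))).
by apply: (congruent_trans cA'); apply: congruent_cast.
Qed.
End Transfer.

(** * Transformations of pairs *)

Section Pairs.
Variable R : realType.
Local Notation C := R[i].

Lemma adj_castmx m n (e : m = n) (A : 'M[C]_m) :
  (castmx (e, e) A)^H = castmx (e, e) A^H.
Proof. by case: _ / e; rewrite !castmx_id. Qed.

Lemma castmx_scalar m n (e : m = n) (a : C) : castmx (e, e) a%:M = a%:M.
Proof. by case: _ / e; rewrite castmx_id. Qed.

Lemma flat_eq m (A B : 'M[C]_m) : m = 0%N -> A = B.
Proof. by move=> m0; subst m; apply/matrixP=> -[]. Qed.

Lemma adj_mxdiag p (d : 'I_p -> nat) (B : forall i, 'M[C]_(d i)) :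
  (\mxdiag_i B i)^H = \mxdiag_i (B i)^H.
Proof.
elim: p d B => [|p IH] d B; first by apply: flat_eq; rewrite big_ord0.
rewrite !mxdiag_recl adj_castmx adj_block !adj0.
by rewrite (IH _ (fun i => B (lift ord0 i))).
Qed.

Lemma unitmx_jblock0 r : (0 < r)%N -> jblock r (0 : C) \notin unitmx.
Proof.
case: r => // r _; apply/negP => Ju.
have e : jblock r.+1 (0 : C) *m delta_mx 0 (0 : 'I_1) = 0.
  by apply/matrixP=> i j; rewrite -colE !mxE /= if_same.
have : delta_mx 0 (0 : 'I_1) = 0 :> 'cV[C]_r.+1 by rewrite -(mulKmx Ju (delta_mx 0
  0)) e mulmx0.
by move/matrixP/(_ 0 0)/eqP; rewrite !mxE eqxx oner_eq0.
Qed.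

Lemma bsum_unit_regular (ts : seq (btype C)) :
  all (@bvalid C) ts -> (bsum ts \in unitmx) = all (@bregular C) ts.
Proof.
elim: ts => [_|t ts IH /= /andP[vt vts]]; first by rewrite /= unitmxE det_mx00 unitr1.
rewrite unitmx_dsum IH //; congr (_ && _); case: t vt => [t|r] vt.
  by rewrite unitmx_bmx.
by apply/negbTE/unitmx_jblock0.
Qed.

Lemma regular_part_unit n (c : canonical_data R n) : regular_part c \in unitmx.
Proof.
(* Taken with an empty family of nilpotent blocks, so that only the regular part remains. *)
have := congruent_block_list (@cf_m R n c) (@cf_mu R n c) (@cf_n R n c)
  (@cf_theta R n c) (fun k : 'I_0 => 0%N).
move/congruent_unit; rewrite [X in X = _]unitmx_dsum => h.
have : bsum (block_list (@cf_m R n c) (@cf_mu R n c) (@cf_n R n c)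
    (fun j => expi (cf_theta j)) (fun k : 'I_0 => 0%N)) \in unitmx.
  have := blocks_of_valid c; rewrite /blocks_of /block_list !all_cat => /and3P[v1
    v2 _].
  rewrite bsum_unit_regular enum_ord0 /= cats0 all_cat ?v1 ?v2 // !all_map.
  by apply/andP; split; apply/allP.
by rewrite -h => /andP[].
Qed.

(** Invertibility excludes nilpotent blocks, so [v = 0]. This is what lets a single pair [U], [V]
    serve both cases when [E] and [Q] are both nonsingular. *)
Lemma canonical_pair_EQ n (c : canonical_data R n) :
  (canonical_pair_E c).2 \in unitmx -> canonical_pair_E c = canonical_pair_Q c.
Proof.
rewrite (congruent_unit (congruent_canonical c)) (bsum_unit_regular
  (blocks_of_valid c)).
rewrite /blocks_of /block_list !all_cat => /and3P[_ _ h].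
have s0 : cf_s c = 0%N.
  case: (posnP (cf_s c)) => // s0; move: h; rewrite all_map => /allP/(_ (Ordinal s0)).
  by rewrite mem_enum => /(_ isT).
have d0 : (\sum_(k < cf_s c) cf_r k)%N = 0%N.
  by rewrite big1 // => k _; have := ltn_ord k; rewrite {2}s0.
rewrite /canonical_pair_E /canonical_pair_Q; congr (_, _); last first.
  by rewrite (flat_eq (\mxdiag_k Jordan (cf_r k) 0) 1%:M d0).
rewrite /dsummx (flat_eq (\mxdiag_k (Jordan (cf_r k) 0)^t*) 1%:M d0).
by rewrite -scalar_mx_block castmx_scalar.
Qed.

Lemma quotient_congruent a b n (e : (a + b)%N = n) (A : 'M[C]_a) (J : 'M[C]_b) :
  A \in unitmx ->
  castmx (e, e) (dsum A 1%:M) \in unitmx /\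
  exists2 Z, Z *m castmx (e, e) (dsum A 1%:M) = castmx (e, e) (dsum 1%:M J^H)
    & congruent Z^H (castmx (e, e) (dsum A J)).
Proof.
case: _ / e; rewrite !castmx_id => Au; split; first by rewrite unitmx_dsum Au unitmx1.
exists (dsum (invmx A) J^H).
  by rewrite /dsum mulmx_block !(mulmx0, mul0mx, addr0, add0r) mulVmx // mulmx1.
rewrite /dsum adj_block !adj0 adjK; apply: congruent_dsum (congruent_refl _).
exact/congruent_sym/congruent_cosquare.
Qed.

Lemma canonical_Q_quotient n (c : canonical_data R n) :
  (canonical_pair_Q c).2 \in unitmx /\
  exists2 Z, Z *m (canonical_pair_Q c).2 = (canonical_pair_Q c).1
    & congruent Z^H (canonical_pair_E c).2.
Proof.
have := quotient_congruent (cf_dim c) (\mxdiag_k Jordan (cf_r k) (0 : C))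
  (regular_part_unit c).
by rewrite adj_mxdiag.
Qed.

(** [U E V = 1] forces [V = E^-1 U^-1], so the second component is [U^-H (Q E^-1) U^-1]. *)
Lemma transform_E_congruent n (U V E Q : 'M[C]_n) c :
  U \in unitmx -> E \in unitmx -> transform U V E Q = canonical_pair_E c ->
  congruent (Q *m invmx E) (canonical_pair_E c).2.
Proof.
move=> Uu Eu h; apply/congruentP; exists (invmx U); first by rewrite unitmx_inv.
have h1 : U *m E *m V = 1%:M := congr1 fst h.
rewrite -h /= -!mulmxA; congr (_ *m (_ *m _)).
have VE : V = invmx E *m (invmx U *m (U *m E *m V)).
  by rewrite -!mulmxA mulKmx // mulKmx.
by rewrite VE h1 mulmx1.
Qed.

(** [V] cancels in the quotient of the first component by the second, which is [U (E Q^-1) U^H]. *)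
Lemma transform_Q_congruent n (U V E Q : 'M[C]_n) c :
  U \in unitmx -> Q \in unitmx -> transform U V E Q = canonical_pair_Q c ->
  congruent (E *m invmx Q)^H (canonical_pair_E c).2.
Proof.
move=> Uu Qu h; have [Qcu [Z hZ cZ]] := canonical_Q_quotient c.
apply: congruent_trans cZ; apply: (congruent_sym); apply/congruentP.
have UHu : U^H \in unitmx by rewrite unitmx_adj.
have h1 : U *m E *m V = (canonical_pair_Q c).1 := congr1 fst h.
have h2 : (invmx U)^H *m Q *m V = (canonical_pair_Q c).2 := congr1 snd h.
have eZ : Z = U *m (E *m invmx Q) *m U^H.
  apply: (can_inj (mulmxK Qcu)); rewrite hZ -h1 -h2 adjV !mulmxA.
  by rewrite mulmxK // mulmxKV.
exists (invmx U^H); first by rewrite unitmx_inv.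
rewrite eZ !adjM adjK adjV adjK !mulmxA mulVmx // mul1mx mulmxK //.
Qed.

Lemma exists_transform_E n (E Q : 'M[C]_n) : E \in unitmx ->
  exists U V, [/\ U \in unitmx, V \in unitmx
    & exists c, transform U V E Q = canonical_pair_E c].
Proof.
move=> Eu; have [c /congruentP[S Su hS]] := exists_canonical (Q *m invmx E).
exists (invmx S), (invmx E *m S); split.
- by rewrite unitmx_inv.
- by rewrite unitmx_mul unitmx_inv Eu.
exists c; rewrite /transform invmxK -/(adjmx S).
rewrite [canonical_pair_E c]surjective_pairing hS; congr (_, _).
  by rewrite mulmxA mulmxK // mulVmx.
by rewrite !mulmxA.
Qed.

Lemma exists_transform_Q n (E Q : 'M[C]_n) : Q \in unitmx ->
  exists U V, [/\ U \in unitmx, V \in unitmx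
    & exists c, transform U V E Q = canonical_pair_Q c].
Proof.
move=> Qu; have [c cA] := exists_canonical (E *m invmx Q)^H.
have [Qcu [Z hZ cZ]] := canonical_Q_quotient c.
have /congruentP[S Su hS] := congruent_trans cA (congruent_sym cZ).
have eZ : Z = S^H *m (E *m invmx Q) *m S by rewrite -[Z]adjK hS adj_form adjK.
(* With [U = S^H] the second component is [S^-1 Q V], which determines [V]; the first then follows
   from [Z = S^H E Q^-1 S]. *)
exists S^H, (invmx Q *m S *m (canonical_pair_Q c).2); split.
- by rewrite unitmx_adj.
- by rewrite !unitmx_mul unitmx_inv Qu Su Qcu.
exists c; rewrite /transform [RHS]surjective_pairing; congr (_, _).
  by rewrite -hZ eZ !mulmxA.
rewrite -/(adjmx (invmx S^H)) adjV adjK !mulmxA mulmxK // mulVmx // mul1mx.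
by [].
Qed.
End Pairs.

Theorem theorem3p4 (R : realType) (n : nat) (E Q : 'M[R[i]]_n)
    (hEQ : E \in unitmx \/ Q \in unitmx) :
  (exists U V : 'M[R[i]]_n,
     [/\ U \in unitmx,
         V \in unitmx,
         E \in unitmx -> exists c : canonical_data R n,
           transform U V E Q = canonical_pair_E c
       & Q \in unitmx -> exists c : canonical_data R n,
           transform U V E Q = canonical_pair_Q c]) /\
  (E \in unitmx ->
     forall (U V U' V' : 'M[R[i]]_n) (c c' : canonical_data R n),
       U \in unitmx -> V \in unitmx -> U' \in unitmx -> V' \in unitmx ->
       transform U V E Q = canonical_pair_E c ->
       transform U' V' E Q = canonical_pair_E c' ->
       same_up_to_perm c c') /\
  (Q \in unitmx ->
     forall (U V U' V' : 'M[R[i]]_n) (c c' : canonical_data R n),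
       U \in unitmx -> V \in unitmx -> U' \in unitmx -> V' \in unitmx ->
       transform U V E Q = canonical_pair_Q c ->
       transform U' V' E Q = canonical_pair_Q c' ->
       same_up_to_perm c c').
Proof.
have unique (A : 'M[R[i]]_n) (c c' : canonical_data R n) : congruent A
  (canonical_pair_E c).2 ->
    congruent A (canonical_pair_E c').2 -> same_up_to_perm c c'.
  move=> h h'; apply/perm_same/perm_congruent; rewrite ?blocks_of_valid //.
  apply: (congruent_trans (congruent_sym (congruent_canonical c))).
  apply: (congruent_trans (congruent_sym h)); apply: (congruent_trans h').
  exact: congruent_canonical.
split; last first.
  split=> [Eu|Qu] U V U' V' c c' Uu _ U'u _ h h'.
    exact: (unique _ _ _ (transform_E_congruent Uu Eu h) (transform_E_congruent U'u
      Eu h')).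
  exact: (unique _ _ _ (transform_Q_congruent Uu Qu h) (transform_Q_congruent U'u
    Qu h')).
have [Eu|Enu] := boolP (E \in unitmx).
  have [U [V [Uu Vu [c hc]]]] := exists_transform_E Q Eu.
  exists U, V; split=> // [_|Qu]; exists c => //.
  rewrite hc canonical_pair_EQ //.
  by rewrite -(congruent_unit (transform_E_congruent Uu Eu hc)) unitmx_mul
    unitmx_inv Qu.
have Qu : Q \in unitmx by case: hEQ => // Eu; rewrite Eu in Enu.
have [U [V [Uu Vu hc]]] := exists_transform_Q E Qu.
by exists U, V.
Qed.
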